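(* Let $k$ be a field and let $a,b$ be coprime positive integers such that $\mathrm{char}(k)\nmid a$ and $\mathrm{char}(k)\nmid b$. Let $k[s^a,s^b]\subseteq k[s]$ be the numerical semigroup algebra. Then the Hochschild cohomology algebra $\mathrm{HH}^*(k[s^a,s^b])$ is isomorphic to the quotient ring $$k[X_1,X_2,Y_1,Y_2,T]/\mathcal{I},$$ where $k[X_1,X_2,Y_1,Y_2,T]$ is the weighted graded commutative polynomial ring with $\deg(X_1)=\deg(X_2)=0$, $\deg(Y_1)=\deg(Y_2)=1$, $\deg(T)=2$, and $\mathrm{wt}(X_1)=a$, $\mathrm{wt}(X_2)=b$, $\mathrm{wt}(Y_1)=0$, $\mathrm{wt}(Y_2)=ab-a-b$, $\mathrm{wt}(T)=-ab$, and where $\mathcal{I}$ is the ideal generated by $$X_1^b-X_2^a,\quad X_1^{b-1}T,\quad X_2^{a-1}T,\quad Y_2T,\quad Y_1^2,\quad Y_2^2,\quad Y_1Y_2,\quad X_1Y_2-X_2^{a-1}Y_1,\quad X_2Y_2-X_1^{b-1}Y_1 .$$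
   Context: For a commutative $k$-algebra $A$, $\mathrm{HH}^*(A)=\bigoplus_{i\ge 0}\mathrm{Ext}^i_{A^e}(A,A)$ with $A^e=A\otimes_k A^{op}$, made into a $k$-algebra by the cup product (equivalently the Yoneda product). The condition $\mathrm{char}(k)\nmid a$ is automatically satisfied when $\mathrm{char}(k)=0$. ''deg'' is the cohomological degree and ''wt'' is the internal weight induced by giving $s$ weight $1$. The only odd-degree generators are $Y_1,Y_2$, and all products of two of them lie in $\mathcal{I}$, so it makes no difference whether the polynomial ring is taken to be strictly commutative or graded-commutative with respect to deg. *)

(* Defs.v *)
From HB Require Import structures.
From mathcomp Require Import all_boot all_order all_algebra.
From mathcomp Require Import boolp mpoly.
Set Implicit Arguments.
Unset Strict Implicit.
Unset Printing Implicit Defensive.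
Import GRing.Theory.
Local Open Scope ring_scope.
Local Open Scope quotient_scope.

Definition projective (R : pzRingType) (P : lmodType R) : Prop :=
  forall (M N : lmodType R) (g : {linear M -> N}) (f : {linear P -> N}),
    (forall y, exists x, g x = y) ->
    exists h : {linear P -> M}, forall x, g (h x) = f x.

Record projective_resolution (R : pzRingType) (M : lmodType R) := {
  res_obj :> nat -> lmodType R;
  res_d : forall n, {linear res_obj n.+1 -> res_obj n};
  res_aug : {linear res_obj 0%N -> M};
  res_projective : forall n, projective (res_obj n);
  res_aug_surj : forall y, exists x, res_aug x = y;
  res_exact0 : forall x, res_aug x = 0 <-> exists y, res_d 0 y = x;
  res_exactS : forall n x, res_d n x = 0 <-> exists y, res_d n.+1 y = x
}.

Section ProjectiveLift.
Variables (R : pzRingType) (P M N : lmodType R).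
Variables (g : {linear M -> N}) (f : {linear P -> N}).

Definition pullback_pred : {pred (P * M)%type} := [pred z | f z.1 == g z.2].

Fact pullback_closed : GRing.submod_closed pullback_pred.
Proof.
split=> [|c x y]; rewrite !inE /= ?linear0 // => /eqP hx /eqP hy.
by rewrite !linearP hx hy.
Qed.
HB.instance Definition _ :=
  GRing.isSubmodClosed.Build R (P * M)%type pullback_pred pullback_closed.

Record pullback := Pullback
  { pullback_val : (P * M)%type; _ : pullback_val \in pullback_pred }.
HB.instance Definition _ := [isSub for pullback_val].
HB.instance Definition _ := [Choice of pullback by <:].
HB.instance Definition _ := [SubChoice_isSubLmodule of pullback by <:].

Lemma projective_lift : projective P -> (forall x, exists y, g y = f x) ->
  exists h : {linear P -> M}, forall x, g (h x) = f x.
Proof.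
move=> projP fg.
pose p1 : {linear pullback -> P} := fst \o \val.
pose p2 : {linear pullback -> M} := snd \o \val.
have p1_surj y : exists x, p1 x = y.
  have [z hz] := fg y.
  have yz : (y, z) \in pullback_pred by rewrite inE /= hz.
  by exists (Pullback yz).
have [s sK] := projP _ _ p1 idfun p1_surj.
exists (p2 \o s) => x /=.
have /eqP := valP (s x); rewrite -[X in f X = _]/(p1 (s x)) sK /= => <-.
by [].
Qed.

End ProjectiveLift.

Section Cochains.
Variables (k : comNzRingType) (R : algType k) (M : lmodType R).
Variable P : projective_resolution M.

Local Notation d := (res_d P).
Local Notation aug := (res_aug P).

Definition cochain := forall n, P n -> M.
HB.instance Definition _ := Choice.on cochain.

Lemma cochainP (f g : cochain) : (forall n x, f n x = g n x) -> f = g.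
Proof. by move=> fg; apply: functional_extensionality_dep => n; apply/funext. Qed.

Definition cochain_add (f g : cochain) : cochain := fun n x => f n x + g n x.
Definition cochain_opp (f : cochain) : cochain := fun n x => - f n x.
Definition cochain_zero : cochain := fun _ _ => 0.
(* k acts on M through the central elements c%:A of R. *)
Definition cochain_scale (c : k) (f : cochain) : cochain :=
  fun n x => c%:A *: f n x.

Fact cochain_addA : associative cochain_add.
Proof. by move=> f g h; apply: cochainP => n x; rewrite /cochain_add addrA. Qed.
Fact cochain_addC : commutative cochain_add.
Proof. by move=> f g; apply: cochainP => n x; rewrite /cochain_add addrC. Qed.
Fact cochain_add0 : left_id cochain_zero cochain_add.
Proof. by move=> f; apply: cochainP => n x; rewrite /cochain_add add0r. Qed.
Fact cochain_addN : left_inverse cochain_zero cochain_opp cochain_add.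
Proof. by move=> f; apply: cochainP => n x; rewrite /cochain_add addNr. Qed.
HB.instance Definition _ := GRing.isZmodule.Build cochain
  cochain_addA cochain_addC cochain_add0 cochain_addN.

Fact cochain_scaleA c c' f :
  cochain_scale c (cochain_scale c' f) = cochain_scale (c * c') f.
Proof.
by apply: cochainP => n x; rewrite /cochain_scale scalerA -scalerAl mul1r scalerA.
Qed.
Fact cochain_scale1 : left_id 1 cochain_scale.
Proof. by move=> f; apply: cochainP => n x; rewrite /cochain_scale !scale1r. Qed.
Fact cochain_scaleDr : right_distributive cochain_scale +%R.
Proof. by move=> c f g; apply: cochainP => n x; apply: scalerDr. Qed.
Fact cochain_scaleDl f : {morph cochain_scale^~ f : c c' / c + c'}.
Proof.
by move=> c c'; apply: cochainP => n x; rewrite /cochain_scale !scalerDl.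
Qed.
HB.instance Definition _ := GRing.Zmodule_isLmodule.Build k cochain
  cochain_scaleA cochain_scale1 cochain_scaleDr cochain_scaleDl.

Definition closed (f : cochain) : Prop :=
  forall n, linear (f n) /\ forall x, f n (d n x) = 0.

Definition coboundary_at n : (P n -> M) -> Prop :=
  match n with
  | 0%N => fun f => forall x, f x = 0
  | m.+1 => fun f => exists h : {linear P m -> M}, forall x, f x = h (d m x)
  end.

Definition coboundary (f : cochain) : Prop := forall n, coboundary_at (f n).

(* A class in the direct sum of the Ext^n is represented by a family of cocycles,
   one in each degree, all but finitely many of which are coboundaries. *)
Definition almost_coboundary (f : cochain) : Prop :=
  exists N, forall n, (N <= n)%N -> coboundary_at (f n).

Lemma central_linear (U V : lmodType R) (c : k) (h h' : U -> V) :
  linear h -> linear h' -> linear (fun x => c%:A *: h x + h' x).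
Proof.
move=> hl hl' a x y; rewrite hl hl' !scalerDr !scalerA.
by rewrite -scalerAl -scalerAr mul1r mulr1 -!addrA; congr (_ + _); rewrite addrCA.
Qed.

Lemma lin_pack (U V : lmodType R) (h : U -> V) :
  linear h -> {h' : {linear U -> V} | forall x, h' x = h x}.
Proof.
move=> hl.
pose H := GRing.isLinear.Build R U V _ h hl.
pose h' : {linear U -> V} := HB.pack h H.
by exists h'.
Qed.

Lemma cbd_ext n (f g : P n -> M) :
  (forall x, f x = g x) -> coboundary_at f -> coboundary_at g.
Proof.
case: n f g => [|n] f g fg /=; first by move=> h x; rewrite -fg.
by case=> h hf; exists h => x; rewrite -fg.
Qed.

Lemma cbd0 n : coboundary_at (fun _ : P n => 0).
Proof. by case: n => [|n] //=; exists \0 => x. Qed.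

Lemma cbd_lin n (c : k) (f g : P n -> M) : coboundary_at f -> coboundary_at g ->
  coboundary_at (fun x => c%:A *: f x + g x).
Proof.
case: n f g => [|n] f g /=; first by move=> hf hg x; rewrite hf hg scaler0 addr0.
case=> h hf [h' hg].
have [u hu] : {u : {linear P n -> M} | forall x, u x = c%:A *: h x + h' x}.
  by apply: lin_pack; apply: central_linear; apply: linearP.
by exists u => x; rewrite hf hg hu.
Qed.

Lemma cbdD n (f g : P n -> M) : coboundary_at f -> coboundary_at g ->
  coboundary_at (fun x => f x + g x).
Proof.
move=> hf hg; apply: cbd_ext (cbd_lin 1 hf hg) => x.
by rewrite scale1r scale1r.
Qed.

Definition cocycle_pred : {pred cochain} :=
  [pred f | `[< closed f /\ almost_coboundary f >]].

Lemma closed_lin c f g : closed f -> closed g -> closed (c *: f + g : cochain).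
Proof.
move=> hf hg n; have [fl fd] := hf n; have [gl gd] := hg n; split.
  exact: central_linear.
by move=> x; rewrite -[LHS]/(c%:A *: f n _ + g n _) fd gd scaler0 addr0.
Qed.

Fact cocycle_closed : GRing.submod_closed cocycle_pred.
Proof.
split=> [|c f g /asboolP[hf [N hN]] /asboolP[hg [N' hN']]]; apply/asboolP.
  split; first by move=> n; split => [a x y|//]; rewrite scaler0 addr0.
  by exists 0%N => n _; apply: cbd0.
split; first exact: closed_lin.
exists (maxn N N') => n; rewrite geq_max => /andP[nN nN'].
by apply: cbd_lin; [apply: hN | apply: hN'].
Qed.
HB.instance Definition _ :=
  GRing.isSubmodClosed.Build k cochain cocycle_pred cocycle_closed.

Record cocycle := Cocycle { cocycle_val :> cochain; _ : cocycle_val \in cocycle_pred }.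
Arguments cocycle_val : clear implicits.
HB.instance Definition _ := [isSub for cocycle_val].
HB.instance Definition _ := [Choice of cocycle by <:].
HB.instance Definition _ := [SubChoice_isSubLmodule of cocycle by <:].

Definition coboundary_pred : {pred cocycle} :=
  [pred z | `[< coboundary (cocycle_val z) >]].

Lemma coboundary_lin c f g :
  coboundary f -> coboundary g -> coboundary (c *: f + g : cochain).
Proof. by move=> hf hg n; apply: cbd_lin. Qed.

Lemma coboundaryB f g : coboundary f -> coboundary g -> coboundary (f - g : cochain).
Proof.
by move=> hf hg; rewrite addrC -scaleN1r; apply: coboundary_lin.
Qed.

Lemma coboundaryD f g : coboundary f -> coboundary g -> coboundary (f + g : cochain).
Proof. by move=> hf hg; rewrite -[f]scale1r; apply: coboundary_lin. Qed.

Fact coboundary_zmod_closed : zmod_closed coboundary_pred.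
Proof.
split=> [|f g /asboolP hf /asboolP hg]; apply/asboolP.
  by move=> n; apply: cbd0.
exact: coboundaryB.
Qed.
HB.instance Definition _ :=
  GRing.isZmodClosed.Build cocycle coboundary_pred coboundary_zmod_closed.

(* The direct sum over n of Ext^n_R(M, M), computed from P. *)
Definition Ext := Quotient.quot coboundary_pred.
HB.instance Definition _ := GRing.Zmodule.on Ext.

Definition Ext_class (z : cocycle) : Ext := \pi_Ext z.

Lemma Ext_class_eq z z' :
  Ext_class z = Ext_class z' <-> coboundary (cocycle_val z - cocycle_val z').
Proof.
split=> [/eqP|h]; rewrite /Ext_class.
  by rewrite -Quotient.idealrBE => /asboolP.
by apply/eqP; rewrite -Quotient.idealrBE; apply/asboolP.
Qed.

Lemma Ext_classP (x : Ext) : exists z, x = Ext_class z.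
Proof. by exists (repr x); rewrite /Ext_class reprK. Qed.

Lemma Ext_classD z z' : Ext_class (z + z') = Ext_class z + Ext_class z'.
Proof. by rewrite /Ext_class !piE. Qed.

Definition Ext_scale (c : k) (x : Ext) : Ext := Ext_class (c *: repr x).

Lemma Ext_scaleE c z : Ext_scale c (Ext_class z) = Ext_class (c *: z).
Proof.
apply/Ext_class_eq; rewrite -[X in coboundary X]/(cocycle_val (_ - _)) -scalerBr /=.
rewrite -[X in coboundary X]addr0; apply: coboundary_lin.
  by apply/Ext_class_eq; rewrite /Ext_class reprK.
by move=> n; apply: cbd0.
Qed.

Fact Ext_scaleA c c' x : Ext_scale c (Ext_scale c' x) = Ext_scale (c * c') x.
Proof. by have [z ->] := Ext_classP x; rewrite !Ext_scaleE scalerA. Qed.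
Fact Ext_scale1 : left_id 1 Ext_scale.
Proof. by move=> x; have [z ->] := Ext_classP x; rewrite !Ext_scaleE scale1r. Qed.
Fact Ext_scaleDr : right_distributive Ext_scale +%R.
Proof.
move=> c x y; have [z ->] := Ext_classP x; have [z' ->] := Ext_classP y.
by rewrite -Ext_classD !Ext_scaleE scalerDr Ext_classD.
Qed.
Fact Ext_scaleDl x : {morph Ext_scale^~ x : c c' / c + c'}.
Proof.
move=> c c'; have [z ->] := Ext_classP x.
by rewrite !Ext_scaleE scalerDl Ext_classD.
Qed.
HB.instance Definition _ := GRing.Zmodule_isLmodule.Build k Ext
  Ext_scaleA Ext_scale1 Ext_scaleDr Ext_scaleDl.

(* A cocycle of degree n lifts to a chain map P_(i+n) -> P_i; these are the
   entries G i (i + n).  A cochain g with components in several degrees is lifted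
   by the upper triangular matrix G collecting the lifts of all of them.  The
   chain maps commute with the differentials without sign; the other sign
   conventions give isomorphic algebras, by rescaling Ext^n by (-1)^(n(n-1)/2). *)
Definition lifts (g : cochain) (G : forall i j, P j -> P i) : Prop :=
  [/\ forall i j, linear (G i j),
      forall i j, (j < i)%N -> forall x, G i j x = 0,
      forall j x, aug (G 0%N j x) = g j x
    & forall i j x, d i (G i.+1 j.+1 x) = G i j (d j x)].

Definition yoneda (f : cochain) (G : forall i j, P j -> P i) : cochain :=
  fun j x => \sum_(i < j.+1) f i (G i j x).

Definition at_cycle i : P i -> Prop :=
  match i with
  | 0%N => fun x => aug x = 0
  | i'.+1 => fun x => d i' x = 0
  end.

Lemma at_cycleP i (x : P i) : at_cycle x <-> exists y, d i y = x.
Proof. by case: i x => [|i] x /=; [apply: res_exact0 | apply: res_exactS]. Qed.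

Lemma at_cycle_d i (x : P i.+1) : at_cycle (d i x).
Proof. by apply/at_cycleP; exists x. Qed.

Lemma dd i (x : P i.+2) : d i (d i.+1 x) = 0.
Proof. exact: (at_cycle_d x). Qed.

Lemma augd (x : P 1%N) : aug (d 0 x) = 0.
Proof. exact: (at_cycle_d x). Qed.

Lemma lin0 (U V : lmodType R) (h : U -> V) : linear h -> h 0 = 0.
Proof. by move=> hl; have [h' <-] := lin_pack hl; rewrite linear0. Qed.
Lemma linD (U V : lmodType R) (h : U -> V) x y :
  linear h -> h (x + y) = h x + h y.
Proof. by move=> hl; have [h' hE] := lin_pack hl; rewrite -!hE linearD. Qed.
Lemma linB (U V : lmodType R) (h : U -> V) x y :
  linear h -> h (x - y) = h x - h y.
Proof. by move=> hl; have [h' hE] := lin_pack hl; rewrite -!hE linearB. Qed.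
Lemma linZ (U V : lmodType R) (h : U -> V) c x :
  linear h -> h (c *: x) = c *: h x.
Proof. by move=> hl; have [h' hE] := lin_pack hl; rewrite -!hE linearZ. Qed.
Lemma lin_sum (U V : lmodType R) (h : U -> V) n (F : 'I_n -> U) :
  linear h -> h (\sum_i F i) = \sum_i h (F i).
Proof.
move=> hl; have [h' hE] := lin_pack hl; rewrite -hE linear_sum.
by apply: eq_bigr => i _; rewrite hE.
Qed.
Lemma sum_linear (U V : lmodType R) n (h : 'I_n -> U -> V) :
  (forall i, linear (h i)) -> linear (fun x => \sum_i h i x).
Proof.
move=> hl a x y; rewrite scaler_sumr -big_split /=.
by apply: eq_bigr => i _; rewrite hl.
Qed.
Lemma comp_linear (U V W : lmodType R) (h : V -> W) (h' : U -> V) :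
  linear h -> linear h' -> linear (fun x => h (h' x)).
Proof. by move=> hl hl' a x y; rewrite hl' hl. Qed.

Lemma lift_aug j (f : P j -> M) : linear f ->
  {h : P j -> P 0%N | linear h /\ forall x, aug (h x) = f x}.
Proof.
move=> fl; apply: cid; have [f' fE] := lin_pack fl.
have [h hE] := @res_projective _ _ P j _ _ aug f' (@res_aug_surj _ _ P).
by exists h; split=> [|x]; [apply: linearP | rewrite hE fE].
Qed.

Lemma lift_d i j (f : P j -> P i) : linear f -> (forall x, at_cycle (f x)) ->
  {h : P j -> P i.+1 | linear h /\ forall x, d i (h x) = f x}.
Proof.
move=> fl fc; apply: cid; have [f' fE] := lin_pack fl.
have [|h hE] := projective_lift (g := d i) (f := f') (@res_projective _ _ P j).
  by move=> x; apply/at_cycleP; rewrite fE.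
by exists h; split=> [|x]; [apply: linearP | rewrite hE fE].
Qed.

Definition row i := forall j, P j -> P i.

Section RowRecursion.
Variables (inv : forall i, row i -> Prop) (rel : forall i, row i -> row i.+1 -> Prop).
Hypothesis inv0 : {r : row 0 | inv r}.
Hypothesis step : forall i (r : row i), inv r -> {r' : row i.+1 | inv r' /\ rel r r'}.

Fixpoint rows i : {r : row i | inv r} :=
  match i with
  | 0%N => inv0
  | i'.+1 => let s := step (projT2 (rows i')) in exist _ (projT1 s) (projT2 s).1
  end.

Lemma row_recursion : {G : forall i, row i |
  [/\ forall j, G 0%N j = projT1 inv0 j,
      forall i, inv (G i) & forall i, rel (G i) (G i.+1)]}.
Proof.
exists (fun i => projT1 (rows i)); split=> // i; first exact: projT2 (rows i).
exact: (projT2 (step (projT2 (rows i)))).2.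
Qed.
End RowRecursion.

Lemma lifts_exist (g : cochain) : closed g -> {G : forall i j, P j -> P i | lifts g G}.
Proof.
move=> gc.
pose inv i (r : row i) := [/\ forall j, linear (r j),
  forall j, (j < i)%N -> forall x, r j x = 0
  & forall j x, at_cycle (r j (d j x))].
pose rel i (r : row i) (r' : row i.+1) := forall j x, d i (r' j.+1 x) = r j (d j x).
have inv0 : {r : row 0 | inv 0%N r /\ forall j x, aug (r j x) = g j x}.
  exists (fun j => projT1 (lift_aug (gc j).1)); split; last first.
    by move=> j x; case: (projT2 (lift_aug (gc j).1)).
  split=> // [j|j x]; first by case: (projT2 (lift_aug (gc j).1)).
  by case: (projT2 (lift_aug (gc j).1)) => _ /= ->; apply: (gc j).2.
have step i (r : row i) : inv i r -> {r' : row i.+1 | inv i.+1 r' /\ rel i r r'}.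
  case=> rl r0 rc.
  have hl j : linear (fun x => r j (d j x)).
    by apply: comp_linear => //; apply: linearP.
  pose r' : row i.+1 := fun j => match j with
    | 0%N => fun=> 0
    | j'.+1 => fun x => if (j' < i)%N then 0 else projT1 (lift_d (hl j') (rc j')) x
    end.
  have r'rel : rel i r r'.
    move=> j x /=; case: ifP => ji; first by rewrite linear0 r0.
    by case: (projT2 (lift_d (hl j) (rc j))) => _ ->.
  exists r'; split=> //; split.
  - case=> [|j] a x y /=; first by rewrite scaler0 addr0.
    case: ifP => ji; first by rewrite scaler0 addr0.
    by case: (projT2 (lift_d (hl j) (rc j))) => + _; apply.
  - by case=> [|j] //=; rewrite ltnS => -> x.
  - case=> [|j] x; first by rewrite /= linear0.
    by rewrite /= -/(r' j.+1 _) r'rel dd lin0.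
have [G [G0 Ginv Grel]] :=
  row_recursion (exist _ (projT1 inv0) (projT2 inv0).1) step.
exists G; split.
- by move=> i j; case: (Ginv i).
- by move=> i j ji x; case: (Ginv i) => _ -> //.
- by move=> j x; rewrite G0 /=; apply: (projT2 inv0).2.
- exact: Grel.
Qed.

Lemma yoneda_coboundaryr f g G :
  closed f -> lifts g G -> coboundary g -> coboundary (yoneda f G).
Proof.
move=> fc [Gl Gt Ga Gd] gb.
pose diff i (r : row i) : row i := fun j => match j with
  | 0%N => G i 0%N
  | j'.+1 => fun x => G i j'.+1 x - r j' (d j' x)
  end.
pose inv i (r : row i) :=
  (forall j, linear (r j)) /\ (forall j x, at_cycle (diff i r j x)).
pose rel i (r : row i) (r' : row i.+1) := forall j x, d i (r' j x) = diff i r j x.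
have diffl i r j : (forall j, linear (r j)) -> linear (diff i r j).
  move=> rl; case: j => [|j] //= a x y.
  by rewrite Gl linearP rl scalerBr opprD addrACA.
have inv0 : {r : row 0 | inv 0%N r}.
  have gb' j : {h : {linear P j -> M} | forall x, g j.+1 x = h (d j x)}.
    by apply: cid; apply: (gb j.+1).
  pose r : row 0 := fun j => projT1 (lift_aug (linearP (projT1 (gb' j)))).
  have rE j x : aug (r j x) = projT1 (gb' j) x.
    by rewrite /r; case: (projT2 (lift_aug (linearP (projT1 (gb' j))))).
  exists r; split; first by move=> j; rewrite /r; case: (projT2 (lift_aug (linearP (projT1 (gb' j))))).
  case=> [|j] x /=; first by rewrite Ga; apply: (gb 0%N).
  by rewrite linearB Ga rE -(projT2 (gb' j)) subrr.
have step i (r : row i) : inv i r -> {r' : row i.+1 | inv i.+1 r' /\ rel i r r'}.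
  case=> rl rc.
  pose r' : row i.+1 := fun j => projT1 (lift_d (diffl i r j rl) (rc j)).
  have r'l j : linear (r' j).
    by rewrite /r'; case: (projT2 (lift_d (diffl i r j rl) (rc j))).
  have r'E : rel i r r'.
    by move=> j x; rewrite /r'; case: (projT2 (lift_d (diffl i r j rl) (rc j))).
  exists r'; split=> //; split=> //.
  case=> [|j] x /=; first by rewrite Gt // linear0.
  rewrite linearB Gd r'E; case: j x => [|j] x /=; first by rewrite subrr.
  by rewrite dd lin0 // subr0 subrr.
have [S [_ Sinv Srel]] := row_recursion inv0 step.
case=> [|j].
  move=> x; rewrite /yoneda big_ord1.
  by have /= <- := Srel 0%N 0%N x; apply: (fc 0%N).2.
have hl : linear (fun x : P j => \sum_(i < j.+2) f i (S i j x)).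
  apply: sum_linear => i; apply: comp_linear; first exact: (fc i).1.
  by case: (Sinv i).
exists (projT1 (lin_pack hl)) => x; rewrite (projT2 (lin_pack hl)).
apply: eq_bigr => i _; have /= Sd := Srel i j.+1 x.
have -> : G i j.+1 x = d i (S i.+1 j.+1 x) + S i j (d j x) by rewrite Sd subrK.
by rewrite (linD _ _ (fc i).1) (fc i).2 add0r.
Qed.

Lemma yoneda_coboundaryl f g G :
  coboundary f -> lifts g G -> coboundary (yoneda f G).
Proof.
move=> fb [Gl Gt Ga Gd].
have fb' j : {h : {linear P j -> M} | forall x, f j.+1 x = h (d j x)}.
  by apply: cid; apply: (fb j.+1).
case=> [|j].
  by move=> x; rewrite /yoneda big_ord1; apply: (fb 0%N).
have hl : linear (fun x : P j => \sum_(i < j.+1) projT1 (fb' i) (G i j x)).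
  by apply: sum_linear => i; apply: comp_linear; first exact: linearP.
exists (projT1 (lin_pack hl)) => x; rewrite (projT2 (lin_pack hl)).
have f0 y : f 0%N y = 0 by apply: (fb 0%N).
rewrite /yoneda big_ord_recl /= f0 add0r; apply: eq_bigr => i _.
by rewrite /= (projT2 (fb' i)) Gd.
Qed.

Lemma yoneda_closed f g G : closed f -> lifts g G -> closed (yoneda f G).
Proof.
move=> fc [Gl Gt Ga Gd] j; split.
  by apply: sum_linear => i; apply: comp_linear => //; apply: (fc i).1.
by move=> x; apply: big1 => i _; rewrite -Gd (fc i).2.
Qed.

Lemma yoneda_almost f g G : closed f -> lifts g G ->
  almost_coboundary f -> almost_coboundary g -> almost_coboundary (yoneda f G).
Proof.
move=> fc Glift [N hN] [N' hN']; have [Gl Gt Ga Gd] := Glift.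
pose f1 : cochain := fun i x => if (N <= i)%N then 0 else f i x.
pose f2 : cochain := fun i x => if (N <= i)%N then f i x else 0.
pose g2 : cochain := fun j x => if (N' <= j)%N then g j x else 0.
pose G2 : forall i j, P j -> P i := fun i j x => if (i + N' <= j)%N then G i j x else 0.
have f1c : closed f1.
  move=> n; rewrite /f1; case: (N <= n)%N; last exact: fc.
  by split=> [a x y|//]; rewrite /= scaler0 addr0.
have f2b : coboundary f2.
  by move=> n; rewrite /f2; case: (boolP (N <= n)%N) => [/hN|_]; [|apply: cbd0].
have g2b : coboundary g2.
  by move=> n; rewrite /g2; case: (boolP (N' <= n)%N) => [/hN'|_]; [|apply: cbd0].
have G2l : lifts g2 G2.
  split=> [i j|i j ji x|j x|i j x].
  - rewrite /G2; case: (i + N' <= j)%N; first exact: Gl.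
    by move=> a x y; rewrite /= scaler0 addr0.
  - by rewrite /G2 Gt // if_same.
  - by rewrite /G2 /g2 add0n; case: ifP => _; rewrite ?Ga ?linear0.
  - by rewrite /G2 addSn ltnS; case: ifP => _; rewrite ?Gd ?linear0.
exists (N + N')%N => j jN.
have h1 := yoneda_coboundaryr f1c G2l g2b.
have h2 := yoneda_coboundaryl f2b Glift.
apply: cbd_ext (cbdD (h1 j) (h2 j)) => x; rewrite /yoneda -big_split /=.
apply: eq_bigr => i _; rewrite /f1 /f2 /G2.
case: (leqP N i) => Ni; first by rewrite add0r.
rewrite addr0 (leq_trans _ jN) // leq_add2r; exact: ltnW.
Qed.

Lemma cocycleP (z : cocycle) : closed z /\ almost_coboundary z.
Proof. by apply/asboolP/(valP z). Qed.

Definition lift (z : cocycle) : forall i j, P j -> P i :=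
  projT1 (lifts_exist (cocycleP z).1).

Lemma liftP (z : cocycle) : lifts z (lift z).
Proof. exact: (projT2 (lifts_exist (cocycleP z).1)). Qed.

Fact yoneda_cocycle (z z' : cocycle) : yoneda z (lift z') \in cocycle_pred.
Proof.
apply/asboolP; split; first exact: yoneda_closed (cocycleP z).1 (liftP z').
exact: yoneda_almost (cocycleP z).1 (liftP z') (cocycleP z).2 (cocycleP z').2.
Qed.

(* Yoneda product; Ext_mulE shows that it depends neither on the representatives
   nor on the lift. *)
Definition Ext_mul (x y : Ext) : Ext :=
  Ext_class (Cocycle (yoneda_cocycle (repr x) (repr y))).

Definition aug_cochain : cochain := fun n =>
  match n return P n -> M with 0%N => aug | _ => fun=> 0 end.

Fact aug_cocycle : aug_cochain \in cocycle_pred.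
Proof.
apply/asboolP; split.
  case=> [|n]; split=> //; [exact: linearP | exact: augd |].
  by move=> a x y; rewrite /= scaler0 addr0.
by exists 1%N; case=> // n _; apply: (cbd0 n.+1).
Qed.

Definition Ext_one : Ext := Ext_class (Cocycle aug_cocycle).

Lemma lifts_lin c g g' G G' : lifts g G -> lifts g' G' ->
  lifts (c *: g + g' : cochain) (fun i j x => c%:A *: G i j x + G' i j x).
Proof.
move=> [Gl Gt Ga Gd] [Gl' Gt' Ga' Gd']; split.
- by move=> i j; apply: central_linear.
- by move=> i j ji x; rewrite Gt ?Gt' // scaler0 addr0.
- by move=> j x; rewrite linearP Ga Ga'.
- by move=> i j x; rewrite linearP Gd Gd'.
Qed.

Lemma yoneda_linr c f G G' : closed f ->
  yoneda f (fun i j x => c%:A *: G i j x + G' i j x) =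
  (c *: yoneda f G + yoneda f G' : cochain).
Proof.
move=> fc; apply: cochainP => n x.
rewrite -[RHS]/(c%:A *: yoneda f G x + yoneda f G' x) /yoneda scaler_sumr -big_split.
by apply: eq_bigr => i _ /=; rewrite (fc i).1.
Qed.

Lemma yoneda_linl c f f' G :
  yoneda (c *: f + f') G = (c *: yoneda f G + yoneda f' G : cochain).
Proof.
apply: cochainP => n x.
by rewrite -[RHS]/(c%:A *: yoneda f G x + yoneda f' G x) /yoneda scaler_sumr -big_split.
Qed.

Lemma Ext_mulE (z z' w : cocycle) G : lifts z' G ->
  (forall n x, cocycle_val w n x = yoneda z G x) -> Ext_mul (Ext_class z) (Ext_class z') = Ext_class w.
Proof.
move=> Gl wE; apply/Ext_class_eq => /=.
have -> : cocycle_val w = yoneda z G by apply: cochainP.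
set f := repr _; set g := repr _.
have fz : coboundary (cocycle_val f - cocycle_val z) by apply/Ext_class_eq; rewrite /Ext_class reprK.
have gz : coboundary (cocycle_val z' - cocycle_val g) by apply/Ext_class_eq; rewrite /Ext_class reprK.
have h1 := yoneda_coboundaryl fz (liftP g).
have h2 := lifts_lin (-1) (liftP g) Gl.
have gz' : coboundary ((-1 : k) *: cocycle_val g + cocycle_val z').
  by rewrite scaleN1r addrC.
have := yoneda_coboundaryr (cocycleP z).1 h2 gz'.
rewrite yoneda_linr; last exact: (cocycleP z).1.
move=> h3; have := coboundaryB h1 h3; congr coboundary.
rewrite [cocycle_val f - _]addrC -[- cocycle_val z]scaleN1r yoneda_linl !scaleN1r.
by rewrite opprD opprK addrACA addNr add0r.
Qed.

Lemma yoneda_witness (z z' : cocycle) G : lifts z' G ->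
  {w : cocycle | forall n x, cocycle_val w n x = yoneda z G x}.
Proof.
move=> Gl; have h : yoneda z G \in cocycle_pred.
  apply/asboolP; split; first exact: yoneda_closed (cocycleP z).1 Gl.
  exact: yoneda_almost (cocycleP z).1 Gl (cocycleP z).2 (cocycleP z').2.
by exists (Cocycle h).
Qed.

Definition lift_comp (F G : forall i j, P j -> P i) : forall i j, P j -> P i :=
  fun i j x => \sum_(l < j.+1) F i l (G l j x).

Lemma lifts_comp f g F G : lifts f F -> lifts g G -> lifts (yoneda f G) (lift_comp F G).
Proof.
move=> [Fl Ft Fa Fd] [Gl Gt Ga Gd]; split.
- by move=> i j; apply: sum_linear => l; apply: comp_linear.
- move=> i j ji x; apply: big1 => l _; apply: Ft.
  by apply: leq_ltn_trans ji; rewrite -ltnS.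
- by move=> j x; rewrite linear_sum; apply: eq_bigr => l _; rewrite Fa.
- move=> i j x; rewrite /lift_comp linear_sum big_ord_recl /= Ft // linear0 add0r.
  by apply: eq_bigr => l _; rewrite /= Fd Gd.
Qed.

Lemma yoneda_comp e f g F G : closed e -> lifts f F -> lifts g G ->
  yoneda e (lift_comp F G) = yoneda (yoneda e F) G.
Proof.
move=> ec [Fl Ft Fa Fd] [Gl Gt Ga Gd]; apply: cochainP => j x; rewrite /yoneda /lift_comp.
under eq_bigr => i _ do rewrite (lin_sum _ (ec i).1).
rewrite exchange_big; apply: eq_bigr => l _ /=.
rewrite -(big_mkord xpredT (fun i => e i (F i l (G l j x)))).
rewrite -(big_mkord xpredT (fun i => e i (F i l (G l j x)))).
rewrite (@big_cat_nat _ _ _ l.+1) //=.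
rewrite [X in _ + X]big_nat_cond [X in _ + X]big1 ?addr0 // => i /andP[/andP[li _] _].
by rewrite Ft // (lin0 (ec i).1).
Qed.

Definition delta : forall i j, P j -> P i := fun i j x =>
  match @eqP _ j i with
  | ReflectT e => eq_rect j (fun n => P n) x i e
  | ReflectF _ => 0
  end.

Lemma delta_id i (x : P i) : delta i x = x.
Proof.
by rewrite /delta; case: eqP => // e; rewrite (eq_irrelevance e erefl).
Qed.
Lemma delta_ne i j (x : P j) : j != i -> delta i x = 0.
Proof. by rewrite /delta; case: eqP. Qed.

Lemma lifts_delta : lifts (Cocycle aug_cocycle) delta.
Proof.
split.
- move=> i j a x y; case: (eqVneq j i) => [e|ne]; last first.
    by rewrite !delta_ne // scaler0 addr0.
  by subst j; rewrite !delta_id.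
- by move=> i j ji x; rewrite delta_ne // neq_ltn ji.
- case=> [|j] x /=; first by rewrite delta_id.
  by rewrite delta_ne // linear0.
- move=> i j x; case: (eqVneq j i) => [e|ne]; last first.
    by rewrite !delta_ne // linear0.
  by subst j; rewrite !delta_id.
Qed.

Lemma yoneda_delta f : closed f -> yoneda f delta = f.
Proof.
move=> fc; apply: cochainP => j x; rewrite /yoneda big_ord_recr /= delta_id big1 ?add0r //.
by move=> i _; rewrite delta_ne ?(lin0 (fc i).1) // neq_ltn /= ltn_ord orbT.
Qed.

Fact Ext_mulA : associative Ext_mul.
Proof.
move=> x y z; have [e ->] := Ext_classP x; have [f ->] := Ext_classP y.
have [g ->] := Ext_classP z.
have [ef efE] := yoneda_witness e (liftP f).
have [fg fgE] := yoneda_witness f (liftP g).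
have [efg efgE] := yoneda_witness ef (liftP g).
rewrite (Ext_mulE (liftP f) efE) (Ext_mulE (liftP g) fgE) (Ext_mulE (liftP g) efgE).
have efE' : cocycle_val ef = yoneda e (lift f) by apply: cochainP.
have fgE' : cocycle_val fg = yoneda f (lift g) by apply: cochainP.
apply: (@Ext_mulE _ _ _ (lift_comp (lift f) (lift g))).
  by rewrite fgE'; apply: lifts_comp; apply: liftP.
move=> n u; rewrite efgE efE' (yoneda_comp (cocycleP e).1 (liftP f) (liftP g)).
by [].
Qed.

Fact Ext_mul1l : left_id Ext_one Ext_mul.
Proof.
move=> x; have [z ->] := Ext_classP x; apply: Ext_mulE (liftP z) _ => n u.
have [_ _ ha _] := liftP z; rewrite /yoneda big_ord_recl /= ha big1 ?addr0 //.
Qed.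

Fact Ext_mul1r : right_id Ext_one Ext_mul.
Proof.
move=> x; have [z ->] := Ext_classP x; apply: Ext_mulE lifts_delta _ => n u.
by rewrite (yoneda_delta (cocycleP z).1).
Qed.

Lemma Ext_mul_linl c x y z :
  Ext_mul (c *: x + y) z = c *: Ext_mul x z + Ext_mul y z.
Proof.
have [e ->] := Ext_classP x; have [f ->] := Ext_classP y; have [g ->] := Ext_classP z.
have [eg egE] := yoneda_witness e (liftP g).
have [fg fgE] := yoneda_witness f (liftP g).
rewrite (Ext_mulE (liftP g) egE) (Ext_mulE (liftP g) fgE).
rewrite -[c *: Ext_class e]/(Ext_scale _ _) -[c *: Ext_class eg]/(Ext_scale _ _).
rewrite !Ext_scaleE -!Ext_classD; apply: Ext_mulE (liftP g) _ => n u.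
rewrite -[cocycle_val (c *: e + f)]/(c *: cocycle_val e + cocycle_val f : cochain).
rewrite yoneda_linl -[LHS]/(c%:A *: cocycle_val eg n u + cocycle_val fg n u) egE fgE.
by [].
Qed.

Lemma Ext_mul_linr c x y z :
  Ext_mul x (c *: y + z) = c *: Ext_mul x y + Ext_mul x z.
Proof.
have [e ->] := Ext_classP x; have [f ->] := Ext_classP y; have [g ->] := Ext_classP z.
have [ef efE] := yoneda_witness e (liftP f).
have [eg egE] := yoneda_witness e (liftP g).
rewrite (Ext_mulE (liftP f) efE) (Ext_mulE (liftP g) egE).
rewrite -[c *: Ext_class f]/(Ext_scale _ _) -[c *: Ext_class ef]/(Ext_scale _ _).
rewrite !Ext_scaleE -!Ext_classD.
have hl : lifts (cocycle_val (c *: f + g)) _ := lifts_lin c (liftP f) (liftP g).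
apply: Ext_mulE hl _ => n u.
rewrite (yoneda_linr _ _ _ (cocycleP e).1) -[LHS]/(c%:A *: cocycle_val ef n u + cocycle_val eg n u) efE egE.
by [].
Qed.

Fact Ext_mulDl : left_distributive Ext_mul +%R.
Proof. by move=> x y z; have := Ext_mul_linl 1 x y z; rewrite !scale1r. Qed.
Fact Ext_mulDr : right_distributive Ext_mul +%R.
Proof. by move=> x y z; have := Ext_mul_linr 1 x y z; rewrite !scale1r. Qed.

HB.instance Definition _ := GRing.Zmodule_isPzRing.Build Ext
  Ext_mulA Ext_mul1l Ext_mul1r Ext_mulDl Ext_mulDr.

Lemma Ext_scaleAl (c : k) (x y : Ext) : c *: (x * y) = (c *: x) * y.
Proof.
have := Ext_mul_linl c x 0 y; rewrite addr0 -[RHS]/(c *: (x * y) + 0 * y).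
by rewrite mul0r addr0 => <-.
Qed.
Lemma Ext_scaleAr (c : k) (x y : Ext) : c *: (x * y) = x * (c *: y).
Proof.
have := Ext_mul_linr c x y 0; rewrite addr0 -[RHS]/(c *: (x * y) + x * 0).
by rewrite mulr0 addr0 => <-.
Qed.

Lemma Ext_one_neq0 : (exists m : M, m != 0) -> (1 : Ext) != 0.
Proof.
case=> m; apply: contra_neq => one0.
have Ext0 : (0 : Ext) = Ext_class 0 by rewrite /Ext_class piE.
have /Ext_class_eq /(_ 0%N) h : Ext_one = Ext_class 0 by rewrite -Ext0 -one0.
have [x <-] := @res_aug_surj _ _ P m; have := h x.
by rewrite -[LHS]/(aug x - 0) subr0.
Qed.

End Cochains.
Arguments cocycle_val {k R M P} _ _ _.

Section Enveloping.
Variables (k : comNzRingType) (A : algType k).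

Definition bilin (V : lmodType k) (f : A -> A -> V) : Prop :=
  (forall x, linear (f x)) /\ (forall y, linear (fun x => f x y)).

Definition tsum (V : lmodType k) (f : A -> A -> V) (s : seq (A * A)) : V :=
  \sum_(p <- s) f p.1 p.2.

(* A formal sum of pairs represents an element of the tensor product A (x)_k A; two
   of them are identified when no bilinear map separates them. *)
Definition tequiv (s t : seq (A * A)) : bool :=
  `[< forall (V : lmodType k) (f : A -> A -> V), bilin f -> tsum f s = tsum f t >].

Fact tequiv_is_equiv : equiv_class_of tequiv.
Proof.
split=> [s|s t|t s u]; first exact/asboolP.
  by apply/asboolP/asboolP => h V f /h.
by move=> /asboolP h /asboolP h'; apply/asboolP => V f fb; rewrite h ?h'.
Qed.
Canonical tequiv_equiv := EquivRelPack tequiv_is_equiv.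

Definition env := {eq_quot tequiv}.
HB.instance Definition _ := Choice.on env.
HB.instance Definition _ := EqQuotient.on env.

Definition env_sum (s : seq (A * A)) : env := \pi_env s.

Definition pure (a b : A) : env := env_sum [:: (a, b)].

Lemma env_sumP (x : env) : exists s, x = env_sum s.
Proof. by exists (repr x); rewrite /env_sum reprK. Qed.

Lemma env_sum_eq s t : env_sum s = env_sum t <->
  forall (V : lmodType k) (f : A -> A -> V), bilin f -> tsum f s = tsum f t.
Proof.
split=> [/eqP|h]; last by apply/eqP; rewrite eqmodE; apply/asboolP.
by rewrite eqmodE => /asboolP.
Qed.

Lemma tsum_repr s (V : lmodType k) (f : A -> A -> V) :
  bilin f -> tsum f (repr (env_sum s)) = tsum f s.
Proof. by apply: (env_sum_eq _ _).1; rewrite /env_sum reprK. Qed.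

Lemma tsum_cat (V : lmodType k) (f : A -> A -> V) s t :
  tsum f (s ++ t) = tsum f s + tsum f t.
Proof. by rewrite /tsum big_cat. Qed.

Definition env_zero : env := env_sum [::].
Definition env_add (x y : env) : env := env_sum (repr x ++ repr y).
Definition env_scale (c : k) (x : env) : env :=
  env_sum [seq (c *: p.1, p.2) | p <- repr x].
Definition env_opp : env -> env := env_scale (-1).
Definition env_one : env := pure 1 1.
(* The second tensor factor is A^op. *)
Definition env_mul (x y : env) : env :=
  env_sum [seq (p.1 * q.1, q.2 * p.2) | p <- repr x, q <- repr y].

Lemma env_addE s t : env_add (env_sum s) (env_sum t) = env_sum (s ++ t).
Proof. by apply/env_sum_eq => V f fb; rewrite !tsum_cat !tsum_repr. Qed.

Lemma bilinZl (V : lmodType k) (f : A -> A -> V) c a b :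
  bilin f -> f (c *: a) b = c *: f a b.
Proof.
case=> _ /(_ b) fl; have f0 : f 0 b = 0.
  by have := fl (-1) 0 0; rewrite scaler0 addr0 scaleN1r addNr.
by have := fl c a 0; rewrite !addr0 f0 addr0.
Qed.

Lemma tsum_scale (V : lmodType k) (f : A -> A -> V) c s : bilin f ->
  tsum f [seq (c *: p.1, p.2) | p <- s] = c *: tsum f s.
Proof.
move=> fb; rewrite /tsum big_map scaler_sumr.
by apply: eq_bigr => p _; rewrite bilinZl.
Qed.

Lemma env_scaleE c s :
  env_scale c (env_sum s) = env_sum [seq (c *: p.1, p.2) | p <- s].
Proof. by apply/env_sum_eq => V f fb; rewrite !tsum_scale // tsum_repr. Qed.

Lemma bilin_mull (V : lmodType k) (f : A -> A -> V) t : bilin f ->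
  bilin (fun a b => tsum (fun a' b' => f (a * a') (b' * b)) t).
Proof.
move=> [fl fr]; split=> x c y z; rewrite /tsum scaler_sumr -big_split;
  apply: eq_bigr => p _ /=.
  by rewrite mulrDr -scalerAr fl.
by rewrite mulrDl -scalerAl fr.
Qed.

Lemma bilin_mulr (V : lmodType k) (f : A -> A -> V) s : bilin f ->
  bilin (fun a' b' => tsum (fun a b => f (a * a') (b' * b)) s).
Proof.
move=> [fl fr]; split=> x c y z; rewrite /tsum scaler_sumr -big_split;
  apply: eq_bigr => p _ /=.
  by rewrite mulrDl -scalerAl fl.
by rewrite mulrDr -scalerAr fr.
Qed.

Lemma tsum_mul (V : lmodType k) (f : A -> A -> V) s t :
  tsum f [seq (p.1 * q.1, q.2 * p.2) | p <- s, q <- t] =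
  tsum (fun a b => tsum (fun a' b' => f (a * a') (b' * b)) t) s.
Proof. by rewrite /tsum big_allpairs_dep. Qed.

Lemma tsum_exchange (V : lmodType k) (g : A -> A -> A -> A -> V) s t :
  tsum (fun a b => tsum (g a b) t) s = tsum (fun a' b' => tsum (fun a b => g a b a' b') s) t.
Proof. by rewrite /tsum exchange_big. Qed.

Lemma env_mulE s t : env_mul (env_sum s) (env_sum t) =
  env_sum [seq (p.1 * q.1, q.2 * p.2) | p <- s, q <- t].
Proof.
apply/env_sum_eq => V f fb; rewrite !tsum_mul.
rewrite tsum_repr; last exact: bilin_mull.
rewrite tsum_exchange tsum_repr; last exact: bilin_mulr.
by rewrite tsum_exchange.
Qed.

Fact env_addA : associative env_add.
Proof.
move=> x y z; have [s ->] := env_sumP x; have [t ->] := env_sumP y.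
by have [u ->] := env_sumP z; rewrite !env_addE catA.
Qed.
Fact env_addC : commutative env_add.
Proof.
move=> x y; have [s ->] := env_sumP x; have [t ->] := env_sumP y.
by rewrite !env_addE; apply/env_sum_eq => V f _; rewrite !tsum_cat addrC.
Qed.
Fact env_add0 : left_id env_zero env_add.
Proof. by move=> x; have [s ->] := env_sumP x; rewrite env_addE. Qed.
Fact env_addN : left_inverse env_zero env_opp env_add.
Proof.
move=> x; have [s ->] := env_sumP x; rewrite /env_opp env_scaleE env_addE.
apply/env_sum_eq => V f fb; rewrite tsum_cat tsum_scale // scaleN1r addNr.
by rewrite /tsum big_nil.
Qed.
HB.instance Definition _ := GRing.isZmodule.Build env
  env_addA env_addC env_add0 env_addN.

Lemma env_sum_cat s t : env_sum (s ++ t) = env_sum s + env_sum t.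
Proof. by rewrite -env_addE. Qed.

Fact env_scaleA c c' x : env_scale c (env_scale c' x) = env_scale (c * c') x.
Proof.
have [s ->] := env_sumP x; rewrite !env_scaleE.
by apply/env_sum_eq => V f fb; rewrite !tsum_scale // scalerA.
Qed.
Fact env_scale1 : left_id 1 env_scale.
Proof.
move=> x; have [s ->] := env_sumP x; rewrite env_scaleE.
by apply/env_sum_eq => V f fb; rewrite tsum_scale // scale1r.
Qed.
Fact env_scaleDr : right_distributive env_scale +%R.
Proof.
move=> c x y; have [s ->] := env_sumP x; have [t ->] := env_sumP y.
by rewrite -env_sum_cat !env_scaleE -env_sum_cat map_cat.
Qed.
Fact env_scaleDl x : {morph env_scale^~ x : c c' / c + c'}.
Proof.
move=> c c'; have [s ->] := env_sumP x; rewrite !env_scaleE -env_sum_cat.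
by apply/env_sum_eq => V f fb; rewrite tsum_cat !tsum_scale // scalerDl.
Qed.
HB.instance Definition _ := GRing.Zmodule_isLmodule.Build k env
  env_scaleA env_scale1 env_scaleDr env_scaleDl.

Fact env_mulA : associative env_mul.
Proof.
move=> x y z; have [s ->] := env_sumP x; have [t ->] := env_sumP y.
have [u ->] := env_sumP z; rewrite !env_mulE; apply/env_sum_eq => V f fb.
rewrite !tsum_mul; apply: eq_bigr => p _; rewrite tsum_mul.
by do 2![apply: eq_bigr => ? _]; rewrite !mulrA.
Qed.
Fact env_mul1l : left_id env_one env_mul.
Proof.
move=> x; have [s ->] := env_sumP x; rewrite env_mulE; apply/env_sum_eq => V f fb.
rewrite tsum_mul {1}/tsum big_seq1; apply: eq_bigr => p _.
by rewrite mul1r mulr1.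
Qed.
Fact env_mul1r : right_id env_one env_mul.
Proof.
move=> x; have [s ->] := env_sumP x; rewrite env_mulE; apply/env_sum_eq => V f fb.
rewrite tsum_mul; apply: eq_bigr => p _.
by rewrite {1}/tsum big_seq1 mul1r mulr1.
Qed.
Fact env_mulDl : left_distributive env_mul +%R.
Proof.
move=> x y z; have [s ->] := env_sumP x; have [t ->] := env_sumP y.
have [u ->] := env_sumP z; rewrite -env_sum_cat !env_mulE -env_sum_cat.
by apply/env_sum_eq => V f fb; rewrite tsum_cat !tsum_mul tsum_cat.
Qed.
Fact env_mulDr : right_distributive env_mul +%R.
Proof.
move=> x y z; have [s ->] := env_sumP x; have [t ->] := env_sumP y.
have [u ->] := env_sumP z; rewrite -env_sum_cat !env_mulE -env_sum_cat.
apply/env_sum_eq => V f fb; rewrite tsum_cat !tsum_mul.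
by rewrite [LHS]tsum_exchange tsum_cat; congr (_ + _); rewrite tsum_exchange.
Qed.

Lemma bilin_act (x : A) : bilin (fun a b => a * x * b).
Proof.
split=> a c y z; first by rewrite mulrDr -scalerAr.
by rewrite !mulrDl -!scalerAl.
Qed.

Fact env_one_neq0 : env_one != env_zero.
Proof.
apply/eqP => /env_sum_eq /(_ A _ (bilin_act 1)) /eqP.
by rewrite /tsum big_seq1 big_nil !mulr1 oner_eq0.
Qed.
HB.instance Definition _ := GRing.Zmodule_isNzRing.Build env
  env_mulA env_mul1l env_mul1r env_mulDl env_mulDr env_one_neq0.

Fact env_scaleAl (c : k) (x y : env) : c *: (x * y) = (c *: x) * y.
Proof.
rewrite -[LHS]/(env_scale c (env_mul x y)) -[RHS]/(env_mul (env_scale c x) y).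
have [s ->] := env_sumP x; have [t ->] := env_sumP y.
rewrite env_mulE !env_scaleE env_mulE; apply/env_sum_eq => V f fb.
rewrite tsum_scale // !tsum_mul tsum_scale //; exact: bilin_mull.
Qed.
HB.instance Definition _ := GRing.Lmodule_isLalgebra.Build k env env_scaleAl.
Fact env_scaleAr (c : k) (x y : env) : c *: (x * y) = x * (c *: y).
Proof.
rewrite -[LHS]/(env_scale c (env_mul x y)) -[RHS]/(env_mul x (env_scale c y)).
have [s ->] := env_sumP x; have [t ->] := env_sumP y.
rewrite env_mulE !env_scaleE env_mulE; apply/env_sum_eq => V f fb.
rewrite tsum_scale // !tsum_mul tsum_exchange [RHS]tsum_exchange tsum_scale //.
exact: bilin_mulr.
Qed.
HB.instance Definition _ := GRing.Lalgebra_isAlgebra.Build k env env_scaleAr.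

Lemma pureM x y x' y' : pure x y * pure x' y' = pure (x * x') (y' * y).
Proof. by rewrite -[LHS]/(env_mul _ _) env_mulE. Qed.

Lemma bilin_pure : bilin pure.
Proof.
split=> [x c y z|y c x z]; rewrite -[c *: pure _ _]/(env_scale _ _) env_scaleE;
  rewrite -env_sum_cat; apply/env_sum_eq => V f fb; have [fl fr] := fb.
  by rewrite /tsum !big_cons !big_nil /= !addr0 fl bilinZl.
by rewrite /tsum !big_cons !big_nil /= !addr0 fr bilinZl.
Qed.

Lemma env_universal (V : lmodType k) (f : A -> A -> V) : bilin f ->
  exists! g : env -> V, linear g /\ forall x y, g (pure x y) = f x y.
Proof.
move=> fb; exists (fun e => tsum f (repr e)); split.
  split=> [c x y|x y]; last by rewrite tsum_repr // /tsum big_seq1.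
  have [s ->] := env_sumP x; have [t ->] := env_sumP y.
  rewrite -[c *: env_sum s]/(env_scale _ _) env_scaleE -env_sum_cat !tsum_repr //.
  by rewrite tsum_cat tsum_scale.
move=> g [gl gE]; apply/funext => e; have [s ->] := env_sumP e.
rewrite tsum_repr //; elim: s => [|p s IHs].
  have := gl (-1) 0 0; rewrite scaler0 addr0 scaleN1r addNr => g0.
  by rewrite /tsum big_nil -g0.
rewrite /tsum big_cons -/(tsum f s) IHs -cat1s env_sum_cat -[env_sum [:: p]]scale1r.
by rewrite gl scale1r; congr (_ + _); case: p => x y /=; rewrite -gE.
Qed.

Definition diagonal_bimodule : Type := A.
HB.instance Definition _ := GRing.Zmodule.on diagonal_bimodule.

Definition env_act (e : env) (x : diagonal_bimodule) : diagonal_bimodule :=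
  \sum_(p <- repr e) (p.1 : A) * (x : A) * p.2.

Lemma env_actE s x : env_act (env_sum s) x = \sum_(p <- s) (p.1 : A) * (x : A) * p.2.
Proof. exact: (tsum_repr s (bilin_act x)). Qed.

Fact env_actA e e' x : env_act e (env_act e' x) = env_act (e * e') x.
Proof.
rewrite -[e * e']/(env_mul e e').
have [s ->] := env_sumP e; have [t ->] := env_sumP e'.
rewrite env_mulE !env_actE big_allpairs_dep; apply: eq_bigr => p _.
rewrite mulr_sumr mulr_suml; apply: eq_bigr => q _ /=.
by rewrite !mulrA.
Qed.
Fact env_act1 : left_id 1 env_act.
Proof. by move=> x; rewrite env_actE big_seq1 /= mul1r mulr1. Qed.
Fact env_actDr : right_distributive env_act +%R.
Proof.
move=> e x y; rewrite /env_act -big_split; apply: eq_bigr => p _ /=.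
by rewrite -mulrDl -mulrDr.
Qed.
Fact env_actDl x : {morph env_act^~ x : e e' / e + e'}.
Proof.
move=> e e'; have [s ->] := env_sumP e; have [t ->] := env_sumP e'.
by rewrite -env_sum_cat !env_actE big_cat.
Qed.
HB.instance Definition _ := GRing.Zmodule_isLmodule.Build env diagonal_bimodule
  env_actA env_act1 env_actDr env_actDl.

Lemma pure_act a b (x : diagonal_bimodule) : pure a b *: x = a * (x : A) * b.
Proof. by rewrite -[LHS]/(env_act _ _) env_actE big_seq1. Qed.

End Enveloping.

Section Hochschild.
Variables (k : comNzRingType) (A : algType k).
Variable P : projective_resolution (diagonal_bimodule A).

Definition HH : Type := Ext P.
HB.instance Definition _ := GRing.PzRing.on HH.
HB.instance Definition _ := GRing.Lmodule.on HH.

Fact HH_one_neq0 : (1 : HH) != 0.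
Proof. by apply: Ext_one_neq0; exists (1 : A); apply: oner_neq0. Qed.
HB.instance Definition _ := GRing.PzSemiRing_isNonZero.Build HH HH_one_neq0.
HB.instance Definition _ := GRing.Lmodule_isLalgebra.Build k HH (@Ext_scaleAl _ _ _ P).
HB.instance Definition _ := GRing.Lalgebra_isAlgebra.Build k HH (@Ext_scaleAr _ _ _ P).
End Hochschild.

Section SemigroupAlgebra.
Variables (k : fieldType) (a b : nat).

Definition sg_eval : {mpoly k[2]} -> {poly k} :=
  mmap (@polyC k) (fun i : 'I_2 => if i == 0 then 'X^a else 'X^b).

(* k[s^a, s^b] is the image of k[x, y] under x |-> s^a, y |-> s^b. *)
Definition sg_pred : {pred {poly k}} :=
  [pred p | `[< exists q : {mpoly k[2]}, p = sg_eval q >]].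

Fact sg_closed : GRing.subalg_closed sg_pred.
Proof.
split=> [|c p q /asboolP[u ->] /asboolP[v ->]|p q /asboolP[u ->] /asboolP[v ->]];
  apply/asboolP.
- by exists 1; rewrite /sg_eval rmorph1.
- by exists (c *: u + v); rewrite /sg_eval rmorphD /= mmapZ mul_polyC.
- by exists (u * v); rewrite /sg_eval rmorphM.
Qed.
HB.instance Definition _ := GRing.isSubalgClosed.Build k {poly k} sg_pred sg_closed.

Record sg_algebra := SgAlgebra
  { sg_val :> {poly k}; _ : sg_val \in sg_pred }.
HB.instance Definition _ := [isSub for sg_val].
HB.instance Definition _ := [Choice of sg_algebra by <:].
HB.instance Definition _ := [SubChoice_isSubAlgebra of sg_algebra by <:].

(* The homogeneous elements of weight w, where s has weight 1. *)
Definition sg_wt (w : int) (x : sg_algebra) : Prop :=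
  forall n : nat, (sg_val x)`_n != 0 -> n%:Z = w.
End SemigroupAlgebra.

Section QuotientAlgebra.
Variables (k : comNzRingType) (A : comAlgType k) (I : idealr A).

Definition quot_alg : Type := {ideal_quot I}.
HB.instance Definition _ := GRing.ComNzRing.on quot_alg.

Definition quot_proj (x : A) : quot_alg := \pi_{ideal_quot I} x.

Lemma quot_projP (y : quot_alg) : exists x, y = quot_proj x.
Proof. by exists (repr (y : {ideal_quot I})); rewrite /quot_proj reprK. Qed.

Lemma quot_proj_eq x y : quot_proj x = quot_proj y <-> x - y \in I.
Proof.
split=> [/eqP|h]; first by rewrite -Quotient.idealrBE.
by apply/eqP; rewrite -Quotient.idealrBE.
Qed.

Lemma quot_projD x y : quot_proj (x + y) = quot_proj x + quot_proj y.
Proof. by rewrite /quot_proj rmorphD. Qed.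
Lemma quot_projM x y : quot_proj (x * y) = quot_proj x * quot_proj y.
Proof. by rewrite /quot_proj rmorphM. Qed.

Definition quot_scale (c : k) (y : quot_alg) : quot_alg := quot_proj c%:A * y.

Lemma quot_scaleE c x : quot_scale c (quot_proj x) = quot_proj (c *: x).
Proof. by rewrite /quot_scale -quot_projM mulr_algl. Qed.

Fact quot_scaleA c c' y : quot_scale c (quot_scale c' y) = quot_scale (c * c') y.
Proof. by have [x ->] := quot_projP y; rewrite !quot_scaleE scalerA. Qed.
Fact quot_scale1 : left_id 1 quot_scale.
Proof. by move=> y; have [x ->] := quot_projP y; rewrite !quot_scaleE scale1r. Qed.
Fact quot_scaleDr : right_distributive quot_scale +%R.
Proof. by move=> c x y; rewrite /quot_scale mulrDr. Qed.
Fact quot_scaleDl y : {morph quot_scale^~ y : c c' / c + c'}.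
Proof. by move=> c c'; rewrite /quot_scale scalerDl quot_projD mulrDl. Qed.
HB.instance Definition _ := GRing.Zmodule_isLmodule.Build k quot_alg
  quot_scaleA quot_scale1 quot_scaleDr quot_scaleDl.

Fact quot_scaleAl (c : k) (x y : quot_alg) : c *: (x * y) = (c *: x) * y.
Proof. by rewrite -[LHS]/(_ * (x * y)) mulrA. Qed.
HB.instance Definition _ := GRing.Lmodule_isLalgebra.Build k quot_alg quot_scaleAl.
HB.instance Definition _ := GRing.Lalgebra_isComAlgebra.Build k quot_alg.
End QuotientAlgebra.

Definition ideal_gen (A : comNzRingType) (s : seq A) : {pred A} :=
  [pred p | `[< exists c : 'I_(size s) -> A, p = \sum_i c i * s`_i >]].

Lemma ideal_gen_closed (A : comNzRingType) (s : seq A) :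
  1 \notin ideal_gen s -> idealr_closed (ideal_gen s).
Proof.
move=> s1; split=> // [|p _ _ /asboolP[c ->] /asboolP[e ->]]; apply/asboolP.
  by exists (fun=> 0); rewrite big1 // => i _; rewrite mul0r.
exists (fun i => p * c i + e i); rewrite mulr_sumr -big_split.
by apply: eq_bigr => i _; rewrite mulrDl mulrA.
Qed.

Section Presentation.
Variables (k : fieldType) (a b : nat).

Local Notation var i := ('X_(@Ordinal 5 i isT) : {mpoly k[5]}).
Local Notation X1 := (var 0).
Local Notation X2 := (var 1).
Local Notation Y1 := (var 2).
Local Notation Y2 := (var 3).
Local Notation T := (var 4).

Definition HH_relations : seq {mpoly k[5]} :=
  [:: X1 ^+ b - X2 ^+ a; X1 ^+ b.-1 * T; X2 ^+ a.-1 * T; Y2 * T;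
      Y1 ^+ 2; Y2 ^+ 2; Y1 * Y2;
      X1 * Y2 - X2 ^+ a.-1 * Y1; X2 * Y2 - X1 ^+ b.-1 * Y1].

Definition var_deg : 'I_5 -> nat := tnth [tuple 0; 0; 1; 1; 2]%N.

Definition var_wt : 'I_5 -> int :=
  tnth [tuple a%:Z; b%:Z; 0; (a * b)%N%:Z - a%:Z - b%:Z; - (a * b)%N%:Z].

Definition deg_homogeneous (n : nat) (f : {mpoly k[5]}) : Prop :=
  forall m, m \in msupp f -> (\sum_i m i * var_deg i)%N = n.

Definition wt_homogeneous (w : int) (f : {mpoly k[5]}) : Prop :=
  forall m, m \in msupp f -> \sum_i var_wt i *+ m i = w.

(* Needed only for the ideal to be proper, as {ideal_quot _} requires. *)
Hypotheses (a_gt0 : (0 < a)%N) (b_gt0 : (0 < b)%N).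

Fact HH_relations_proper : 1 \notin ideal_gen HH_relations.
Proof.
apply/negP => /asboolP[c].
move=> /(congr1 (meval (fun=> 0 : k))); rewrite rmorph1 rmorph_sum big1 => [/eqP|i _].
  by rewrite oner_eq0.
suff h : all (fun p => p.@[fun=> 0 : k] == 0) HH_relations.
  by rewrite rmorphM /= (eqP (allP h _ (mem_nth _ _))) ?mulr0.
rewrite /= !(mevalM, mevalB, rmorphXn) /= !mevalXU !mulr0 !subr0.
by rewrite !expr0n !eqn0Ngt a_gt0 b_gt0 subr0 eqxx.
Qed.

Definition HH_ideal : idealr {mpoly k[5]} :=
  HB.pack (ideal_gen HH_relations : {mpoly k[5]} -> bool)
    (isIdealr.Build _ _ (ideal_gen_closed HH_relations_proper)).

Definition HH_presentation : comAlgType k := quot_alg HH_ideal.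
End Presentation.

Record is_grading (V : zmodType) (g : int -> V -> Prop) : Prop := {
  grading0 : forall w, g w 0;
  gradingB : forall w x y, g w x -> g w y -> g w (x - y);
  grading_span : forall x, exists (s : seq int) (c : int -> V),
    [/\ uniq s, (forall w, g w (c w)) & x = \sum_(w <- s) c w];
  grading_free : forall (s : seq int) (c : int -> V),
    uniq s -> (forall w, g w (c w)) -> \sum_(w <- s) c w = 0 ->
    forall w, w \in s -> c w = 0
}.

(* g makes P a resolution by graded A^e-modules with maps of weight 0, where A is
   graded by gA. *)
Record graded_resolution (k : comNzRingType) (A : algType k) (gA : int -> A -> Prop)
    (P : projective_resolution (diagonal_bimodule A))
    (g : forall n, int -> P n -> Prop) : Prop := {
  graded_obj : forall n, is_grading (g n);
  graded_act : forall n u v w x y p, gA u x -> gA v y -> g n w p ->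
    g n (u + v + w) (pure x y *: p);
  graded_d : forall n w p, g n.+1 w p -> g n w (res_d P n p);
  graded_aug : forall w p, g 0%N w p -> gA w (res_aug P p)
}.

Definition HH_deg (k : comNzRingType) (A : algType k)
    (P : projective_resolution (diagonal_bimodule A)) (n : nat) (x : HH P) : Prop :=
  exists2 z : cocycle P, x = Ext_class z &
    forall m, m != n -> forall p, cocycle_val z m p = 0.

(* x is a class in Ext^n of internal weight w, i.e. it is represented by a cocycle
   P_n -> A shifting weights by w. *)
Definition HH_bideg (k : comNzRingType) (A : algType k) (gA : int -> A -> Prop)
    (P : projective_resolution (diagonal_bimodule A))
    (g : forall n, int -> P n -> Prop) (n : nat) (w : int) (x : HH P) : Prop :=
  exists2 z : cocycle P, x = Ext_class z &
    (forall m, m != n -> forall p, cocycle_val z m p = 0) /\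
    (forall v p, g n v p -> gA (v + w) (cocycle_val z n p)).

(* Main.v *)
(* A = k[s^a, s^b] is the plane curve k[x, y] / (F) with F = y^a - x^b.  Its enveloping
   algebra is A[x', y'] / (F(x', y')), and modulo this equation, which reads
   u P + v Q = 0 for u = x' - x and v = y' - y, Tate's resolution of A is free of rank
   2 in every positive degree and 2-periodic: it is exact because (P, -v; Q, u) and
   (u, v; -Q, P) form a matrix factorization of F over A[x', y'], in low degrees because
   u, v is a regular sequence there.  As u and v act as 0 on A, and P and Q as
   F_x = - b x^(b-1) and F_y = a y^(a-1), the cohomology is A in degree 0, the
   derivations in degree 1, A / (x^(b-1), y^(a-1)) in positive even degrees and the
   derivations modulo A Y_2 in odd degrees > 1, where the derivations are generated by
   Y_1 = a x d/dx + b y d/dy and Y_2 = a y^(a-1) d/dx + b x^(b-1) d/dy.  The class T is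
   the shift by the period.  Products of derivations vanish because their values on t
   involve only second divided differences of F times multiples of x^(b-1) and y^(a-1).
   On a graded resolution, the weight 0 part of a comparison map to Tate's resolution is
   again a comparison map, so it carries homogeneous cocycles to homogeneous cocycles. *)
Require Import Defs.
From HB Require Import structures.
From mathcomp Require Import all_boot all_order all_algebra.
From mathcomp Require Import boolp mpoly.
From mathcomp Require Import ring zify.
Set Implicit Arguments.
Unset Strict Implicit.
Unset Printing Implicit Defensive.
Import GRing.Theory.
Local Open Scope ring_scope.

Local Notation closed := Defs.closed.
Local Notation projective := Defs.projective.
Local Notation delta := Defs.delta.

(** * Comparison of projective resolutions *)

(** The statement allows any projective resolution, so the product too must be carried along a
    comparison map; the computation itself is done once, over an abstract commutative E and module M
    satisfying [tate_data]. Elements of the enveloping algebra are formal sums up to bilinear maps,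
    so exactness cannot be read off directly. The coordinates of A on the monomials x^i y^j with j <
    a show that the kernel of A[x', y'] -> A (x) A is generated by F; exactness is then proved
    upstairs, where F is monic in y' and cancels. Coprimality of a and b provides these coordinates:
    the exponents a i + b j with j < a are distinct. Invertibility of a and b makes the partial
    derivatives of F equal to x^(b-1) and y^(a-1) up to units; otherwise one of them would vanish.
    Injectivity avoids any dimension count: modulo the relations every polynomial is a sum of terms
    p T^m and (p Y_1 + q Y_2) T^m with p, q polynomials in X_1, X_2, and a term whose image in Ext
    is 0 is already 0 by the relations. *)

Section Comparison.
Variables (k : comNzRingType) (R : algType k) (M : lmodType R).
Implicit Types P Q : projective_resolution M.

Definition chain_map P Q (u : forall n, {linear P n -> Q n}) : Prop :=
  (forall x, res_aug Q (u 0%N x) = res_aug P x) /\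
  (forall n x, res_d Q n (u n.+1 x) = u n (res_d P n x)).

Lemma cycle_lift P Q i j (f : {linear P j -> Q i}) : (forall x, at_cycle (f x)) ->
  exists h : {linear P j -> Q i.+1}, forall x, res_d Q i (h x) = f x.
Proof.
move=> fc; apply: projective_lift; first exact: res_projective.
by move=> x; apply/at_cycleP.
Qed.

Lemma chain_map_exists P Q : exists u : forall n, {linear P n -> Q n}, chain_map u.
Proof.
(* Each stage stores the cycle condition along with the map: it is what the lift to the next degree
   requires. *)
pose stage i := {u : {linear P i -> Q i} | forall x, at_cycle (u (res_d P i x))}.
have [u0 u0E] : exists u0 : {linear P 0%N -> Q 0%N},
    forall x, res_aug Q (u0 x) = res_aug P x.
  by apply: res_projective; apply: res_aug_surj.
have u0c x : at_cycle (u0 (res_d P 0 x)) by rewrite /= u0E augd.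
have step i (s : stage i) :
    {s' : stage i.+1 | forall x, res_d Q i (sval s' x) = sval s (res_d P i x)}.
  apply: cid; case: s => u uc.
  have [h hE] := cycle_lift (f := u \o res_d P i) uc.
  have hc x : at_cycle (h (res_d P i.+1 x)) by rewrite /= hE /= dd linear0.
  by exists (exist _ h hc).
pose s0 : stage 0%N := exist _ u0 u0c.
pose fix stages i : stage i :=
  match i with 0%N => s0 | i'.+1 => sval (step i' (stages i')) end.
exists (fun n => sval (stages n)); split=> // n x.
exact: (svalP (step n (stages n))).
Qed.

Definition pullback_cochain P Q (u : forall n, {linear P n -> Q n}) (f : cochain Q) :
  cochain P := fun n x => f n (u n x).

Lemma null_homotopic P Q (r : forall n, {linear P n -> Q n}) (f : cochain Q) :
  (forall x, res_aug Q (r 0%N x) = 0) ->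
  (forall n x, res_d Q n (r n.+1 x) = r n (res_d P n x)) ->
  closed f -> coboundary (pullback_cochain r f).
Proof.
move=> r0 rd fc.
have homotopy n : exists s : {linear P n -> Q n.+1},
    (forall x, res_d Q n (s (res_d P n x)) = r n (res_d P n x)) /\
    coboundary_at (fun x => f n (r n x)).
  elim: n => [|n [s [sE _]]].
    have [s sE] := cycle_lift (f := r 0%N) r0.
    by exists s; split=> [x|x]; rewrite ?sE // -sE (fc 0%N).2.
  pose e : {linear P n.+1 -> Q n.+1} := r n.+1 \- (s \o res_d P n).
  have ec x : at_cycle (e x) by rewrite /e /= linearB /= sE rd subrr.
  have [s' s'E] := cycle_lift ec.
  exists s'; split=> [x|]; first by rewrite s'E /e /= dd linear0 subr0.
  have hl : linear (fun x => f n.+1 (s x)).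
    by apply: comp_linear; [exact: (fc n.+1).1 | exact: linearP].
  exists (projT1 (lin_pack hl)) => x; rewrite (projT2 (lin_pack hl)).
  have -> : r n.+1 x = res_d Q n.+1 (s' x) + s (res_d P n x) by rewrite s'E /e /= subrK.
  by rewrite (linD _ _ (fc n.+1).1) (fc n.+1).2 add0r.
by move=> n; case: (homotopy n) => s [].
Qed.

Lemma pullback_unique P Q (u v : forall n, {linear P n -> Q n}) (f : cochain Q) :
  chain_map u -> chain_map v -> closed f ->
  coboundary (pullback_cochain u f - pullback_cochain v f).
Proof.
move=> [u0 ud] [v0 vd] fc.
have h := @null_homotopic P Q (fun n => u n \- v n) f _ _ fc.
suff <- : pullback_cochain (fun n => u n \- v n) f =
    pullback_cochain u f - pullback_cochain v f.
  by apply: h => [x|n x] /=; rewrite linearB ?u0 ?v0 ?ud ?vd /= ?subrr.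
by apply: cochainP => n x; apply: linB; apply: (fc n).1.
Qed.

Lemma pullback_closed P Q (u : forall n, {linear P n -> Q n}) (f : cochain Q) :
  chain_map u -> closed f -> closed (pullback_cochain u f).
Proof.
move=> [_ ud] fc n; split; last by move=> x; rewrite /pullback_cochain -ud (fc n).2.
by apply: comp_linear; [exact: (fc n).1 | exact: linearP].
Qed.

Lemma pullback_coboundary_at P Q (u : forall n, {linear P n -> Q n}) n (f : Q n -> M) :
  chain_map u -> coboundary_at f -> coboundary_at (fun x => f (u n x)).
Proof.
move=> [_ ud]; case: n f => [|n] f /=; first by move=> f0 x; rewrite f0.
by case=> h fE; exists (h \o u n) => x; rewrite fE /= ud.
Qed.

Lemma pullback_cocycle P Q (u : forall n, {linear P n -> Q n}) (z : cocycle Q) :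
  chain_map u ->
  {z' : cocycle P | forall n x, cocycle_val z' n x = cocycle_val z n (u n x)}.
Proof.
move=> uc; have h : pullback_cochain u (cocycle_val z) \in @cocycle_pred _ _ _ P.
  have [zc [N zN]] := cocycleP z.
  apply/asboolP; split; first exact: pullback_closed.
  by exists N => n /zN; apply: pullback_coboundary_at.
by exists (Cocycle h).
Qed.

Section Transport.
Variables (P Q : projective_resolution M) (u : forall n, {linear P n -> Q n}).
Hypothesis uc : chain_map u.

Definition Ext_pullback (x : Ext Q) : Ext P :=
  Ext_class (sval (pullback_cocycle (repr x) uc)).

Lemma Ext_pullbackE (z : cocycle Q) (z' : cocycle P) :
  (forall n x, cocycle_val z' n x = cocycle_val z n (u n x)) ->
  Ext_pullback (Ext_class z) = Ext_class z'.
Proof.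
move=> z'E; apply/Ext_class_eq.
set w := repr _.
have /Ext_class_eq wz : Ext_class w = Ext_class z by rewrite /Ext_class reprK.
move=> n; apply: (cbd_ext (f := fun x => (cocycle_val w - cocycle_val z) n (u n x))).
  by move=> x; rewrite -[RHS]/(_ - cocycle_val z' n x) z'E (svalP (pullback_cocycle _ _)).
exact: pullback_coboundary_at.
Qed.

Lemma Ext_pullback_linear : linear Ext_pullback.
Proof.
move=> c x y; have [e ->] := Ext_classP x; have [f ->] := Ext_classP y.
have [e' e'E] := pullback_cocycle e uc; have [f' f'E] := pullback_cocycle f uc.
rewrite (Ext_pullbackE e'E) (Ext_pullbackE f'E).
rewrite -[c *: Ext_class e]/(Ext_scale _ _) -[c *: Ext_class e']/(Ext_scale _ _).
rewrite !Ext_scaleE -!Ext_classD; apply: Ext_pullbackE => n p.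
rewrite -[LHS]/(c%:A *: cocycle_val e' n p + cocycle_val f' n p).
by rewrite e'E f'E.
Qed.

Lemma Ext_pullback1 : Ext_pullback 1 = 1.
Proof. by apply: Ext_pullbackE; case=> [|n] x //=; rewrite uc.1. Qed.

(** If G lifts f and v goes back from Q to P, then v G u lifts the pullback of f. The product
    computed with it is e (u v) G u, and u v is homotopic to the identity, so that it differs from e
    G u by a coboundary. *)
Lemma Ext_pullbackM : {morph Ext_pullback : x y / x * y}.
Proof.
move=> x y; have [e ->] := Ext_classP x; have [f ->] := Ext_classP y.
have [e' e'E] := pullback_cocycle e uc; have [f' f'E] := pullback_cocycle f uc.
have [ef efE] := yoneda_witness e (liftP f).
rewrite -[Ext_class e * _]/(Ext_mul _ _) (Ext_mulE (liftP f) efE).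
rewrite (Ext_pullbackE e'E) (Ext_pullbackE f'E).
rewrite -[RHS]/(Ext_mul _ _).
have [v vc] := chain_map_exists Q P.
have [Gl Gt Ga Gd] := liftP f.
pose H i j (p : P j) : P i := v i (Defs.lift f i (u j p)).
have Hlift : lifts (cocycle_val f') H.
  split.
  - by move=> i j; do !apply: comp_linear => //; exact: linearP.
  - by move=> i j ji p; rewrite /H Gt // linear0.
  - by move=> j p; rewrite /H vc.1 Ga f'E.
  - by move=> i j p; rewrite /H vc.2 Gd uc.2.
have [w wE] := yoneda_witness e' Hlift.
rewrite (Ext_mulE Hlift wE).
have [w' w'E] := pullback_cocycle ef uc.
rewrite (Ext_pullbackE w'E); apply/Ext_class_eq.
have uvc : chain_map (fun n => u n \o v n) by split=> [p|n p] /=; rewrite ?uc.1 ?uc.2 ?vc.1 ?vc.2.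
have idc : chain_map (fun n => idfun : {linear Q n -> Q n}) by [].
have h := pullback_unique idc uvc (cocycleP e).1.
have h' := yoneda_coboundaryl h (liftP f).
move=> n; apply: cbd_ext (pullback_coboundary_at uc (h' n)) => p.
rewrite -[RHS]/(_ - cocycle_val w n p) wE w'E efE /yoneda -sumrB.
by apply: eq_bigr => i _; rewrite e'E.
Qed.
End Transport.

Lemma Ext_pullbackK P Q (u : forall n, {linear P n -> Q n})
    (v : forall n, {linear Q n -> P n}) (uc : chain_map u) (vc : chain_map v) :
  cancel (Ext_pullback uc) (Ext_pullback vc).
Proof.
move=> x; have [e ->] := Ext_classP x.
have [e' e'E] := pullback_cocycle e uc; have [e'' e''E] := pullback_cocycle e' vc.
rewrite (Ext_pullbackE _ e'E) (Ext_pullbackE _ e''E); apply/Ext_class_eq.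
have uvc : chain_map (fun n => u n \o v n) by split=> [p|n p] /=; rewrite ?uc.1 ?uc.2 ?vc.1 ?vc.2.
have idc : chain_map (fun n => idfun : {linear Q n -> Q n}) by [].
move=> n; apply: cbd_ext (pullback_unique uvc idc (cocycleP e).1 n) => p.
by rewrite -[RHS]/(_ - _) e''E e'E.
Qed.

Lemma Ext_pullback_bij P Q (u : forall n, {linear P n -> Q n}) (uc : chain_map u) :
  bijective (Ext_pullback uc).
Proof.
have [v vc] := chain_map_exists Q P.
by exists (Ext_pullback vc); apply: Ext_pullbackK.
Qed.

End Comparison.

(** * The enveloping algebra of a plane curve *)

Section TwoVariables.
Variables (C B : comNzRingType) (f : {rmorphism C -> B}) (x y : B).

Definition ev1 : {poly C} -> B := horner_morph (fun c => mulrC x (f c)).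
HB.instance Definition _ := GRing.RMorphism.on ev1.
Definition ev2 : {poly {poly C}} -> B := horner_morph (fun c => mulrC y (ev1 c)).
HB.instance Definition _ := GRing.RMorphism.on ev2.

Lemma ev2C p : ev2 p%:P = ev1 p.
Proof. exact: horner_morphC. Qed.
Lemma ev2CC c : ev2 c%:P%:P = f c.
Proof. by rewrite ev2C /ev1 horner_morphC. Qed.
Lemma ev2CX : ev2 'X%:P = x.
Proof. by rewrite ev2C /ev1 horner_morphX. Qed.
Lemma ev2X : ev2 'X = y.
Proof. exact: horner_morphX. Qed.

Lemma ev2E (p : {poly {poly C}}) :
  ev2 p = \sum_(j < size p) \sum_(i < size p`_j) f p`_j`_i * x ^+ i * y ^+ j.
Proof.
rewrite -{1}[p]coefK poly_def rmorph_sum; apply: eq_bigr => j _.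
rewrite -mul_polyC rmorphM rmorphXn /= ev2C ev2X -mulr_suml; congr (_ * _).
rewrite -{1}[p`_j]coefK poly_def rmorph_sum; apply: eq_bigr => i _.
by rewrite -mul_polyC rmorphM rmorphXn /= /ev1 horner_morphC horner_morphX.
Qed.

Variables a b : nat.
Hypothesis a_gt0 : (0 < a)%N.

(** The outer variable is y: the equation is then monic, and division by it works over every
    coefficient ring C. *)
Definition curve : {poly {poly C}} := 'X^a - ('X^b)%:P.

Lemma curve_monic : curve \is monic.
Proof. exact: monicXnsubC. Qed.

Lemma ev2_curve : x ^+ b = y ^+ a -> ev2 curve = 0.
Proof.
by move=> h; rewrite rmorphB rmorphXn /= ev2X polyC_exp rmorphXn /= ev2CX h subrr.
Qed.

(** The remainder of p modulo the curve has degree < a in y, and the functionals [co i j] read its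
    coefficients off its value. It serves for A over k and for A (x) A over its left factor A. *)
Lemma ev2_ker (co : nat -> nat -> B -> C) :
  x ^+ b = y ^+ a ->
  (forall i j, {morph co i j : u v / u + v}) ->
  (forall i j i' j' c, (j < a)%N -> (j' < a)%N ->
    co i j (f c * x ^+ i' * y ^+ j') = if (i == i') && (j == j') then c else 0) ->
  forall p, ev2 p = 0 -> exists q, p = q * curve.
Proof.
move=> hxy coD coE p p0.
have /= pE := Pdiv.RingMonic.rdivp_eq curve_monic p.
set q := Pdiv.Ring.rdivp p curve in pE; set r := Pdiv.Ring.rmodp p curve in pE.
have sr : (size r <= a)%N.
  have := Pdiv.Ring.ltn_rmodpN0 p (monic_neq0 curve_monic).
  by rewrite /curve size_XnsubC.
have r0 : ev2 r = 0.
  by move: p0; rewrite pE rmorphD rmorphM /= ev2_curve // mulr0 add0r.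
exists q; rewrite pE; suff -> : r = 0 by rewrite addr0.
apply/polyP => j; rewrite coef0; apply/polyP => i; rewrite coef0.
have [ja|ja] := ltnP j (size r); last by rewrite (nth_default 0 ja) coef0.
have [ia|ia] := ltnP i (size r`_j); last by rewrite nth_default.
have co0 i' j' : co i' j' 0 = 0.
  by apply: (addrI (co i' j' 0)); rewrite -coD !addr0.
have co_sum i' j' (I : finType) (F : I -> B) :
    co i' j' (\sum_l F l) = \sum_l co i' j' (F l).
  exact: (big_morph _ (coD i' j') (co0 i' j')).
move: r0 => /(congr1 (co i j)); rewrite co0 ev2E co_sum.
rewrite (bigD1 (Ordinal ja)) //= [X in _ + X]big1 ?addr0; last first.
  move=> j' jj'; rewrite co_sum big1 // => i' _.
  rewrite coE ?(leq_trans _ sr) //.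
  by have /negbTE -> : j != j' :> nat; [rewrite eq_sym | rewrite andbF].
rewrite co_sum (bigD1 (Ordinal ia)) //= big1 ?addr0; last first.
  move=> i' ii'; rewrite coE ?(leq_trans _ sr) //.
  by have /negbTE -> : i != i' :> nat; [rewrite eq_sym | rewrite andFb].
by rewrite coE ?(leq_trans _ sr) // !eqxx.
Qed.

End TwoVariables.

Section CommutativeEnveloping.
Variables (k : comNzRingType) (A : comAlgType k).

Lemma env_ind (p : env A -> Prop) :
  p 0 -> (forall e e', p e -> p e' -> p (e + e')) -> (forall c d, p (pure c d)) ->
  forall e, p e.
Proof.
move=> p0 pD pp e; have [s ->] := env_sumP e.
elim: s => [|[c d] s IH]; first exact: p0.
by rewrite -cat1s env_sum_cat; apply: pD IH; apply: pp.
Qed.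

Fact env_mulC : commutative (@GRing.mul (env A)).
Proof.
move=> e f; elim/env_ind: e => [|e e' he he'|c d]; first by rewrite mul0r mulr0.
  by rewrite mulrDl mulrDr he he'.
elim/env_ind: f => [|f f' hf hf'|c' d']; first by rewrite mul0r mulr0.
  by rewrite mulrDl mulrDr hf hf'.
by rewrite !pureM [c * _]mulrC [d * _]mulrC.
Qed.
HB.instance Definition _ :=
  GRing.PzRing_hasCommutativeMul.Build (env A) env_mulC.

Definition envl (c : A) : env A := pure c 1.
Definition envr (c : A) : env A := pure 1 c.

Fact envl_additive : zmod_morphism envl.
Proof.
move=> c d; rewrite addrC /envl; have := (bilin_pure A).2 1 (-1) d c.
by rewrite !scaleN1r => ->; rewrite addrC.
Qed.
HB.instance Definition _ := GRing.isZmodMorphism.Build A (env A) envl envl_additive.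
Fact envl_monoid : monoid_morphism envl.
Proof. by split=> // c d; rewrite /envl pureM mulr1. Qed.
HB.instance Definition _ := GRing.isMonoidMorphism.Build A (env A) envl envl_monoid.

Fact envr_additive : zmod_morphism envr.
Proof.
move=> c d; rewrite addrC /envr; have := (bilin_pure A).1 1 (-1) d c.
by rewrite !scaleN1r => ->; rewrite addrC.
Qed.
HB.instance Definition _ := GRing.isZmodMorphism.Build A (env A) envr envr_additive.
Fact envr_monoid : monoid_morphism envr.
Proof. by split=> // c d; rewrite /envr pureM mulr1 mulrC. Qed.
HB.instance Definition _ := GRing.isMonoidMorphism.Build A (env A) envr envr_monoid.

Lemma pureE c d : pure c d = envl c * envr d.
Proof. by rewrite /envl /envr pureM mulr1 mulr1. Qed.

(** The multiplication A (x) A -> A; by [act_mu] the action on the diagonal bimodule factors through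
    it. *)
Definition mu (e : env A) : A := e *: (1 : diagonal_bimodule A).

Lemma act_mu (e : env A) (m : diagonal_bimodule A) : e *: m = mu e * (m : A) :> A.
Proof.
rewrite /mu; elim/env_ind: e => [|e e' he he'|c d]; first by rewrite !scale0r mul0r.
  by rewrite !scalerDl he he' mulrDl.
by rewrite !pure_act mulr1 -!mulrA [m * d]mulrC.
Qed.

Fact mu_additive : zmod_morphism mu.
Proof. by move=> c d; rewrite /mu scalerBl. Qed.
HB.instance Definition _ := GRing.isZmodMorphism.Build (env A) A mu mu_additive.
Fact mu_monoid : monoid_morphism mu.
Proof. by split=> [|c d]; rewrite /mu ?scale1r // -scalerA act_mu. Qed.
HB.instance Definition _ := GRing.isMonoidMorphism.Build (env A) A mu mu_monoid.

Lemma mu_envl c : mu (envl c) = c.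
Proof. by rewrite /mu pure_act !mulr1. Qed.
Lemma mu_envr c : mu (envr c) = c.
Proof. by rewrite /mu pure_act !mul1r. Qed.
End CommutativeEnveloping.

(** * Divided differences of powers *)

Section DividedDifferences.
Variable B : comNzRingType.
Implicit Types s t : B.

(* (s^n - t^n) / (s - t) *)
Definition divdiff n s t : B := \sum_(i < n) s ^+ (n.-1 - i) * t ^+ i.

(* (divdiff n s t - n t^(n-1)) / (s - t) *)
Definition divdiff2 n s t : B := \sum_(i < n) divdiff (n.-1 - i) s t * t ^+ i.

Lemma divdiffE n s t : s ^+ n - t ^+ n = (s - t) * divdiff n s t.
Proof. exact: subrXX. Qed.

Lemma divdiff_diag n s : divdiff n s s = s ^+ n.-1 *+ n.
Proof.
rewrite /divdiff (eq_bigr (fun=> s ^+ n.-1)) ?sumr_const ?card_ord // => i _.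
rewrite -exprD subnK //; case: n i => [[]//|n] i; exact: (leq_ord i).
Qed.

(** Each summand s^(n-1-i) t^i is t^(n-1) plus (s^(n-1-i) - t^(n-1-i)) t^i. *)
Lemma divdiff2E n s t :
  divdiff n s t = t ^+ n.-1 *+ n + (s - t) * divdiff2 n s t.
Proof.
rewrite mulr_sumr -[t ^+ _ *+ n]mulr1 -divdiff_diag {2}/divdiff mulr1 -big_split.
apply: eq_bigr => i _ /=; rewrite mulrA -divdiffE -mulrDl.
by rewrite addrC subrK.
Qed.

(** On the diagonal the second divided difference is binom(n, 2) s^(n-2); the factor s avoids the
    exponent n - 2, which is negative for n = 1. *)
Lemma divdiff2_diag n s : s * divdiff2 n s s = s ^+ n.-1 *+ (\sum_(i < n) (n.-1 - i)).
Proof.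
rewrite mulr_sumr -sumrMnr; apply: eq_bigr => i _; rewrite divdiff_diag.
have [->|] := posnP (n.-1 - i); first by rewrite !mulr0n mul0r mulr0.
move=> h; rewrite mulrnAl mulrnAr; congr (_ *+ _).
rewrite mulrA -exprS prednK // -exprD subnK //.
by case: n i h => [[]//|n] i _; exact: (leq_ord i).
Qed.

End DividedDifferences.

Lemma rmorph_divdiff (B B' : comNzRingType) (f : {rmorphism B -> B'}) n s t :
  f (divdiff n s t) = divdiff n (f s) (f t).
Proof.
by rewrite rmorph_sum; apply: eq_bigr => i _; rewrite rmorphM !rmorphXn.
Qed.

Lemma rmorph_divdiff2 (B B' : comNzRingType) (f : {rmorphism B -> B'}) n s t :
  f (divdiff2 n s t) = divdiff2 n (f s) (f t).
Proof.
by rewrite rmorph_sum; apply: eq_bigr => i _; rewrite rmorphM rmorphXn rmorph_divdiff.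
Qed.

(* A = k[x, y] / (y^a - x^b): the relation has no further consequences because the
   monomials x^i y^j with j < a have coordinate functionals co i j. *)
Record curve_algebra (k : fieldType) (A : comAlgType k) (a b : nat) (x y : A)
    (co : nat -> nat -> A -> k) : Prop := {
  curve_a_gt0 : (0 < a)%N;
  curve_b_gt0 : (0 < b)%N;
  curve_rel : x ^+ b = y ^+ a;
  curve_gen : forall c, exists p, c = ev2 (in_alg A) x y p;
  curve_coD : forall i j, {morph co i j : u v / u + v};
  curve_coZ : forall i j c u, co i j (c *: u) = c * co i j u;
  curve_co : forall i j i' j', (j < a)%N -> (j' < a)%N ->
    co i j (x ^+ i' * y ^+ j') = ((i == i') && (j == j'))%:R
}.

(** * The enveloping algebra as a quotient of A[x', y'], and the exactness statements *)

Section CurveAlgebra.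
Variables (k : fieldType) (A : comAlgType k) (a b : nat) (x y : A).
Variable co : nat -> nat -> A -> k.
Hypothesis cA : curve_algebra a b x y co.

Lemma curve_ker p : ev2 (in_alg A) x y p = 0 -> exists q, p = q * curve k a b.
Proof.
apply: (@ev2_ker _ _ _ _ _ _ _ (curve_a_gt0 cA) co (curve_rel cA) (curve_coD cA)).
move=> i j i' j' c ja ja'; rewrite mulr_algl -scalerAl (curve_coZ cA) (curve_co cA) //.
by case: (_ && _); rewrite ?mulr1 ?mulr0.
Qed.

(** This is id (x) [co i j], the coordinate along 1 (x) x^i y^j of the left A-module A (x) A. *)
Lemma env_coordinate i j : exists g : env A -> A,
  {morph g : e e' / e + e'} /\ forall c d, g (pure c d) = co i j d *: c.
Proof.
have fb : bilin (fun c d => co i j d *: c : A).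
  split=> [c r d d'|d r c c'].
    by rewrite (curve_coD cA) (curve_coZ cA) scalerDl scalerA.
  by rewrite scalerDr !scalerA mulrC.
have [g [[gl gE] _]] := env_universal fb.
exists g; split=> // e e'; have := gl 1 e e'; by rewrite !scale1r.
Qed.

(** The quotient map A[x', y'] -> A (x) A: coefficients go to the left factor, variables to the
    right one. *)
Definition bivar : {poly {poly A}} -> env A := ev2 (@envl _ A) (envr x) (envr y).
HB.instance Definition _ := GRing.RMorphism.on bivar.

Lemma bivarC c : bivar c%:P%:P = envl c.
Proof. exact: ev2CC. Qed.
Lemma bivar_x : bivar 'X%:P = envr x.
Proof. exact: ev2CX. Qed.
Lemma bivar_y : bivar 'X = envr y.
Proof. exact: ev2X. Qed.

Lemma bivar_ker p : bivar p = 0 -> exists q, p = q * curve A a b.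
Proof.
pose CO i j := projT1 (cid (env_coordinate i j)).
have [COD COE] : (forall i j, {morph CO i j : e e' / e + e'}) /\
    (forall i j c d, CO i j (pure c d) = co i j d *: c).
  by split=> i j; case: (projT2 (cid (env_coordinate i j))).
apply: (@ev2_ker _ _ _ _ _ _ _ (curve_a_gt0 cA) CO) => //.
  by rewrite -!rmorphXn (curve_rel cA).
move=> i j i' j' c ja ja'.
rewrite -!rmorphXn -mulrA -rmorphM -pureE COE (curve_co cA) //.
by case: (_ && _); rewrite ?scale1r ?scale0r.
Qed.

Lemma envr_alg c : envr (c%:A : A) = envl (c%:A : A).
Proof.
have h : forall (d : k) (u : A), pure (d *: u) 1 = d *: pure u 1.
  by move=> d u; apply: (bilinZl _ _ _ (bilin_pure A)).
rewrite /envl h /envr; have := (bilin_pure A).1 1 c 1 0.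
have -> : pure 1 (0 : A) = 0 by apply: (raddf0 (@envr _ A)).
by rewrite !addr0.
Qed.

Lemma bivar_surj e : exists p, bivar p = e.
Proof.
elim/env_ind: e => [|e e' [p <-] [q <-]|c d]; first by exists 0; rewrite rmorph0.
  by exists (p + q); rewrite rmorphD.
have [p ->] := curve_gen cA d; rewrite pureE ev2E.
exists (c%:P%:P * \sum_(j < size p) \sum_(i < size p`_j)
  (in_alg A p`_j`_i)%:P%:P * 'X%:P ^+ i * 'X ^+ j).
rewrite rmorphM /= bivarC; congr (_ * _).
rewrite !rmorph_sum; apply: eq_bigr => j _; rewrite !rmorph_sum; apply: eq_bigr => i _.
rewrite !rmorphM !rmorphXn /= bivarC bivar_x bivar_y envr_alg.
by [].
Qed.

Definition xl : env A := envl x.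
Definition yl : env A := envl y.
Definition uu : env A := envr x - xl.
Definition vv : env A := envr y - yl.
Definition PP : env A := - divdiff b (envr x) xl.
Definition QQ : env A := divdiff a (envr y) yl.

(** Lifts of [uu], [vv], [PP], [QQ] to A[x', y'], where F is a regular element instead of 0. *)
Let u : {poly {poly A}} := ('X - x%:P)%:P.
Let v : {poly {poly A}} := 'X - y%:P%:P.
Let P : {poly {poly A}} := - divdiff b 'X%:P x%:P%:P.
Let Q : {poly {poly A}} := divdiff a 'X y%:P%:P.
Let F := curve A a b.

Let bivar_u : bivar u = uu.
Proof. by rewrite /u !rmorphB /= bivar_x bivarC. Qed.
Let bivar_v : bivar v = vv.
Proof. by rewrite /v rmorphB /= bivar_y bivarC. Qed.
Let bivar_P : bivar P = PP.
Proof. by rewrite /P rmorphN rmorph_divdiff /= bivar_x bivarC. Qed.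
Let bivar_Q : bivar Q = QQ.
Proof. by rewrite /Q rmorph_divdiff /= bivar_y bivarC. Qed.
Let bivar_F : bivar F = 0.
Proof. by apply: ev2_curve; rewrite -!rmorphXn (curve_rel cA). Qed.

(** The two products telescope to y'^a - y^a and - (x'^b - x^b), and x^b = y^a. *)
Let FE : F = u * P + v * Q.
Proof.
have xy : x%:P%:P ^+ b = y%:P%:P ^+ a :> {poly {poly A}}.
  by have := congr1 (fun c : A => c%:P%:P) (curve_rel cA); rewrite /= !polyC_exp.
have uE : u * divdiff b 'X%:P x%:P%:P = 'X%:P ^+ b - x%:P%:P ^+ b.
  by rewrite divdiffE /u polyCB.
have vE : v * Q = 'X ^+ a - y%:P%:P ^+ a by rewrite divdiffE.
rewrite mulrN uE vE xy /F /curve polyC_exp.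
by ring.
Qed.

Lemma uPvQ : uu * PP + vv * QQ = 0.
Proof. by have := bivar_F; rewrite FE rmorphD !rmorphM /= bivar_u bivar_v bivar_P bivar_Q. Qed.

Let F_reg g : F * g = 0 -> g = 0.
Proof.
move=> h; have /monic_lreg := curve_monic A b (curve_a_gt0 cA).
by apply; rewrite mulr0.
Qed.

(** At y' = y the equation says that p times the monic x' - x is 0, hence v divides p; afterwards
    the monic v is cancelled. *)
Lemma koszul_exact p q : p * u + q * v = 0 -> exists t, p = - t * v /\ q = t * u.
Proof.
move=> h.
have vm : v \is monic by apply: monicXsubC.
have um : 'X - x%:P \is monic by apply: monicXsubC.
have : p.[y%:P] * ('X - x%:P) = 0.
  have := congr1 (horner^~ y%:P) h; rewrite /= hornerD !hornerM hornerC hornerXsubC.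
  by rewrite subrr mulr0 addr0 horner0.
move/monic_rreg: (um) => /[swap] pu.
rewrite -[RHS](mul0r ('X - x%:P)) in pu.
move=> /(_ _ _ pu) /eqP /factor_theorem [t pE].
exists (- t); rewrite opprK; split=> //.
apply/eqP; rewrite -subr_eq0; apply/eqP; move/monic_rreg: (vm); apply.
by rewrite mul0r -[RHS]h pE -/v; ring.
Qed.

(** Division by v and then by u leaves the value at (x, y) as remainder, and this value is
    [mu e]. *)
Lemma exact_aug e : mu e = 0 -> exists p q, e = p * uu + q * vv.
Proof.
have [s <-] := bivar_surj e => s0.
have /factor_theorem [q qE] : root (s - (s.[y%:P])%:P) y%:P.
  by rewrite /root !hornerE subrr.
have muE r : mu (bivar r%:P) = r.[x].
  rewrite /bivar /= ev2C -{1}[r]coefK poly_def !rmorph_sum horner_coef.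
  apply: eq_bigr => i _; rewrite -mul_polyC !rmorphM !rmorphXn /=.
  by rewrite /ev1 horner_morphC horner_morphX mu_envl mu_envr.
have sE : s = q * v + (s.[y%:P])%:P by rewrite -qE subrK.
have sE' : bivar s = bivar q * vv + bivar (s.[y%:P])%:P.
  by rewrite {1}sE rmorphD rmorphM /= bivar_v.
have /factor_theorem [p pE] : root s.[y%:P] x.
  move: s0; rewrite sE' rmorphD rmorphM /= muE rmorphB /= mu_envl mu_envr.
  by rewrite subrr mulr0 add0r => /eqP.
exists (bivar p%:P), (bivar q); rewrite sE' pE polyCM -/u rmorphM /= bivar_u.
by rewrite addrC.
Qed.

(** Upstairs p u + q v = g F = g (u P + v Q), so that (p - g P, q - g Q) is a syzygy of u, v, that
    is, a Koszul one. *)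
Lemma exact_odd e f : e * uu + f * vv = 0 ->
  exists s t, e = s * PP - t * vv /\ f = s * QQ + t * uu.
Proof.
have [p <-] := bivar_surj e; have [q <-] := bivar_surj f.
rewrite -bivar_u -bivar_v -!rmorphM -rmorphD => /bivar_ker [g gE].
have [|t [t1 t2]] := @koszul_exact (p - g * P) (q - g * Q).
  rewrite !mulrBl; apply: (@etrans _ _ (p * u + q * v - g * F)); last by rewrite gE subrr.
  by rewrite FE; ring.
exists (bivar g), (bivar t); rewrite -bivar_P -bivar_Q.
rewrite -!rmorphM -rmorphB -rmorphD -t2 -mulNr -t1.
by split; congr bivar; rewrite addrC subrK.
Qed.

(* (P, -v; Q, u) and (u, v; -Q, P) is a matrix factorization of F. *)
Lemma exact_even e f : e * PP - f * vv = 0 -> e * QQ + f * uu = 0 ->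
  exists s t, e = s * uu + t * vv /\ f = t * PP - s * QQ.
Proof.
have [p <-] := bivar_surj e; have [q <-] := bivar_surj f.
rewrite -bivar_u -bivar_v -bivar_P -bivar_Q -!rmorphM -rmorphD -rmorphB.
(* The witnesses are the quotients of the two equations by F. Applying the other factor of the
   matrix factorization gives F times the claim, and F cancels. *)
move=> /bivar_ker [s sE] /bivar_ker [t tE].
exists (bivar s), (bivar t); rewrite -!rmorphM -rmorphD -rmorphB.
rewrite -/F in sE tE.
split; congr bivar; apply/eqP; rewrite -subr_eq0; apply/eqP/F_reg.
  rewrite mulrBr; apply: (@etrans _ _ ((p * P - q * v) * u + (p * Q + q * u) * v - F * (s * u + t * v))).
    by rewrite {1}FE; ring.
  by rewrite sE tE; ring.
rewrite mulrBr; apply: (@etrans _ _ ((p * Q + q * u) * P - (p * P - q * v) * Q - F * (t * P - s * Q))).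
  by rewrite {1}FE; ring.
by rewrite sE tE; ring.
Qed.

End CurveAlgebra.

(** * Tate's resolution *)

Lemma projective_regular (R : pzRingType) : projective (R^o : lmodType R).
Proof.
move=> M N g f gs; have [m mE] := gs (f 1).
have hl : linear (fun r : R^o => r *: m) by move=> c r r'; rewrite scalerDl scalerA.
pose H := GRing.isLinear.Build R R^o M _ _ hl.
pose h : {linear R^o -> M} := HB.pack (fun r : R^o => r *: m) H.
exists h => r; rewrite -[h r]/(r *: m) linearZ mE -linearZ /=; congr (f _).
exact: mulr1.
Qed.

Lemma projective_prod (R : pzRingType) (P Q : lmodType R) :
  projective P -> projective Q -> projective (P * Q)%type.
Proof.
move=> pP pQ M N g f gs.
have fPl : linear (fun p : P => f (p, 0)).
  by move=> c p p'; rewrite -linearP; congr (f _); congr (_, _); rewrite /= ?scaler0 ?addr0.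
have fQl : linear (fun q : Q => f (0, q)).
  by move=> c q q'; rewrite -linearP; congr (f _); congr (_, _); rewrite /= ?scaler0 ?addr0.
pose fP : {linear P -> N} := HB.pack (fun p : P => f (p, 0)) (GRing.isLinear.Build R P N _ _ fPl).
pose fQ : {linear Q -> N} := HB.pack (fun q : Q => f (0, q)) (GRing.isLinear.Build R Q N _ _ fQl).
have [hP hPE] := pP _ _ g fP gs; have [hQ hQE] := pQ _ _ g fQ gs.
have hl : linear (fun r : P * Q => hP r.1 + hQ r.2).
  by move=> c r r' /=; rewrite !linearP scalerDr addrACA.
pose h : {linear (P * Q)%type -> M} :=
  HB.pack (fun r : P * Q => hP r.1 + hQ r.2) (GRing.isLinear.Build R (P * Q)%type M _ _ hl).
exists h.
move=> [p q] /=; rewrite linearD hPE hQE -[fP p]/(f _) -[fQ q]/(f _) -linearD.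
by congr (f _); congr (_, _); rewrite /= ?addr0 ?add0r.
Qed.

Section Differentials.
Variables (E : comNzRingType) (u v P Q : E).

Local Notation E1 := (E^o : lmodType E).
Local Notation E2 := ((E^o * E^o)%type : lmodType E).

(* Tate's resolution is E<e1, e2; t> with d e1 = u, d e2 = v, d t = P e1 + Q e2.  A
   pair in an odd degree 2 m + 1 holds the coefficients of t^m e1 and t^m e2, a pair
   in an even degree 2 m > 0 those of t^m and t^(m-1) e1 e2. *)
Definition diff0 (p : E2) : E1 := (p.1 : E) * u + (p.2 : E) * v.
Definition diff_even (p : E2) : E2 :=
  ((p.1 : E) * P - (p.2 : E) * v, (p.1 : E) * Q + (p.2 : E) * u).
Definition diff_odd (p : E2) : E2 :=
  ((p.1 : E) * u + (p.2 : E) * v, (p.2 : E) * P - (p.1 : E) * Q).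

Fact diff0_linear : linear diff0.
Proof.
have h (c p p' q q' : E) :
  (c * p + q) * u + (c * p' + q') * v = c * (p * u + p' * v) + (q * u + q' * v) by ring.
by move=> c p q; apply: h.
Qed.
Fact diff_even_linear : linear diff_even.
Proof.
have h (c p p' q q' r s : E) :
  (c * p + q) * r - (c * p' + q') * s = c * (p * r - p' * s) + (q * r - q' * s) by ring.
have h' (c p p' q q' r s : E) :
  (c * p + q) * r + (c * p' + q') * s = c * (p * r + p' * s) + (q * r + q' * s) by ring.
by move=> c p q; congr (_, _); [apply: h | apply: h'].
Qed.
Fact diff_odd_linear : linear diff_odd.
Proof.
have h (c p p' q q' r s : E) :
  (c * p + q) * r - (c * p' + q') * s = c * (p * r - p' * s) + (q * r - q' * s) by ring.
have h' (c p p' q q' r s : E) :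
  (c * p + q) * r + (c * p' + q') * s = c * (p * r + p' * s) + (q * r + q' * s) by ring.
by move=> c p q; congr (_, _); [apply: h' | apply: h].
Qed.
HB.instance Definition _ := GRing.isLinear.Build E E2 E1 _ _ diff0_linear.
HB.instance Definition _ := GRing.isLinear.Build E E2 E2 _ _ diff_even_linear.
HB.instance Definition _ := GRing.isLinear.Build E E2 E2 _ _ diff_odd_linear.

Hypothesis uPvQ : u * P + v * Q = 0.

Lemma diff0_even p : diff0 (diff_even p) = 0.
Proof.
have h (p1 p2 : E) : (p1 * P - p2 * v) * u + (p1 * Q + p2 * u) * v = 0.
  by rewrite -[RHS](mulr0 p1) -uPvQ; ring.
exact: h.
Qed.
Lemma diff_odd_even p : diff_odd (diff_even p) = 0.
Proof.
have h (p1 p2 : E) : (p1 * P - p2 * v) * u + (p1 * Q + p2 * u) * v = 0.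
  by rewrite -[RHS](mulr0 p1) -uPvQ; ring.
have h' (p1 p2 : E) : (p1 * Q + p2 * u) * P - (p1 * P - p2 * v) * Q = 0.
  by rewrite -[RHS](mulr0 p2) -uPvQ; ring.
by congr (_, _); [apply: h | apply: h'].
Qed.
Lemma diff_even_odd p : diff_even (diff_odd p) = 0.
Proof.
have h (p1 p2 : E) : (p1 * u + p2 * v) * P - (p2 * P - p1 * Q) * v = 0.
  by rewrite -[RHS](mulr0 p1) -uPvQ; ring.
have h' (p1 p2 : E) : (p1 * u + p2 * v) * Q + (p2 * P - p1 * Q) * u = 0.
  by rewrite -[RHS](mulr0 p2) -uPvQ; ring.
by congr (_, _); [apply: h | apply: h'].
Qed.

Variables (P' Q' f g : E).
Hypothesis derivation : P * f + Q * g = u * (P' * f) + v * (Q' * g).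

(* A chain map of degree -1 lifting the derivation f d/dx + g d/dy; like the
   resolution it is 2-periodic, which makes it commute with t. *)
Definition der_lift0 (p : E2) : E1 := (p.1 : E) * f + (p.2 : E) * g.
Definition der_lift_even (p : E2) : E2 :=
  ((p.1 : E) * (P' * f) + (p.2 : E) * g, (p.1 : E) * (Q' * g) - (p.2 : E) * f).
Definition der_lift_odd (p : E2) : E2 :=
  ((p.1 : E) * f + (p.2 : E) * g, (p.1 : E) * (Q' * g) - (p.2 : E) * (P' * f)).

Let lin_add (c p p' q q' r s : E) :
  (c * p + q) * r + (c * p' + q') * s = c * (p * r + p' * s) + (q * r + q' * s).
Proof. by ring. Qed.
Let lin_sub (c p p' q q' r s : E) :
  (c * p + q) * r - (c * p' + q') * s = c * (p * r - p' * s) + (q * r - q' * s).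
Proof. by ring. Qed.

Fact der_lift0_linear : linear der_lift0.
Proof. by move=> c p q; apply: lin_add. Qed.
Fact der_lift_even_linear : linear der_lift_even.
Proof. by move=> c p q; congr (_, _); [apply: lin_add | apply: lin_sub]. Qed.
Fact der_lift_odd_linear : linear der_lift_odd.
Proof. by move=> c p q; congr (_, _); [apply: lin_add | apply: lin_sub]. Qed.

Lemma diff0_der_lift p : diff0 (der_lift_even p) = der_lift0 (diff_even p).
Proof.
have h (p1 p2 : E) : (p1 * (P' * f) + p2 * g) * u + (p1 * (Q' * g) - p2 * f) * v =
    (p1 * P - p2 * v) * f + (p1 * Q + p2 * u) * g.
  apply: (@etrans _ _ (p1 * (u * (P' * f) + v * (Q' * g)) + p2 * (u * g - v * f))).
    by ring.
  by rewrite -derivation; ring.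
exact: h.
Qed.
Lemma diff_even_der_lift p : diff_even (der_lift_odd p) = der_lift_even (diff_odd p).
Proof.
have h (p1 p2 : E) :
    (p1 * f + p2 * g) * P - (p1 * (Q' * g) - p2 * (P' * f)) * v =
    (p1 * u + p2 * v) * (P' * f) + (p2 * P - p1 * Q) * g.
  apply: (@etrans _ _ (p1 * (P * f + Q * g) - p1 * (Q * g) + p2 * g * P -
    (p1 * (Q' * g) - p2 * (P' * f)) * v)); first by ring.
  by rewrite derivation; ring.
have h' (p1 p2 : E) :
    (p1 * f + p2 * g) * Q + (p1 * (Q' * g) - p2 * (P' * f)) * u =
    (p1 * u + p2 * v) * (Q' * g) - (p2 * P - p1 * Q) * f.
  apply: (@etrans _ _ (p2 * (P * f + Q * g) - p2 * (P * f) + p1 * f * Q +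
    (p1 * (Q' * g) - p2 * (P' * f)) * u)); first by ring.
  by rewrite derivation; ring.
by congr (_, _); [apply: h | apply: h'].
Qed.
Lemma diff_odd_der_lift p : diff_odd (der_lift_even p) = der_lift_odd (diff_even p).
Proof.
have h (p1 p2 : E) : (p1 * (P' * f) + p2 * g) * u + (p1 * (Q' * g) - p2 * f) * v =
    (p1 * P - p2 * v) * f + (p1 * Q + p2 * u) * g.
  apply: (@etrans _ _ (p1 * (u * (P' * f) + v * (Q' * g)) + p2 * (u * g - v * f))).
    by ring.
  by rewrite -derivation; ring.
have h' (p1 p2 : E) : (p1 * (Q' * g) - p2 * f) * P - (p1 * (P' * f) + p2 * g) * Q =
    (p1 * P - p2 * v) * (Q' * g) - (p1 * Q + p2 * u) * (P' * f).
  apply: (@etrans _ _ (p1 * (Q' * g) * P - p1 * (P' * f) * Q - p2 * (P * f + Q * g))).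
    by ring.
  by rewrite derivation; ring.
by congr (_, _); [apply: h | apply: h'].
Qed.
End Differentials.

(* E stands for the enveloping algebra of k[x, y] / (y^a - x^b) and M for its
   diagonal bimodule; u = x' - x and v = y' - y act as 0 on M, u P + v Q = 0 is the
   equation y'^a - x'^b = 0, and P', Q' are the second divided differences. *)
Record tate_data (k : fieldType) (E : comAlgType k) (M : lmodType E) (a b : nat)
    (x y u v P Q P' Q' : E) (m1 : M) : Prop := {
  td_a_gt0 : (0 < a)%N;
  td_b_gt0 : (0 < b)%N;
  td_a_unit : exists c : E, c *+ a = 1;
  td_b_unit : exists c : E, c *+ b = 1;
  td_rel : x ^+ b = y ^+ a;
  td_uPvQ : u * P + v * Q = 0;
  td_P : P = - (x ^+ b.-1 *+ b) + u * P';
  td_Q : Q = y ^+ a.-1 *+ a + v * Q';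
  td_u : forall m : M, u *: m = 0;
  td_v : forall m : M, v *: m = 0;
  td_P' : exists c : E, forall m : M, (x * P') *: m = (x ^+ b.-1 * c) *: m;
  td_Q' : exists c : E, forall m : M, (y * Q') *: m = (y ^+ a.-1 * c) *: m;
  td_m1 : m1 != 0;
  td_gen : forall m, exists e : E, e *: m1 = m;
  td_exact0 : forall e : E, e *: m1 = 0 -> exists p q, e = p * u + q * v;
  td_exact_odd : forall p q : E, p * u + q * v = 0 ->
    exists s t, p = s * P - t * v /\ q = s * Q + t * u;
  td_exact_even : forall p q : E, p * P - q * v = 0 -> p * Q + q * u = 0 ->
    exists s t, p = s * u + t * v /\ q = t * P - s * Q;
  td_reg : forall m : M, x ^+ b.-1 *: m = 0 -> m = 0;
  td_der : forall m m' : M, x ^+ b.-1 *: m = y ^+ a.-1 *: m' ->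
    exists c c', m = (x * c + y ^+ a.-1 * c') *: m1 /\
                 m' = (y * c + x ^+ b.-1 * c') *: m1
}.

Section Resolution.
Variables (k : fieldType) (E : comAlgType k) (M : lmodType E) (a b : nat).
Variables (x y u v P Q P' Q' : E) (m1 : M).
Hypothesis td : tate_data a b x y u v P Q P' Q' m1.

Local Notation E1 := (E^o : lmodType E).
Local Notation E2 := ((E^o * E^o)%type : lmodType E).

Definition tate_obj (n : nat) : lmodType E := if n is 0%N then E1 else E2.

(** The parity in the names [diff_even] and [diff_odd] is that of the source degree n' + 2. *)
Definition tate_d (n : nat) : {linear tate_obj n.+1 -> tate_obj n} :=
  match n return {linear tate_obj n.+1 -> tate_obj n} with
  | 0%N => (diff0 u v : {linear E2 -> E1})
  | n'.+1 => if odd n' then (diff_odd u v P Q : {linear E2 -> E2})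
             else (diff_even u v P Q : {linear E2 -> E2})
  end.

Definition tate_aug (e : E1) : M := (e : E) *: m1.
Fact tate_aug_linear : linear tate_aug.
Proof. by move=> c e e'; rewrite /tate_aug scalerDl scalerA. Qed.
HB.instance Definition _ := GRing.isLinear.Build E E1 M _ _ tate_aug_linear.

Lemma tate_projective n : projective (tate_obj n).
Proof.
case: n => [|n]; first exact: projective_regular.
by apply: projective_prod; apply: projective_regular.
Qed.

Lemma tate_exact0 e : tate_aug e = 0 <-> exists p, tate_d 0 p = e.
Proof.
split=> [/(td_exact0 td) [p [q ->]]|[p <-]]; first by exists (p, q).
rewrite -[LHS]/(((p.1 : E) * u + (p.2 : E) * v) *: m1).
by rewrite scalerDl -!scalerA (td_u td) (td_v td) !scaler0 addr0.
Qed.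

Lemma tate_exactS n p : tate_d n p = 0 <-> exists q, tate_d n.+1 q = p.
Proof.
have uPvQ := td_uPvQ td.
case: n p => [|n] p.
  split=> [/(td_exact_odd td) [s [t [h1 h2]]]|[q <-]]; last exact: diff0_even.
  by exists (s, t); case: p h1 h2 => p1 p2 /= -> ->.
case no : (odd n); rewrite /tate_d /= no /=.
  split=> [[h1 h2]|[q <-]]; last exact: diff_odd_even.
  have [s [t [h3 h4]]] := td_exact_odd td h1.
  by exists (s, t); case: p h1 h2 h3 h4 => p1 p2 /= _ _ -> ->.
split=> [[h1 h2]|[q <-]]; last exact: diff_even_odd.
have [s [t [h3 h4]]] := td_exact_even td h1 h2.
by exists (s, t); case: p h1 h2 h3 h4 => p1 p2 /= _ _ -> ->.
Qed.

Definition tate : projective_resolution M :=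
  {| res_obj := tate_obj; res_d := tate_d; res_aug := tate_aug;
     res_projective := tate_projective; res_aug_surj := td_gen td;
     res_exact0 := tate_exact0; res_exactS := tate_exactS |}.

End Resolution.

(** * Classes and their products *)

Section ConcentratedCochains.
Variables (k : comNzRingType) (R : algType k) (M : lmodType R).
Variable K : projective_resolution M.

(** [delta n] is the identity of K_n and 0 on the other K_j, which spares any transport along j =
    n. *)
Definition concentrated n (f : K n -> M) : cochain K := fun j p => f (delta n p).

Lemma concentratedE n (f : K n -> M) p : concentrated f p = f p.
Proof. by rewrite /concentrated delta_id. Qed.

Lemma concentrated_ne n (f : K n -> M) j (p : K j) :
  linear f -> j != n -> concentrated f p = 0.
Proof. by move=> fl jn; rewrite /concentrated delta_ne ?(lin0 fl). Qed.

Lemma concentrated_cocycle n (f : K n -> M) : linear f ->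
  (forall p, f (res_d K n p) = 0) ->
  {z : cocycle K | forall j p, cocycle_val z j p = concentrated f p}.
Proof.
move=> fl fd; have h : concentrated f \in @cocycle_pred _ _ _ K; last by exists (Cocycle h).
have [dl _ _ dd] := lifts_delta K.
apply/asboolP; split.
  move=> j; split; first by apply: (comp_linear fl); apply: dl.
  move=> p; rewrite /concentrated; case: (eqVneq j n) => [e|jn].
    by subst j; rewrite delta_id.
  by rewrite delta_ne ?(lin0 fl).
exists n.+1 => j nj; apply: cbd_ext (cbd0 _ _) => p.
by rewrite concentrated_ne // neq_ltn nj orbT.
Qed.

(** A chain map of degree -n as a matrix: only the n-th diagonal above the main one is nonzero. *)
Definition shift_lift n (h : forall i, K (i + n)%N -> K i) : forall i j, K j -> K i :=
  fun i j p => h i (delta (i + n)%N p).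

Lemma shift_lifts n (h : forall i, K (i + n)%N -> K i) (g : K n -> M) :
  (forall i, linear (h i)) ->
  (forall p, res_aug K (h 0%N p) = g p) ->
  (forall i p, res_d K i (h i.+1 p) = h i (res_d K (i + n)%N p)) ->
  lifts (concentrated g) (shift_lift h).
Proof.
move=> hl ha hd; have [dl dt da dd] := lifts_delta K.
split.
- by move=> i j; apply: (comp_linear (hl i)); apply: dl.
- move=> i j ji p; rewrite /shift_lift delta_ne ?(lin0 (hl i)) //.
  by rewrite neq_ltn (leq_trans ji) // leq_addr.
- by move=> j p; rewrite /shift_lift ha.
- by move=> i j p; rewrite /shift_lift hd -(dd (i + n)%N j p).
Qed.

Lemma yoneda_shift m n (h : forall i, K (i + n)%N -> K i) (f : K m -> M) j (p : K j) :
  linear f -> (forall i, linear (h i)) ->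
  yoneda (concentrated f) (shift_lift h) p =
  concentrated (fun q : K (m + n)%N => f (h m q)) p.
Proof.
move=> fl hl; rewrite /yoneda /shift_lift.
have term i : i != m -> concentrated f (h i (delta (i + n)%N p)) = 0.
  exact: concentrated_ne.
have [jm|mj] := ltnP j m.
  rewrite big1 => [|i _]; last first.
    by rewrite term // neq_ltn (leq_trans _ jm) //; apply: ltn_ord.
  rewrite /concentrated delta_ne ?(lin0 (hl m)) ?(lin0 fl) //.
  by rewrite neq_ltn (leq_trans jm) // leq_addr.
rewrite (bigD1 (inord m)) //= big1 => [|i im]; last first.
  by rewrite term //; apply: contra im => /eqP im; apply/eqP/val_inj; rewrite /= inordK.
rewrite addr0 inordK // concentratedE.
by [].
Qed.

End ConcentratedCochains.

Section Classes.
Variables (k : fieldType) (E : comAlgType k) (M : lmodType E) (a b : nat).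
Variables (x y u v P Q P' Q' : E) (m1 : M).
Hypothesis td : tate_data a b x y u v P Q P' Q' m1.
Local Notation K := (tate td).
Local Notation E1 := (E^o : lmodType E).
Local Notation E2 := ((E^o * E^o)%type : lmodType E).
Local Notation xb := (x ^+ b.-1).
Local Notation ya := (y ^+ a.-1).

Definition pair_cochain (n : nat) (m : M * M) : K n -> M :=
  match n return K n -> M with
  | 0%N => fun e : E1 => (e : E) *: m.1
  | _.+1 => fun p : E2 => (p.1 : E) *: m.1 + (p.2 : E) *: m.2
  end.

Arguments pair_cochain : clear implicits.

Lemma pair_cochain_linear n m : linear (pair_cochain n m).
Proof.
case: n => [|n] c p q; first by rewrite /= scalerDl scalerA.
by rewrite /= !scalerDl -!scalerA scalerDr addrACA.
Qed.

Lemma pair_cochainZ n (d : E) m p : pair_cochain n (d *: m) p = d *: pair_cochain n m p.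
Proof.
case: n p => [|n] p; rewrite /= ?scalerDr !scalerA; first by congr (_ *: _); exact: mulrC.
by congr (_ *: _ + _ *: _); exact: mulrC.
Qed.

Lemma pair_cochainD n m m' p : pair_cochain n (m + m') p = pair_cochain n m p + pair_cochain n m' p.
Proof.
case: n p => [|n] p; rewrite /= !scalerDr //.
by rewrite addrACA.
Qed.

(* The derivation f d/dx + g d/dy, with f = a (x c + y^(a-1) c') and
   g = b (y c + x^(b-1) c'), is c Y_1 + c' Y_2. *)
Definition derivx (c c' : E) : E := (x * c + ya * c') *+ a.
Definition derivy (c c' : E) : E := (y * c + xb * c') *+ b.

Lemma derivxD c c' d d' : derivx (c + d) (c' + d') = derivx c c' + derivx d d'.
Proof. by rewrite /derivx -mulrnDl; congr (_ *+ _); ring. Qed.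
Lemma derivyD c c' d d' : derivy (c + d) (c' + d') = derivy c c' + derivy d d'.
Proof. by rewrite /derivy -mulrnDl; congr (_ *+ _); ring. Qed.
Lemma derivxM c c' d : derivx (c * d) (c' * d) = derivx c c' * d.
Proof. by rewrite /derivx mulrnAl; congr (_ *+ _); ring. Qed.
Lemma derivyM c c' d : derivy (c * d) (c' * d) = derivy c c' * d.
Proof. by rewrite /derivy mulrnAl; congr (_ *+ _); ring. Qed.

(** In even degree the value on t^(m-1) e_1 e_2 is 0, because it is annihilated by b x^(b-1), which
    is regular on M. There [c'] has no effect. *)
Definition class_values (n : nat) (c c' : E) : M * M :=
  if odd n then (derivx c c' *: m1, derivy c c' *: m1) else (c *: m1, 0).

Lemma class_valuesM n c c' d : class_values n (c * d) (c' * d) = d *: class_values n c c'.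
Proof.
rewrite /class_values derivxM derivyM.
by case: (odd n); congr (_, _); rewrite /= ?scaler0 // scalerA mulrC.
Qed.

(** This says that f d/dx + g d/dy kills F. For the part in c it is Euler's identity together with
    x^b = y^a; the part in c' is symmetric. *)
Lemma derivation c c' : (xb *+ b) * derivx c c' = (ya *+ a) * derivy c c'.
Proof.
rewrite /derivx /derivy !mulrnAl !mulrnAr -!mulrnA [(b * a)%N]mulnC; congr (_ *+ _).
rewrite !mulrDr !mulrA -exprSr prednK ?(td_b_gt0 td) // -exprSr prednK ?(td_a_gt0 td) //.
by rewrite (td_rel td) [xb * ya]mulrC.
Qed.

Lemma PQ_derivation c c' :
  P * derivx c c' + Q * derivy c c' = u * (P' * derivx c c') + v * (Q' * derivy c c').
Proof.
rewrite (td_P td) (td_Q td).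
apply: (@etrans _ _ (ya *+ a * derivy c c' - xb *+ b * derivx c c' +
  (u * (P' * derivx c c') + v * (Q' * derivy c c')))); first by ring.
by rewrite derivation subrr add0r.
Qed.

Lemma P_act (m : M) : P *: m = - ((xb *+ b) *: m).
Proof. by rewrite (td_P td) scalerDl -scalerA (td_u td) addr0 scaleNr. Qed.
Lemma Q_act (m : M) : Q *: m = (ya *+ a) *: m.
Proof. by rewrite (td_Q td) scalerDl -scalerA (td_v td) addr0. Qed.

(** The degree 1 in the statement stands for all positive degrees: there the modules of K coincide,
    so the lemma applies by conversion. *)
Lemma pair_cochain_diff_even m m' (p : E2) :
  pair_cochain 1 (m, m') (diff_even u v P Q p) =
  (p.1 : E) *: ((ya *+ a) *: m' - (xb *+ b) *: m).
Proof.
case: p => p q; rewrite /= scalerBl scalerDl -!scalerA (td_u td) (td_v td).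
by rewrite !scaler0 subr0 addr0 -scalerDr P_act Q_act addrC.
Qed.

Lemma pair_cochain_diff_odd m m' (p : E2) :
  pair_cochain 1 (m, m') (diff_odd u v P Q p) =
  - ((p.1 : E) *: ((ya *+ a) *: m') + (p.2 : E) *: ((xb *+ b) *: m')).
Proof.
case: p => p q; rewrite /= scalerDl scalerBl -!scalerA (td_u td) (td_v td).
by rewrite !scaler0 addr0 add0r P_act Q_act scalerN -opprD addrC.
Qed.

Lemma pair_cochain_closed n c c' p : pair_cochain n (class_values n c c') (tate_d u v P Q n p) = 0.
Proof.
case: n p => [|n] p.
  case: p => p q; rewrite /= scalerDl -!scalerA (td_u td) (td_v td) !scaler0.
  exact: addr0.
rewrite /class_values /tate_d /=; case: (odd n) => /=.
  by apply: (etrans (pair_cochain_diff_odd _ _ _)); rewrite !scaler0 addr0 oppr0.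
apply: (etrans (pair_cochain_diff_even _ _ _)).
by rewrite !scalerA -derivation subrr scaler0.
Qed.

Definition class_cocycle n c c' : cocycle K :=
  sval (concentrated_cocycle (K := K) (@pair_cochain_linear n (class_values n c c'))
         (@pair_cochain_closed n c c')).

Lemma class_cocycleE n c c' j p :
  cocycle_val (class_cocycle n c c') j p = concentrated (pair_cochain n (class_values n c c')) p.
Proof. exact: (svalP (concentrated_cocycle _ _)). Qed.

(* With the generators named as in the presentation, this is c T^(n/2) for even n
   and (c Y_1 + c' Y_2) T^((n-1)/2) for odd n. *)
Definition hclass n c c' : Ext K := Ext_class (class_cocycle n c c').

Lemma Ext_class_ext (z z' : cocycle K) :
  (forall j p, cocycle_val z j p = cocycle_val z' j p) -> Ext_class z = Ext_class z'.
Proof.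
move=> zz'; apply/Ext_class_eq => n; apply: cbd_ext (cbd0 _ _) => p.
by rewrite -[RHS]/(_ - _) zz' subrr.
Qed.

Lemma Ext_scale_class (r : k) (z : cocycle K) : r *: Ext_class z = Ext_class (r *: z).
Proof. exact: Ext_scaleE. Qed.

Lemma hclassD n c c' d d' : hclass n (c + d) (c' + d') = hclass n c c' + hclass n d d'.
Proof.
rewrite /hclass -Ext_classD; apply: Ext_class_ext => j p.
rewrite -[RHS]/(cocycle_val _ j p + cocycle_val _ j p) !class_cocycleE.
rewrite /concentrated; move: (delta n p) => {p} p.
have vE : class_values n (c + d) (c' + d') = class_values n c c' + class_values n d d'.
  rewrite /class_values derivxD derivyD !scalerDl.
  by case: (odd n) => //; congr (_, _); rewrite /= addr0.
by rewrite vE pair_cochainD.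
Qed.

Lemma hclassZ n r c c' : hclass n (r *: c) (r *: c') = r *: hclass n c c'.
Proof.
rewrite /hclass Ext_scale_class; apply: Ext_class_ext => j p.
rewrite -[RHS]/(r%:A *: cocycle_val _ j p) !class_cocycleE.
rewrite /concentrated; move: (delta n p) => {p} p.
rewrite -[r *: c]mulr_algl -[r *: c']mulr_algl ![r%:A * _]mulrC.
by rewrite class_valuesM pair_cochainZ.
Qed.

Lemma hclass_even n c c' d' : ~~ odd n -> hclass n c c' = hclass n c d'.
Proof.
move=> no; apply: Ext_class_ext => j p; rewrite !class_cocycleE /class_values.
by rewrite (negbTE no).
Qed.

Lemma hclass_ext n c c' d d' : c *: m1 = d *: m1 -> c' *: m1 = d' *: m1 ->
  hclass n c c' = hclass n d d'.
Proof.
move=> cd cd'; apply: Ext_class_ext => j p; rewrite !class_cocycleE.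
suff -> : class_values n c c' = class_values n d d' by [].
rewrite /class_values /derivx /derivy; case: (odd n); congr (_, _) => //.
  by rewrite !mulrnDl !scalerDl -!mulrnAl -!scalerA cd cd'.
by rewrite !mulrnDl !scalerDl -!mulrnAl -!scalerA cd cd'.
Qed.

Lemma hclass1 : hclass 0 1 0 = 1.
Proof.
apply: Ext_class_ext => j p; rewrite class_cocycleE.
case: j p => [|j] p; first by rewrite concentratedE /= scale1r.
by rewrite (concentrated_ne _ (@pair_cochain_linear _ _)).
Qed.

Lemma scaled_delta_lifts d :
  lifts (class_cocycle 0 d 0) (fun i j (p : K j) => d *: (delta i p : K i)).
Proof.
have [dl dt da dd] := lifts_delta K.
split.
- by move=> i j c p q; rewrite dl scalerDr !scalerA mulrC.
- by move=> i j ji p; rewrite dt // scaler0.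
- move=> j p; rewrite class_cocycleE /concentrated linearZ /=.
  by move: (delta 0 p) => e; rewrite /tate_aug /= !scalerA; congr (_ *: _); exact: mulrC.
- by move=> i j p; rewrite linearZ dd.
Qed.

Lemma mul_hclass0 n c c' d : hclass n c c' * hclass 0 d 0 = hclass n (c * d) (c' * d).
Proof.
apply: Ext_mulE (scaled_delta_lifts d) _ => j p.
rewrite /yoneda big_ord_recr big1 /= => [|i _]; last first.
  rewrite delta_ne ?scaler0 ?(lin0 ((cocycleP _).1 i).1) //.
  by rewrite neq_ltn ltn_ord orbT.
rewrite add0r delta_id (linZ _ _ ((cocycleP _).1 j).1) !class_cocycleE /concentrated.
move: (delta n p) => {p} p.
by rewrite class_valuesM pair_cochainZ.
Qed.

(** Both products are d times z: in one order d is the scalar lift and leaves z by linearity, in the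
    other it multiplies the augmentation of the lift of z. *)
Lemma hclass0_central d (X : Ext K) : GRing.comm X (hclass 0 d 0).
Proof.
have [z ->] := Ext_classP X; rewrite /GRing.comm.
have [w wE] := yoneda_witness z (scaled_delta_lifts d).
have -> : Ext_class z * hclass 0 d 0 = Ext_class w by apply: Ext_mulE wE; apply: scaled_delta_lifts.
apply/esym; apply: Ext_mulE (liftP z) _ => j p.
have [_ _ Ga _] := liftP z.
rewrite wE /yoneda big_ord_recr big1 /= => [|i _]; last first.
  rewrite delta_ne ?scaler0 ?(lin0 ((cocycleP _).1 i).1) //.
  by rewrite neq_ltn ltn_ord orbT.
rewrite add0r delta_id (linZ _ _ ((cocycleP _).1 j).1) big_ord_recl big1 => [|i _]; last first.
  by rewrite class_cocycleE (concentrated_ne _ (@pair_cochain_linear _ _)).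
rewrite addr0 class_cocycleE concentratedE -Ga /= /tate_aug !scalerA.
by congr (_ *: _); exact: mulrC.
Qed.
End Classes.

(** * Products of the classes *)

Section Products.
Variables (k : fieldType) (E : comAlgType k) (M : lmodType E) (a b : nat).
Variables (x y u v P Q P' Q' : E) (m1 : M).
Hypothesis td : tate_data a b x y u v P Q P' Q' m1.
Local Notation K := (tate td).
Local Notation E2 := ((E^o * E^o)%type : lmodType E).
Local Notation xb := (x ^+ b.-1).
Local Notation ya := (y ^+ a.-1).
Local Notation hcl := (hclass td).
Local Notation basic_cocycle := (class_cocycle td).
Local Notation values := (class_values a b x y m1).
Local Notation derx := (derivx a x y).
Local Notation dery := (derivy b x y).
Local Notation pairing n m := (@pair_cochain _ _ _ _ _ _ _ _ _ _ _ _ _ _ td n m).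
Local Notation pairing_linear n m := (@pair_cochain_linear _ _ _ _ _ _ _ _ _ _ _ _ _ _ td n m).

(** Division by t, a chain map because the differential is 2-periodic; on K_2 it forgets e_1 e_2. *)
Definition drop2 i : K (i + 2)%N -> K i :=
  match i return K (i + 2)%N -> K i with
  | 0%N => fun p : E2 => p.1
  | _.+1 => fun p : E2 => p
  end.

Lemma drop2_linear i : linear (@drop2 i).
Proof. by case: i. Qed.

Lemma drop2_lifts : lifts (basic_cocycle 2 1 0) (shift_lift drop2).
Proof.
have [|p|i p|Gl Gt Ga Gd] := @shift_lifts _ _ _ K 2 drop2 (pairing 2 (values 2 1 0)).
- exact: drop2_linear.
- by rewrite /= scale1r scaler0 addr0.
- by case: i p => [|i] p //=; rewrite oddD addbF.
split=> // j p; by rewrite Ga class_cocycleE.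
Qed.

Lemma mulT n c c' : hcl n c c' * hcl 2 1 0 = hcl (n + 2) c c'.
Proof.
apply: Ext_mulE drop2_lifts _ => j p; rewrite class_cocycleE.
have -> : cocycle_val (basic_cocycle n c c') = concentrated (pairing n (values n c c')).
  by apply: cochainP => i q; rewrite class_cocycleE.
rewrite (yoneda_shift (h := drop2)) //; last exact: drop2_linear.
  rewrite /concentrated; move: (delta (n + 2) p) => {p} p.
  case: n p => [|n] p; first by rewrite /= scaler0 addr0.
  suff -> : values (n.+1 + 2) c c' = values n.+1 c c' by [].
  by rewrite /class_values oddD addbF.
exact: pair_cochain_linear.
Qed.

Section DerivationLift.
Variables (c c' : E).
Let f := derx c c'.
Let g := dery c c'.

Definition drop1 i : K (i + 1)%N -> K i :=
  match i return K (i + 1)%N -> K i with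
  | 0%N => der_lift0 f g
  | i'.+1 => if odd i' then der_lift_odd P' Q' f g else der_lift_even P' Q' f g
  end.

Lemma drop1_linear i : linear (@drop1 i).
Proof.
case: i => [|i]; first exact: der_lift0_linear.
rewrite /drop1; case: (odd i); first exact: der_lift_odd_linear.
exact: der_lift_even_linear.
Qed.

Lemma drop1_lifts : lifts (basic_cocycle 1 c c') (shift_lift drop1).
Proof.
have d := PQ_derivation td c c'.
have [|p|i p|Gl Gt Ga Gd] := @shift_lifts _ _ _ K 1 drop1 (pairing 1 (values 1 c c')).
- exact: drop1_linear.
- by rewrite /= /tate_aug /= /der_lift0 scalerDl !scalerA.
- case: i p => [|i] p /=; first exact: diff0_der_lift.
  rewrite addn1 /=; case: (odd i) => /=; first exact: diff_odd_der_lift.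
  exact: diff_even_der_lift.
split=> // j p; by rewrite Ga class_cocycleE.
Qed.
End DerivationLift.

Lemma hcl_cochain n c c' :
  cocycle_val (basic_cocycle n c c') = concentrated (pairing n (values n c c')).
Proof. by apply: cochainP => i q; rewrite class_cocycleE. Qed.

(** The order opposite to [mulT]; the two together show that T commutes with the classes of degree
    1. *)
Lemma mulTY c c' : hcl 2 1 0 * hcl 1 c c' = hcl 3 c c'.
Proof.
apply: Ext_mulE (drop1_lifts c c') _ => j p; rewrite !hcl_cochain.
rewrite (yoneda_shift (h := drop1 c c')); last exact: drop1_linear.
  rewrite /concentrated; move: (delta 3 p) => {p} p.
  by rewrite /= scaler0 addr0 scale1r scalerDl !scalerA.
exact: pair_cochain_linear.
Qed.

(** With (f, g) the lifted derivation and (f', g') the other one, the product sends t to P' f f' +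
    Q' g g' and e_1 e_2 to g f' - f g'. The latter is 0, and the former lies in the ideal (x^(b-1),
    y^(a-1)) of values of coboundaries on t. *)
Lemma mulYY c c' d d' : hcl 1 c c' * hcl 1 d d' = 0.
Proof.
have [w wE] := yoneda_witness (basic_cocycle 1 c c') (drop1_lifts d d').
rewrite /hclass -[LHS]/(Ext_mul _ _) (Ext_mulE (drop1_lifts d d') wE).
have -> : 0 = Ext_class (0 : cocycle K) by rewrite /Ext_class piE.
apply/Ext_class_eq => j.
apply: (cbd_ext (f := cocycle_val w j)); first by move=> p; rewrite -[RHS]/(_ - 0) subr0.
have {}wE i p : cocycle_val w i p = concentrated (K := K) (n := (1 + 1)%N)
    (fun q : K (1 + 1)%N => pairing 1 (values 1 c c') (drop1 d d' q)) p.
  rewrite wE !hcl_cochain (yoneda_shift (h := drop1 d d')) //; last exact: drop1_linear.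
  exact: pair_cochain_linear.
have hl : linear (fun q : K (1 + 1)%N => pairing 1 (values 1 c c') (drop1 d d' q)).
  by apply: comp_linear; [exact: pair_cochain_linear | exact: drop1_linear].
have [e|j2] := eqVneq j 2; last first.
  by apply: cbd_ext (cbd0 _ _) => p; rewrite wE (concentrated_ne _ hl).
subst j.
have [ca caE] := td_a_unit td; have [cb cbE] := td_b_unit td.
have [n1 hP'] := td_P' td; have [n2 hQ'] := td_Q' td.
have xyab : x * xb = y * ya.
  by rewrite -!exprS !prednK ?(td_a_gt0 td) ?(td_b_gt0 td) ?(td_rel td).
(* In f f' every term is a multiple of x except the one with y^(2(a-1)) c' d'. The factor x turns P'
   into x^(b-1) [n1], and the remaining term is a multiple of y^(a-1); g g' is treated in the same
   way. Collecting the cofactors of x^(b-1) and y^(a-1) gives [g1] and [g2]. *)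
pose g1 := ((x * c * d + ya * (c * d' + c' * d)) *+ (a * a)) * n1
           + (xb * c' * d' * Q') *+ (b * b).
pose g2 := (ya * c' * d' * P') *+ (a * a)
           + ((y * c * d + xb * (c * d' + c' * d)) *+ (b * b)) * n2.
have key : (P' * derx d d' * derx c c' + Q' * dery d d' * dery c c') *: m1 =
    (xb * g1 + ya * g2) *: m1.
  have -> : P' * derx d d' * derx c c' + Q' * dery d d' * dery c c' =
      ((x * c * d + ya * (c * d' + c' * d)) *+ (a * a)) * (x * P') +
      ((y * c * d + xb * (c * d' + c' * d)) *+ (b * b)) * (y * Q') +
      (xb * ((xb * c' * d' * Q') *+ (b * b)) + ya * ((ya * c' * d' * P') *+ (a * a))).
    by rewrite /derivx /derivy; ring.
  rewrite !scalerDl -![(_ * (x * P')) *: _]scalerA -![(_ * (y * Q')) *: _]scalerA.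
  rewrite hP' hQ' !scalerA -!scalerDl; congr (_ *: _).
  by rewrite /g1 /g2; ring.
(* The 2 x 2 determinant of two derivations is a multiple of x x^(b-1) - y y^(a-1) = 0. *)
have swap : dery d d' * derx c c' = derx d d' * dery c c'.
  rewrite /derivx /derivy; apply/eqP; rewrite -subr_eq0; apply/eqP.
  apply: (@etrans _ _ ((x * xb - y * ya) * (c * d' - c' * d) *+ (a * b))); first by ring.
  by rewrite xyab subrr mul0r mul0rn.
(* A cochain (m, m') has coboundary a y^(a-1) m' - b x^(b-1) m on t, whence the sign and the
   inverses [cb] of b and [ca] of a. *)
have Hl := pairing_linear 1 (- (cb * g1) *: m1, (ca * g2) *: m1).
exists (projT1 (lin_pack Hl)) => p; rewrite (projT2 (lin_pack Hl)) wE.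
rewrite concentratedE.
apply/esym/(etrans (pair_cochain_diff_even td _ _ _)).
case: p => p1 p2 /=.
have -> : (ya *+ a) *: ((ca * g2) *: m1) - (xb *+ b) *: (- (cb * g1) *: m1) =
    (xb * g1 + ya * g2) *: m1.
  rewrite !scalerA -scalerBl mulrN opprK; congr (_ *: _).
  apply: (@etrans _ _ (ya * g2 * (ca *+ a) + xb * g1 * (cb *+ b))).
    by ring.
  by rewrite caE cbE !mulr1 addrC.
rewrite -key !scalerA -scalerDl; congr (_ *: _).
have h (p q f g f' g' : E) : g * f' = f * g' ->
    p * (P' * f * f' + Q' * g * g') =
    (p * (P' * f) + q * g) * f' + (p * (Q' * g) - q * f) * g'.
  move=> fg; apply: (@etrans _ _ (p * (P' * f * f' + Q' * g * g') + q * (g * f' - f * g'))).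
    by rewrite fg; ring.
  by ring.
exact: h.
Qed.

End Products.

(** * The classes span Ext and commute; when they vanish *)

Section Structure.
Variables (k : fieldType) (E : comAlgType k) (M : lmodType E) (a b : nat).
Variables (x y u v P Q P' Q' : E) (m1 : M).
Hypothesis td : tate_data a b x y u v P Q P' Q' m1.
Local Notation K := (tate td).
Local Notation E1 := (E^o : lmodType E).
Local Notation E2 := ((E^o * E^o)%type : lmodType E).
Local Notation xb := (x ^+ b.-1).
Local Notation ya := (y ^+ a.-1).
Local Notation hcl := (hclass td).
Local Notation values := (class_values a b x y m1).
Local Notation derx := (derivx a x y).
Local Notation dery := (derivy b x y).
Local Notation pairing n m := (@pair_cochain _ _ _ _ _ _ _ _ _ _ _ _ _ _ td n m).

Lemma linear_regular (h : E1 -> M) e : linear h -> h e = (e : E) *: h (1 : E).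
Proof. by move=> hl; rewrite -(linZ _ _ hl); congr h; rewrite -[RHS]/(_ * _) mulr1. Qed.

Lemma linear_regular2 (h : E2 -> M) (p : E2) : linear h ->
  h p = (p.1 : E) *: h (1 : E, 0 : E) + (p.2 : E) *: h (0 : E, 1 : E).
Proof.
move=> hl; rewrite -!(linZ _ _ hl) -(linD _ _ hl); case: p => p q; congr (h (_, _)).
  by rewrite -[RHS]/((p * 1 + q * 0) : E) mulr1 mulr0 addr0.
by rewrite -[RHS]/((p * 0 + q * 1) : E) mulr1 mulr0 add0r.
Qed.

Lemma values_surj n (f : K n -> M) : linear f -> (forall p, f (res_d K n p) = 0) ->
  exists c c', forall p, f p = pairing n (values n c c') p.
Proof.
move=> fl fd.
have [ca caE] := td_a_unit td; have [cb cbE] := td_b_unit td.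
case: n f fl fd => [|n] f fl fd.
  have [c cE] := td_gen td (f (1 : E)); exists c, 0 => p.
  by rewrite (linear_regular _ fl) -cE.
set m := f (1 : E, 0 : E); set m' := f (0 : E, 1 : E).
have fE p : f p = pairing 1 (m, m') p by apply: linear_regular2.
case no : (odd n).
  (* Even degree: the cocycle condition on the second generator is b x^(b-1) m' = 0. *)
  have m'0 : m' = 0.
    have := fd (0 : E, 1 : E); rewrite /= /tate_d /= no fE (pair_cochain_diff_odd td) /=.
    rewrite scale0r add0r scale1r => /eqP; rewrite oppr_eq0 => /eqP h.
    apply: (td_reg td); rewrite -[LHS]scale1r -cbE -mulr_natr scalerA.
    by rewrite -mulrA [_%:R * _]mulrC mulr_natr -scalerA h scaler0.
  have [c cE] := td_gen td m; exists c, 0 => p.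
  by rewrite fE /class_values /= no /= m'0 -cE.
(* Odd degree: the cocycle condition is b x^(b-1) m = a y^(a-1) m', and dividing it by a b brings it
   to the form of [td_der]. *)
have [|c [c' [mE m'E]]] := td_der td (m := ca *: m) (m' := cb *: m').
  have := fd (1 : E, 0 : E); rewrite /= /tate_d /= no fE (pair_cochain_diff_even td) /=.
  rewrite scale1r => /eqP; rewrite subr_eq0 => /eqP h.
  rewrite -[LHS]scale1r -[RHS]scale1r -{1}cbE -caE !scalerA.
  apply: (@etrans _ _ (((ca * cb) * (xb *+ b)) *: m)); first by congr (_ *: _); ring.
  by rewrite -scalerA -h scalerA; congr (_ *: _); ring.
exists c, c' => p.
have -> : values n.+1 c c' = (m, m').
  rewrite /class_values /= no /= /derivx /derivy; congr (_, _).
    by rewrite -mulr_natl -scalerA -mE scalerA mulr_natl caE scale1r.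
  by rewrite -mulr_natl -scalerA -m'E scalerA mulr_natl cbE scale1r.
exact: fE.
Qed.

Lemma Ext_class_sum (I : Type) (s : seq I) (z : I -> cocycle K) :
  \sum_(i <- s) Ext_class (z i) = Ext_class (\sum_(i <- s) z i).
Proof.
elim: s => [|i s IH]; last by rewrite !big_cons IH Ext_classD.
by rewrite !big_nil /Ext_class piE.
Qed.

Lemma cocycle_val_sum (I : Type) (s : seq I) (z : I -> cocycle K) j p :
  cocycle_val (\sum_(i <- s) z i) j p = \sum_(i <- s) cocycle_val (z i) j p.
Proof.
elim: s => [|i s IH]; first by rewrite !big_nil.
by rewrite !big_cons -IH.
Qed.

Lemma basic_sum_val (N : nat) (c c' : nat -> E) j p : (j < N)%N ->
  cocycle_val (\sum_(n < N) class_cocycle td n (c n) (c' n)) j p =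
  pairing j (values j (c j) (c' j)) p.
Proof.
move=> jN; rewrite cocycle_val_sum (bigD1 (Ordinal jN)) //= big1 => [|i ij].
  by rewrite addr0 class_cocycleE concentratedE.
rewrite class_cocycleE (concentrated_ne _ (@pair_cochain_linear _ _ _ _ _ _ _ _ _ _ _ _ _ _ td _ _)) //.
by rewrite eq_sym.
Qed.

Lemma hclass_span (X : Ext K) : exists N c c', X = \sum_(n < N) hcl n (c n) (c' n).
Proof.
have [z ->] := Ext_classP X; have [zc [N zN]] := cocycleP z.
have h n : exists cc : E * E, forall p, cocycle_val z n p = pairing n (values n cc.1 cc.2) p.
  have [zl zd] := zc n; have [c [c' h]] := values_surj zl zd.
  by exists (c, c').
pose cc n := projT1 (cid (h n)).
have ccE n p : cocycle_val z n p = pairing n (values n (cc n).1 (cc n).2) p.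
  exact: (projT2 (cid (h n))).
exists N, (fun n => (cc n).1), (fun n => (cc n).2).
rewrite Ext_class_sum; apply/Ext_class_eq => j.
have [jN|Nj] := ltnP j N.
  apply: cbd_ext (cbd0 _ _) => p; rewrite -[RHS]/(_ - cocycle_val _ j p).
  by rewrite (basic_sum_val (fun n => (cc n).1) (fun n => (cc n).2)) // -ccE subrr.
apply: cbd_ext (zN j Nj) => p; rewrite -[RHS]/(_ - cocycle_val _ j p).
rewrite cocycle_val_sum big1 ?subr0 // => i _.
rewrite class_cocycleE (concentrated_ne _ (@pair_cochain_linear _ _ _ _ _ _ _ _ _ _ _ _ _ _ td _ _)) //.
by rewrite neq_ltn (leq_trans (ltn_ord i) Nj) orbT.
Qed.

Lemma hclass_T n m c c' : hcl (n + m.*2) c c' = hcl n c c' * hcl 2 1 0 ^+ m.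
Proof.
elim: m => [|m IH]; first by rewrite addn0 mulr1.
by rewrite exprSr mulrA -IH mulT -addnA; congr hclass; lia.
Qed.

Lemma hclass_comm n c c' (X : Ext K) :
  GRing.comm X (hcl (odd n) c c') -> GRing.comm X (hcl 2 1 0) -> GRing.comm X (hcl n c c').
Proof.
move=> h hT; rewrite -[n in hcl n]odd_double_half hclass_T.
by apply: commrM => //; apply: commrX.
Qed.

(** Every class is a combination of products of a class of degree 0 or 1 with a power of T, and
    those of degree 0 are central. *)
Lemma comm_span (X : Ext K) :
  (forall c c', GRing.comm X (hcl 1 c c')) -> GRing.comm X (hcl 2 1 0) ->
  forall Z, GRing.comm X Z.
Proof.
move=> h1 hT Z; have [N [c [c' ->]]] := hclass_span Z.
apply: commr_sum => n _; apply: hclass_comm => //.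
case: (odd n) => //; rewrite (@hclass_even _ _ _ _ _ _ _ _ _ _ _ _ _ _ td 0 _ _ 0) //.
exact: hclass0_central.
Qed.

Lemma hcl1_T c c' : GRing.comm (hcl 1 c c') (hcl 2 1 0).
Proof. by rewrite /GRing.comm mulTY mulT. Qed.

(** Two classes of degree 1 commute since both products are 0. This is why Ext is strictly
    commutative, although it has odd generators. *)
Lemma hcl1_central c c' Z : GRing.comm Z (hcl 1 c c').
Proof.
apply/commr_sym/comm_span; last exact: hcl1_T.
by move=> d d'; rewrite /GRing.comm !mulYY.
Qed.

Lemma T_central Z : GRing.comm Z (hcl 2 1 0).
Proof.
by apply/commr_sym/comm_span => // c c'; apply/commr_sym/hcl1_T.
Qed.

(** What the vanishing of a class forces on its coefficients. There are no nonzero coboundaries in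
    degree 1, as u and v act as 0; in higher odd degrees they are the multiples of Y_2, in positive
    even degrees the values in (x^(b-1), y^(a-1)). *)
Definition vanishing (n : nat) (c c' : E) : Prop :=
  match n with
  | 0%N => c *: m1 = 0
  | 1%N => (x * c + ya * c') *: m1 = 0 /\ (y * c + xb * c') *: m1 = 0
  | m.+2 => if odd m
    then exists e, (x * c + ya * c') *: m1 = (ya * e) *: m1 /\
                   (y * c + xb * c') *: m1 = (xb * e) *: m1
    else exists e e', c *: m1 = (xb * e + ya * e') *: m1
  end.

Lemma hclass_vanishing N (c c' : nat -> E) :
  \sum_(n < N) hcl n (c n) (c' n) = 0 -> forall n, (n < N)%N -> vanishing n (c n) (c' n).
Proof.
have [ca caE] := td_a_unit td; have [cb cbE] := td_b_unit td.
move=> h n nN.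
have cb_at : coboundary_at (pairing n (values n (c n) (c' n))).
  have h0 : 0 = Ext_class (0 : cocycle K) by rewrite /Ext_class piE.
  move: h; rewrite Ext_class_sum h0 => /Ext_class_eq /(_ n).
  by apply: cbd_ext => p; rewrite -[LHS]/(cocycle_val _ n p - 0) subr0 basic_sum_val.
have derxE e e' m : derx e e' *: m1 = m -> (x * e + ya * e') *: m1 = ca *: m.
  by move=> <-; rewrite scalerA /derivx mulrnAr -mulrnAl caE mul1r.
have deryE e e' m : dery e e' *: m1 = m -> (y * e + xb * e') *: m1 = cb *: m.
  by move=> <-; rewrite scalerA /derivy mulrnAr -mulrnAl cbE mul1r.
case: n nN cb_at => [|[|n]] nN.
- by move=> /(_ (1 : E)) /=; rewrite scale1r.
- case=> H HE.
  have HE' p : H (res_d K 0 p) = 0.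
    rewrite (linear_regular _ (linearP H)) /= /diff0 scalerDl -!scalerA.
    by rewrite (td_u td) (td_v td) !scaler0 addr0.
  split.
    rewrite (derxE _ _ 0) ?scaler0 //.
    by have := HE (1 : E, 0 : E); rewrite HE' /= scale1r scale0r addr0.
  rewrite (deryE _ _ 0) ?scaler0 //.
  by have := HE (0 : E, 1 : E); rewrite HE' /= scale1r scale0r add0r.
- case=> H HE.
  have H2 p : H p = pairing 1 (H (1 : E, 0 : E), H (0 : E, 1 : E)) p.
    exact: (linear_regular2 _ (linearP H)).
  have [e eE] := td_gen td (H (1 : E, 0 : E)); have [e' e'E] := td_gen td (H (0 : E, 1 : E)).
  rewrite -eE -e'E in H2.
  rewrite /vanishing; case no : (odd n).
    (* The coboundary of the cochain (e, e') is - e' times Y_2: only its value on the generator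
       containing e_1 e_2 contributes. *)
    exists (- e').
    have HE' p : pairing n.+2 (values n.+2 (c n.+2) (c' n.+2)) p =
        pairing 1 (e *: m1, e' *: m1) (diff_odd u v P Q p).
      by rewrite HE H2 /= no.
    split.
      rewrite (derxE _ _ (- ((ya *+ a) *: (e' *: m1)))).
        rewrite scalerN !scalerA mulrN scaleNr; congr (- (_ *: _)).
        by apply: (@etrans _ _ ((ca *+ a) * (ya * e'))); [ring | rewrite caE mul1r].
      have := HE' (1 : E, 0 : E); rewrite (pair_cochain_diff_odd td).
      by rewrite /class_values /= no /= !scale0r !addr0 !scale1r.
    rewrite (deryE _ _ (- ((xb *+ b) *: (e' *: m1)))).
      rewrite scalerN !scalerA mulrN scaleNr; congr (- (_ *: _)).
      by apply: (@etrans _ _ ((cb *+ b) * (xb * e'))); [ring | rewrite cbE mul1r].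
    have := HE' (0 : E, 1 : E); rewrite (pair_cochain_diff_odd td).
    by rewrite /class_values /= no /= !scale0r !add0r !scale1r.
  exists (- (e *+ b)), (e' *+ a).
  have HE' p : pairing n.+2 (values n.+2 (c n.+2) (c' n.+2)) p =
      pairing 1 (e *: m1, e' *: m1) (diff_even u v P Q p).
    by rewrite HE H2 /= no.
  have := HE' (1 : E, 0 : E); rewrite (pair_cochain_diff_even td).
  rewrite /class_values /= no /= scale0r addr0 !scale1r => ->.
  by rewrite !scalerA -scalerBl; congr (_ *: _); ring.
Qed.

End Structure.

(** * Normal forms in the presented algebra *)

Section BivariatePolynomials.
Variables (k : fieldType) (a b : nat).
Hypotheses (a_gt0 : (0 < a)%N) (b_gt0 : (0 < b)%N).
Local Notation R2 := {poly {poly k}}.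
Local Notation X := ('X%:P : R2).
Local Notation Y := ('X : R2).
Local Notation F := (curve k a b).

Lemma horner0_mulY (q : R2) : q.[0] = 0 -> exists r, q = Y * r.
Proof.
move/eqP => /factor_theorem [r ->]; exists r.
by rewrite polyC0 subr0 mulrC.
Qed.

Lemma bivariate_decomp (q : R2) : exists (c : k) q1 q2, q = c%:P%:P + X * q1 + Y * q2.
Proof.
have [|q2 q2E] := @horner0_mulY (q - q.[0]%:P); first by rewrite !hornerE subrr.
have /factor_theorem [r rE] : root (q.[0] - q.[0].[0]%:P) 0.
  by rewrite /root !hornerE subrr.
exists q.[0].[0], r%:P, q2; rewrite -q2E -rmorphM /=.
rewrite polyC0 subr0 in rE.
by rewrite mulrC -rE rmorphB /= addrC [_%:P + _]addrC subrK subrK.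
Qed.

Lemma curve_horner0 : F.[0] = - 'X^b.
Proof.
by rewrite /curve hornerD hornerXn hornerN hornerC expr0n eqn0Ngt a_gt0 sub0r.
Qed.

(** At y = 0 the equation reads c x^(b-1) = - r(x, 0) x^b. The coefficient of x^(b-1) gives c = 0,
    then r(x, 0) = 0, and a factor y can be cancelled. *)
Lemma curve_vanish_derivation (p : R2) (c : k) (r : R2) :
  Y * p + X ^+ b.-1 * c%:P%:P = r * F -> c = 0 /\ exists r', p = r' * F.
Proof.
move=> h; have h0 : 'X^(b.-1) * c%:P = - (r.[0] * 'X^b).
  have := congr1 (horner^~ 0) h; rewrite /= hornerD !hornerM hornerX mul0r add0r.
  rewrite curve_horner0 mulrN => <-.
  by rewrite -polyC_exp !hornerC.
have c0 : c = 0.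
  have := congr1 (fun s : {poly k} => s`_b.-1) h0.
  by rewrite /= mulrC coefCM coefXn eqxx mulr1 coefN coefMXn prednK // leqnn oppr0.
split=> //; move: h h0; rewrite c0 !rmorph0 mulr0 addr0 mulr0 => h h0.
have [|r' rE] := @horner0_mulY r.
  have /eqP : r.[0] * 'X^b = 0 by apply/eqP; rewrite -oppr_eq0 -h0.
  by rewrite mulf_eq0 (negbTE (monic_neq0 (monicXn _ _))) orbF => /eqP.
exists r'; apply: (mulfI (monic_neq0 (monicX _))).
by rewrite h rE mulrA.
Qed.

(** Expanding F gives y (p - r y^(a-1)) = x^(b-1) (- q - r x); y divides the last factor, as it is
    coprime to x. *)
Lemma curve_vanish_quotient (p q r : R2) :
  Y * p + X ^+ b.-1 * q = r * F ->
  exists s, p = r * Y ^+ a.-1 + X ^+ b.-1 * s.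
Proof.
move=> h.
have h1 : Y * (p - r * Y ^+ a.-1) = X ^+ b.-1 * (- q - r * X).
  apply/eqP; rewrite -subr_eq0; apply/eqP.
  have FE : F = Y * Y ^+ a.-1 - X * X ^+ b.-1.
    by rewrite /curve -!exprS !prednK // polyC_exp.
  apply: (@etrans _ _ ((Y * p + X ^+ b.-1 * q) - r * (Y * Y ^+ a.-1 - X * X ^+ b.-1))).
    by ring.
  by rewrite -FE h subrr.
have [|s sE] := @horner0_mulY (- q - r * X).
  have := congr1 (horner^~ 0) h1; rewrite /= hornerM hornerX mul0r hornerM.
  rewrite -polyC_exp hornerC => /esym/eqP.
  by rewrite mulf_eq0 (negbTE (monic_neq0 (monicXn _ _))) => /eqP.
exists s; apply/eqP; rewrite addrC -subr_eq; apply/eqP/(mulfI (monic_neq0 (monicX _))).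
by rewrite h1 sE mulrCA.
Qed.
End BivariatePolynomials.

(** Stated for elements of any ring, since it is applied both to the classes in Ext and to the
    images of the variables in the presented algebra. *)
Record pres_relations (W : comNzRingType) (a b : nat) (X1 X2 Y1 Y2 T : W) : Prop := {
  rel_curve : X1 ^+ b = X2 ^+ a;
  rel_X1T : X1 ^+ b.-1 * T = 0;
  rel_X2T : X2 ^+ a.-1 * T = 0;
  rel_Y2T : Y2 * T = 0;
  rel_Y1Y1 : Y1 * Y1 = 0;
  rel_Y2Y2 : Y2 * Y2 = 0;
  rel_Y1Y2 : Y1 * Y2 = 0;
  rel_X1Y2 : X1 * Y2 = X2 ^+ a.-1 * Y1;
  rel_X2Y2 : X2 * Y2 = X1 ^+ b.-1 * Y1
}.

Section NormalForm.
Variables (k : fieldType) (W : comAlgType k) (X1 X2 Y1 Y2 T : W).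
Local Notation R2 := {poly {poly k}}.

Definition iota : R2 -> W := ev2 (in_alg W) X1 X2.
HB.instance Definition _ := GRing.RMorphism.on iota.

Lemma iotaB : {morph iota : p q / p - q}.
Proof. by move=> p q; apply: raddfB. Qed.
Lemma iotaC c : iota c%:P%:P = c%:A.
Proof. exact: ev2CC. Qed.
Lemma iotaX : iota 'X%:P = X1.
Proof. exact: ev2CX. Qed.
Lemma iotaY : iota 'X = X2.
Proof. exact: ev2X. Qed.

(** The counterpart of [hclass n], with polynomials as coefficients. These elements span but are not
    independent: p and q matter only up to the relations. *)
Definition basis n (p q : R2) : W :=
  if odd n then (iota p * Y1 + iota q * Y2) * T ^+ n./2 else iota p * T ^+ n./2.

Lemma basisD n p q p' q' : basis n (p + p') (q + q') = basis n p q + basis n p' q'.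
Proof. by rewrite /basis !rmorphD; case: (odd n); ring. Qed.

Lemma basis0 n : basis n 0 0 = 0.
Proof. by rewrite /basis !rmorph0; case: (odd n); rewrite ?mul0r ?addr0 ?mul0r. Qed.

Lemma basisM n p q r : basis n (p * r) (q * r) = basis n p q * iota r.
Proof. by rewrite /basis !rmorphM; case: (odd n); ring. Qed.

Lemma basis_iota n p q r s : s = iota r -> basis n p q * s = basis n (p * r) (q * r).
Proof. by move=> ->; rewrite basisM. Qed.

Lemma basis_T n p q : basis n p q * T = basis (n + 2) p q.
Proof.
rewrite /basis oddD addbF halfD andbF add0n addn1.
by case: (odd n); rewrite -mulrA -exprSr.
Qed.

Definition normal_form (w : W) : Prop := exists N (p q : nat -> R2),
  (forall n, (N <= n)%N -> p n = 0 /\ q n = 0) /\ w = \sum_(n < N) basis n (p n) (q n).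

Lemma sum_extend N N' (F : nat -> W) : (N <= N')%N ->
  (forall n, (N <= n)%N -> F n = 0) -> \sum_(n < N) F n = \sum_(n < N') F n.
Proof.
move=> NN' F0; rewrite -!(big_mkord xpredT F) (@big_cat_nat _ _ _ N 0 N') //=.
by rewrite [X in _ + X]big_nat_cond [X in _ + X]big1 ?addr0 // => i /andP[/andP[/F0]].
Qed.

Lemma normal_formD w w' : normal_form w -> normal_form w' -> normal_form (w + w').
Proof.
move=> [N [p [q [pq0 ->]]]] [N' [p' [q' [pq0' ->]]]].
exists (maxn N N'), (fun n => p n + p' n), (fun n => q n + q' n); split.
  by move=> n; rewrite geq_max => /andP[/pq0 [-> ->] /pq0' [-> ->]]; rewrite addr0.
rewrite (@sum_extend N (maxn N N') (fun n => basis n (p n) (q n))) ?leq_maxl //; last first.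
  by move=> n /pq0 [-> ->]; rewrite basis0.
rewrite (@sum_extend N' (maxn N N') (fun n => basis n (p' n) (q' n))) ?leq_maxr //; last first.
  by move=> n /pq0' [-> ->]; rewrite basis0.
by rewrite -big_split; apply: eq_bigr => n _; rewrite basisD.
Qed.

Lemma normal_form_basis n p q : normal_form (basis n p q).
Proof.
exists n.+1, (fun j => if j == n then p else 0), (fun j => if j == n then q else 0).
split; first by move=> j nj; case: eqP => // jn; rewrite jn ltnn in nj.
rewrite (bigD1 ord_max) //= eqxx big1 ?addr0 // => i.
rewrite -val_eqE /= => /negbTE ->; exact: basis0.
Qed.

Lemma normal_form0 : normal_form 0.
Proof. by rewrite -(basis0 0); apply: normal_form_basis. Qed.

Lemma normal_form_sum (I : Type) (s : seq I) (w : I -> W) :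
  (forall i, normal_form (w i)) -> normal_form (\sum_(i <- s) w i).
Proof.
move=> h; elim: s => [|i s IH]; first by rewrite big_nil; apply: normal_form0.
by rewrite big_cons; apply: normal_formD.
Qed.

Lemma normal_formM g : (forall n p q, normal_form (basis n p q * g)) ->
  forall w, normal_form w -> normal_form (w * g).
Proof.
move=> h w [N [p [q [_ ->]]]]; rewrite mulr_suml.
by apply: normal_form_sum.
Qed.

Lemma normal_form_expr g : (forall n p q, normal_form (basis n p q * g)) ->
  forall w m, normal_form w -> normal_form (w * g ^+ m).
Proof.
move=> h w m nw; elim: m => [|m IH]; first by rewrite mulr1.
by rewrite exprSr mulrA; apply: normal_formM.
Qed.

Definition gen : 'I_5 -> W := tnth [tuple X1; X2; Y1; Y2; T].

Lemma mmap1_gen (m : 'X_{1..5}) : mmap1 gen m =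
  X1 ^+ m (@Ordinal 5 0 isT) * X2 ^+ m (@Ordinal 5 1 isT) * Y1 ^+ m (@Ordinal 5 2 isT) *
  Y2 ^+ m (@Ordinal 5 3 isT) * T ^+ m (@Ordinal 5 4 isT).
Proof.
rewrite /mmap1 !big_ord_recl big_ord0 mulr1 !mulrA.
congr (_ * _ * _ * _ * _); rewrite /gen (tnth_nth 0) /=; congr (_ ^+ m _); by apply: val_inj.
Qed.

Variables (a b : nat).
Hypotheses (a_gt0 : (0 < a)%N) (b_gt0 : (0 < b)%N).
Hypothesis rel : pres_relations a b X1 X2 Y1 Y2 T.

(** Normal forms are stable under multiplication by each generator, so every monomial is reached
    from its coefficient one variable at a time. *)
Lemma normal_form_mmap (f : {mpoly k[5]}) : normal_form (mmap (in_alg W) gen f).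
Proof.
have hX1 n p q : normal_form (basis n p q * X1).
  by rewrite (@basis_iota n p q 'X%:P) ?iotaX //; apply: normal_form_basis.
have hX2 n p q : normal_form (basis n p q * X2).
  by rewrite (@basis_iota n p q 'X) ?iotaY //; apply: normal_form_basis.
have hY1 n p q : normal_form (basis n p q * Y1).
  case no : (odd n).
    suff -> : basis n p q * Y1 = 0 by exact: normal_form0.
    rewrite /basis no.
    apply: (@etrans _ _ ((iota p * (Y1 * Y1) + iota q * (Y1 * Y2)) * T ^+ n./2)).
      by ring.
    by rewrite (rel_Y1Y1 rel) (rel_Y1Y2 rel) !mulr0 addr0 mul0r.
  suff -> : basis n p q * Y1 = basis n.+1 p 0 by exact: normal_form_basis.
  by rewrite /basis /= no /= uphalf_half no rmorph0; ring.
have hY2 n p q : normal_form (basis n p q * Y2).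
  case no : (odd n).
    suff -> : basis n p q * Y2 = 0 by exact: normal_form0.
    rewrite /basis no.
    apply: (@etrans _ _ ((iota p * (Y1 * Y2) + iota q * (Y2 * Y2)) * T ^+ n./2)).
      by ring.
    by rewrite (rel_Y2Y2 rel) (rel_Y1Y2 rel) !mulr0 addr0 mul0r.
  suff -> : basis n p q * Y2 = basis n.+1 0 p by exact: normal_form_basis.
  by rewrite /basis /= no /= uphalf_half no rmorph0; ring.
have hT n p q : normal_form (basis n p q * T).
  by rewrite basis_T; apply: normal_form_basis.
apply: normal_form_sum => m; rewrite mmap1_gen !mulrA.
have B0 c : c%:A = basis 0 c%:P%:P 0 by rewrite /basis /= iotaC mulr1.
rewrite /= B0.
apply: (normal_form_expr hT _ (normal_form_expr hY2 _ (normal_form_expr hY1 _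
  (normal_form_expr hX2 _ (normal_form_expr hX1 _ _))))).
exact: normal_form_basis.
Qed.

Lemma iota_curve p : (exists r, p = r * curve k a b) -> iota p = 0.
Proof. by case=> r ->; rewrite rmorphM /= /iota ev2_curve ?mulr0 ?(rel_curve rel). Qed.

Local Notation F := (curve k a b).
Local Notation X := ('X%:P : R2).
Local Notation Y := ('X : R2).

(** Write q = c + x q1 + y q2. The relations for X_1 Y_2 and X_2 Y_2 move q1 and q2 to the
    coefficient of Y_1, which becomes [p']; what is left is p' Y_1 + c Y_2, and the hypothesis then
    forces c = 0 and p' in (F). *)
Lemma basis1_eq0 p q r :
  Y * p + X ^+ b.-1 * q = r * F -> basis 1 p q = 0.
Proof.
have FE : F = Y * Y ^+ a.-1 - X * X ^+ b.-1.
  by rewrite /curve -!exprS !prednK // polyC_exp.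
have [c [q1 [q2 ->]]] := bivariate_decomp q => h.
pose p' := p + q1 * Y ^+ a.-1 + q2 * X ^+ b.-1.
have [c0 p'0] : c = 0 /\ exists s, p' = s * F.
  apply: (@curve_vanish_derivation k a b a_gt0 b_gt0 p' c (r + q1)).
  rewrite mulrDl -h FE /p'; ring.
rewrite /basis /= expr0 mulr1 c0 !polyC0 add0r.
rewrite rmorphD !rmorphM /= iotaX iotaY.
apply: (@etrans _ _ (iota p' * Y1)); last by rewrite iota_curve ?mul0r.
rewrite /p' !rmorphD !rmorphM !rmorphXn /= iotaX iotaY.
apply: (@etrans _ _ (iota p * Y1 + iota q1 * (X1 * Y2) + iota q2 * (X2 * Y2))); first by ring.
by rewrite (rel_X1Y2 rel) (rel_X2Y2 rel); ring.
Qed.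

Lemma basis_even_eq0 n p q s s' r : ~~ odd n ->
  p - X ^+ b.-1 * s - Y ^+ a.-1 * s' = r * F -> basis n.+2 p q = 0.
Proof.
move=> no h; rewrite /basis /= (negbTE no) /= exprS.
have -> : p = r * F + X ^+ b.-1 * s + Y ^+ a.-1 * s' by rewrite -h; ring.
rewrite !rmorphD !rmorphM !rmorphXn /= iotaX iotaY.
have -> : iota F = 0 by apply: iota_curve; exists 1; rewrite mul1r.
apply: (@etrans _ _ ((iota s * (X1 ^+ b.-1 * T) + iota s' * (X2 ^+ a.-1 * T)) * T ^+ n./2)).
  by ring.
by rewrite (rel_X1T rel) (rel_X2T rel) !mulr0 addr0 mul0r.
Qed.

(** Y_2 T = 0 removes q, and the hypothesis puts p into (x^(b-1), y^(a-1)), which annihilates T. *)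
Lemma basis_odd_eq0 n p q s r : odd n ->
  Y * p + X ^+ b.-1 * (q - s) = r * F -> basis n.+2 p q = 0.
Proof.
move=> no h; rewrite /basis /= no /= exprS.
have [t ->] := curve_vanish_quotient a_gt0 b_gt0 h.
rewrite !rmorphD !rmorphM !rmorphXn /= iotaX iotaY.
apply: (@etrans _ _ ((iota r * (X2 ^+ a.-1 * T) * Y1 + iota t * (X1 ^+ b.-1 * T) * Y1
  + iota q * (Y2 * T)) * T ^+ n./2)); first by ring.
by rewrite (rel_X1T rel) (rel_X2T rel) (rel_Y2T rel) !mulr0 !mul0r !addr0 mul0r.
Qed.
End NormalForm.

Lemma rmorph_iota (k : fieldType) (W W' : comAlgType k) (phi : {rmorphism W -> W'})
    (X1 X2 : W) p : (forall c : k, phi c%:A = c%:A) ->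
  phi (iota X1 X2 p) = iota (phi X1) (phi X2) p.
Proof.
move=> pc; rewrite /iota !ev2E rmorph_sum; apply: eq_bigr => j _.
by rewrite rmorph_sum; apply: eq_bigr => i _; rewrite !rmorphM !rmorphXn /= pc.
Qed.

Lemma rmorph_basis (k : fieldType) (W W' : comAlgType k) (phi : {rmorphism W -> W'})
    (X1 X2 Y1 Y2 T : W) n p q : (forall c : k, phi c%:A = c%:A) ->
  phi (basis X1 X2 Y1 Y2 T n p q) =
  basis (phi X1) (phi X2) (phi Y1) (phi Y2) (phi T) n p q.
Proof.
move=> pc; rewrite /basis; case: (odd n);
by rewrite !(rmorphM, rmorphD, rmorphXn) /= !rmorph_iota.
Qed.

(** * The isomorphism *)

Section TateExt.
Variables (k : fieldType) (E : comAlgType k) (M : lmodType E) (a b : nat).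
Variables (x y u v P Q P' Q' : E) (m1 : M).
Hypothesis td : tate_data a b x y u v P Q P' Q' m1.
Local Notation K := (tate td).
Local Notation xb := (x ^+ b.-1).
Local Notation ya := (y ^+ a.-1).
Local Notation hcl := (hclass td).
Local Notation values := (class_values a b x y m1).
Local Notation pairing n m := (@pair_cochain _ _ _ _ _ _ _ _ _ _ _ _ _ _ td n m).
Local Notation pairing_linear n m := (@pair_cochain_linear _ _ _ _ _ _ _ _ _ _ _ _ _ _ td n m).

Lemma all_comm (X Z : Ext K) : X * Z = Z * X.
Proof. by apply: comm_span; [move=> c c'; apply: hcl1_central | apply: T_central]. Qed.

Fact tate_one_neq0 : (1 : Ext K) != 0.
Proof. by apply: Ext_one_neq0; exists m1; apply: (td_m1 td). Qed.

Definition tateExt : Type := Ext K.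
HB.instance Definition _ := GRing.PzRing.on tateExt.
HB.instance Definition _ := GRing.Lmodule.on tateExt.
HB.instance Definition _ := GRing.PzSemiRing_isNonZero.Build tateExt tate_one_neq0.
HB.instance Definition _ := GRing.PzRing_hasCommutativeMul.Build tateExt all_comm.
HB.instance Definition _ := GRing.Lmodule_isLalgebra.Build k tateExt (@Ext_scaleAl _ _ _ K).
HB.instance Definition _ := GRing.Lalgebra_isAlgebra.Build k tateExt (@Ext_scaleAr _ _ _ K).

Definition hcl0 (e : E) : tateExt := hcl 0 e 0.

Fact hcl0_additive : zmod_morphism hcl0.
Proof.
move=> c d; apply/eqP; rewrite eq_sym subr_eq; apply/eqP.
by rewrite /hcl0 -hclassD subrK addr0.
Qed.
HB.instance Definition _ := GRing.isZmodMorphism.Build E tateExt hcl0 hcl0_additive.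
Fact hcl0_monoid : monoid_morphism hcl0.
Proof.
split=> [|c d]; first exact: hclass1.
by rewrite /hcl0 mul_hclass0 mul0r.
Qed.
HB.instance Definition _ := GRing.isMonoidMorphism.Build E tateExt hcl0 hcl0_monoid.

Lemma hcl0_alg (c : k) : hcl0 c%:A = c%:A.
Proof. by rewrite /hcl0 -[X in hcl 0 _ X](scaler0 _ c) hclassZ hclass1. Qed.

Lemma mul_hcl0 n c c' d : (hcl n c c' : tateExt) * hcl0 d = hcl n (c * d) (c' * d).
Proof. exact: mul_hclass0. Qed.

Lemma hclass_values n c c' d d' : values n c c' = values n d d' -> hcl n c c' = hcl n d d'.
Proof. by move=> h; apply: Ext_class_ext => j p; rewrite !class_cocycleE h. Qed.

Lemma hclass_eq0 n c c' :
  coboundary_at (P := K) (pairing n (values n c c')) -> hcl n c c' = 0.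
Proof.
move=> h; have -> : 0 = Ext_class (0 : cocycle K) by rewrite /Ext_class piE.
apply/Ext_class_eq => j.
have [e|jn] := eqVneq j n.
  subst j; apply: cbd_ext h => p; rewrite -[RHS]/(cocycle_val _ n p - 0) subr0.
  by rewrite class_cocycleE concentratedE.
apply: cbd_ext (cbd0 _ _) => p; rewrite -[RHS]/(cocycle_val _ j p - 0) subr0.
by rewrite class_cocycleE (concentrated_ne _ (pairing_linear _ _)).
Qed.

Lemma hclass2_eq0 e e' : hcl 2 (xb * e + ya * e') 0 = 0.
Proof.
have [ca caE] := td_a_unit td; have [cb cbE] := td_b_unit td.
apply: hclass_eq0.
have Hl := pairing_linear 1 (- (cb * e) *: m1, (ca * e') *: m1).
exists (projT1 (lin_pack Hl)) => p; rewrite (projT2 (lin_pack Hl)).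
apply/esym/(etrans (pair_cochain_diff_even td _ _ _)).
case: p => p q; rewrite /= scaler0 addr0; congr (_ *: _).
rewrite !scalerA -scalerBl mulrN opprK; congr (_ *: _).
apply: (@etrans _ _ (ya * e' * (ca *+ a) + xb * e * (cb *+ b))); first by ring.
by rewrite caE cbE !mulr1 addrC.
Qed.

(** This is Y_2 T = 0. As d(t e_1) and d(t e_2) contain - Q e_1 e_2 and P e_1 e_2, sending e_1 e_2
    to - m1 gives the values of Y_2. *)
Lemma hclass3_eq0 : hcl 3 0 1 = 0.
Proof.
apply: hclass_eq0; have Hl := pairing_linear 2 (0, - m1).
exists (projT1 (lin_pack Hl)) => p; rewrite (projT2 (lin_pack Hl)).
apply/esym/(etrans (pair_cochain_diff_odd td _ _ _)).
case: p => p q; rewrite /= /derivx /derivy !mulr0 !mulr1 !add0r.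
by rewrite !scalerN opprD !opprK.
Qed.

Definition tX1 : tateExt := hcl0 x.
Definition tX2 : tateExt := hcl0 y.
Definition tY1 : tateExt := hcl 1 1 0.
Definition tY2 : tateExt := hcl 1 0 1.
Definition tT : tateExt := hcl 2 1 0.

Lemma tate_relations : pres_relations a b tX1 tX2 tY1 tY2 tT.
Proof.
have xyab : x * xb = y * ya.
  by rewrite -!exprS !prednK ?(td_a_gt0 td) ?(td_b_gt0 td) ?(td_rel td).
split.
- by rewrite /tX1 /tX2 -!rmorphXn (td_rel td).
- rewrite /tX1 -rmorphXn /= mulrC mul_hcl0 mul1r mul0r.
  by have := hclass2_eq0 1 0; rewrite mulr1 mulr0 addr0.
- rewrite /tX2 -rmorphXn /= mulrC mul_hcl0 mul1r mul0r.
  by have := hclass2_eq0 0 1; rewrite mulr1 mulr0 add0r.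
- exact: (etrans (mulT td 1 0 1) hclass3_eq0).
- exact: mulYY.
- exact: mulYY.
- exact: mulYY.
- rewrite /tX1 /tX2 -rmorphXn ![hcl0 _ * _]mulrC !mul_hcl0 !mul1r !mul0r.
  apply: hclass_values; rewrite /class_values /derivx /derivy /= !mulr0 !add0r !addr0.
  by rewrite ![_ * x]mulrC xyab.
- rewrite /tX1 /tX2 -rmorphXn ![hcl0 _ * _]mulrC !mul_hcl0 !mul1r !mul0r.
  apply: hclass_values; rewrite /class_values /derivx /derivy /= !mulr0 !add0r !addr0.
  by rewrite ![_ * y]mulrC xyab.
Qed.

Local Notation iotaE := (iota x y).
Local Notation basisT := (basis tX1 tX2 tY1 tY2 tT).

Lemma basis_hclass n p q : basisT n p q = hcl n (iotaE p) (iotaE q).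
Proof.
have iotaT r : iota tX1 tX2 r = hcl0 (iotaE r).
  by rewrite (rmorph_iota (phi := hcl0)) // => c; apply: hcl0_alg.
rewrite /basis !iotaT -[in RHS](odd_double_half n) hclass_T.
case: (odd n) => /=.
  rewrite ![hcl0 _ * _]mulrC /tY1 /tY2 !mul_hcl0 !mul1r !mul0r.
  rewrite -[X in X * _]/(hclass _ _ _ _ + hclass _ _ _ _ : Ext K) -hclassD.
  by rewrite addr0 add0r.
rewrite (@hclass_even _ _ _ _ _ _ _ _ _ _ _ _ _ _ td 0 _ (iotaE q) 0) //.
Qed.

Hypothesis gen_iota : forall m : M, exists p, iotaE p *: m1 = m.
Hypothesis ker_iota : forall p, iotaE p *: m1 = 0 -> exists r, p = r * curve k a b.

Definition Phi : {mpoly k[5]} -> tateExt :=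
  mmap (in_alg tateExt) (gen tX1 tX2 tY1 tY2 tT).
HB.instance Definition _ := GRing.RMorphism.on Phi.

Lemma Phi_alg c : Phi c%:A = c%:A.
Proof. by rewrite /Phi -mul_mpolyC mulr1 mmapC. Qed.

Local Notation var i := ('X_(@Ordinal 5 i isT) : {mpoly k[5]}).
Local Notation basisM := (basis (var 0) (var 1) (var 2) (var 3) (var 4)).

Lemma Phi_var i : Phi 'X_i = gen tX1 tX2 tY1 tY2 tT i.
Proof. by rewrite /Phi mmapX mmap1U. Qed.

Lemma Phi_basis n p q : Phi (basisM n p q) = hcl n (iotaE p) (iotaE q).
Proof.
rewrite (rmorph_basis (phi := Phi)) ; last exact: Phi_alg.
by rewrite /= !Phi_var; exact: basis_hclass.
Qed.

(** A class depends on its coefficients only through their action on m1, so elements of E can be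
    replaced by polynomials in x and y. *)
Lemma Phi_surj z : exists f, Phi f = z.
Proof.
have [N [c [c' zE]]] := hclass_span (z : Ext K).
have lift e : exists p, iotaE p *: m1 = e *: m1 by exact: gen_iota.
pose p n := projT1 (cid (lift (c n))); pose q n := projT1 (cid (lift (c' n))).
exists (\sum_(n < N) basisM n (p n) (q n)).
rewrite rmorph_sum zE; apply: eq_bigr => n _ /=; rewrite Phi_basis.
by apply: hclass_ext; [exact: (projT2 (cid (lift (c n)))) | exact: (projT2 (cid (lift (c' n))))].
Qed.

Lemma vanishing_basis (W : comAlgType k) (X1 X2 Y1 Y2 T : W) n p q :
  pres_relations a b X1 X2 Y1 Y2 T ->
  vanishing a b x y m1 n (iotaE p) (iotaE q) -> basis X1 X2 Y1 Y2 T n p q = 0.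
Proof.
have a0 := td_a_gt0 td; have b0 := td_b_gt0 td => rel.
case: n => [|[|n]].
- move=> /ker_iota h.
  by rewrite /basis /= (iota_curve rel h) mul0r.
- case=> _ h.
  have [|r rE] := @ker_iota ('X * p + 'X%:P ^+ b.-1 * q).
    by rewrite rmorphD !rmorphM rmorphXn /= iotaX iotaY.
  exact: (basis1_eq0 a0 b0 rel rE).
rewrite /vanishing; case no : (odd n).
  case=> e [_ h]; have [s sE] := gen_iota (e *: m1).
  have [|r rE] := @ker_iota ('X * p + 'X%:P ^+ b.-1 * (q - s)).
    rewrite rmorphD !rmorphM rmorphXn /= iotaB iotaX iotaY mulrBr addrA scalerBl h.
    by rewrite -!scalerA sE subrr.
  exact: (basis_odd_eq0 a0 b0 rel no rE).
case=> e [e' h]; have [s sE] := gen_iota (e *: m1); have [s' sE'] := gen_iota (e' *: m1).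
have [|r rE] := @ker_iota (p - 'X%:P ^+ b.-1 * s - 'X ^+ a.-1 * s').
  rewrite 2!iotaB !rmorphM !rmorphXn /= iotaX iotaY.
  rewrite 2!scalerBl h scalerDl -!scalerA sE sE'.
  by rewrite addrAC addrK subrr.
by apply: (basis_even_eq0 rel q _ rE); rewrite no.
Qed.

Section Kernel.
Hypotheses (a_gt0 : (0 < a)%N) (b_gt0 : (0 < b)%N).
Local Notation I := (HH_ideal k a_gt0 b_gt0).
Local Notation Qt := (HH_presentation k a_gt0 b_gt0).
Local Notation proj := (quot_proj I).

Lemma Phi_ideal f : f \in I -> Phi f = 0.
Proof.
move=> /asboolP [c ->]; rewrite rmorph_sum big1 // => i _.
rewrite rmorphM /=; suff /allP h : all (fun f => Phi f == 0) (HH_relations k a b).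
  by rewrite (eqP (h _ (mem_nth _ (ltn_ord i)))) mulr0.
have rel := tate_relations.
rewrite /= !(rmorphM, rmorphB, rmorphXn) /= !Phi_var /gen !(tnth_nth 0) /=.
rewrite (rel_curve rel) (rel_X1T rel) (rel_X2T rel) (rel_Y2T rel) (rel_Y1Y1 rel).
by rewrite (rel_Y2Y2 rel) (rel_Y1Y2 rel) (rel_X1Y2 rel) (rel_X2Y2 rel) !subrr eqxx.
Qed.

Fact proj_additive : zmod_morphism proj.
Proof.
by move=> f g; apply/eqP; rewrite eq_sym subr_eq -quot_projD subrK.
Qed.
HB.instance Definition _ := GRing.isZmodMorphism.Build {mpoly k[5]} Qt proj proj_additive.
Fact proj_monoid : monoid_morphism proj.
Proof. by split=> [|f g]; [rewrite /quot_proj rmorph1 | apply: quot_projM]. Qed.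
HB.instance Definition _ := GRing.isMonoidMorphism.Build {mpoly k[5]} Qt proj proj_monoid.

Lemma proj_eq0 f : f \in I -> proj f = 0.
Proof. by move=> h; rewrite -(rmorph0 proj); apply/quot_proj_eq; rewrite subr0. Qed.

Lemma proj_relation (i : nat) : (i < 9)%N -> proj (HH_relations k a b)`_i = 0.
Proof.
move=> i9; apply: proj_eq0; apply/asboolP.
exists (fun j => (j == Ordinal (i9 : (i < size (HH_relations k a b))%N))%:R).
rewrite (bigD1 (Ordinal (i9 : (i < size (HH_relations k a b))%N))) //= eqxx mul1r.
by rewrite big1 ?addr0 // => j /negbTE ->; rewrite mul0r.
Qed.

Lemma proj_alg (c : k) : proj c%:A = c%:A.
Proof. by rewrite -(quot_scaleE I c 1) rmorph1. Qed.

Lemma proj_relations :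
  pres_relations a b (proj (var 0)) (proj (var 1)) (proj (var 2)) (proj (var 3)) (proj (var 4)).
Proof.
have r i i9 := @proj_relation i i9.
split.
- by apply/eqP; rewrite -subr_eq0 -!rmorphXn -rmorphB; apply/eqP/(r 0%N isT).
- by rewrite -!rmorphXn -rmorphM; apply: (r 1%N isT).
- by rewrite -!rmorphXn -rmorphM; apply: (r 2%N isT).
- by rewrite -rmorphM; apply: (r 3%N isT).
- by rewrite -rmorphM; apply: (r 4%N isT).
- by rewrite -rmorphM; apply: (r 5%N isT).
- by rewrite -rmorphM; apply: (r 6%N isT).
- by apply/eqP; rewrite -subr_eq0 -!rmorphXn -!rmorphM -rmorphB; apply/eqP/(r 7%N isT).
- by apply/eqP; rewrite -subr_eq0 -!rmorphXn -!rmorphM -rmorphB; apply/eqP/(r 8%N isT).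
Qed.

(** Presents the projection as an evaluation, the form to which [normal_form_mmap] applies. *)
Lemma proj_mmap f : proj f =
  mmap (in_alg Qt) (gen (proj (var 0)) (proj (var 1)) (proj (var 2)) (proj (var 3)) (proj (var 4))) f.
Proof.
rewrite {1}[f]mpolyE rmorph_sum; apply: eq_bigr => m _.
rewrite -mul_mpolyC rmorphM /= -[(f@_m)%:MP]mulr1 mul_mpolyC proj_alg; congr (_ * _).
rewrite mpolyXE_id rmorph_prod; apply: eq_bigr => i _; rewrite rmorphXn /=.
congr (_ ^+ _); rewrite /gen (tnth_nth 0).
have h j (hj : (j < 5)%N) : i = j :> nat -> 'X_i = 'X_(Ordinal hj) :> {mpoly k[5]}.
  by move=> e; congr ('X_(_)); apply: val_inj.
case: i h => [[|[|[|[|[|i]]]]] hi] h //=; congr (proj _); exact: h.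
Qed.

(** Modulo I, f is a sum g of normal-form terms, and [Phi g] is the sum of the corresponding
    classes. These lie in different degrees, so each of them vanishes, and the relations kill the
    terms of g one by one in the quotient. *)
Lemma Phi_ker f : Phi f = 0 -> f \in I.
Proof.
move=> f0; have a0 := td_a_gt0 td; have b0 := td_b_gt0 td.
have [N [p [q [_ fE]]]] := normal_form_mmap proj_relations f.
rewrite -proj_mmap in fE.
pose g : {mpoly k[5]} := \sum_(n < N) basisM n (p n) (q n).
have gE : proj g = proj f.
  rewrite fE rmorph_sum; apply: eq_bigr => n _ /=.
  by rewrite (rmorph_basis (phi := proj)) //; apply: proj_alg.
have : Phi g = 0.
  have /quot_proj_eq /Phi_ideal := gE.
  by rewrite rmorphB /= f0 subr0.
rewrite /g rmorph_sum /=; under eq_bigr do rewrite Phi_basis.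
move=> /(hclass_vanishing (c := fun n => iotaE (p n)) (c' := fun n => iotaE (q n))) h.
suff : proj f = 0 by rewrite -(rmorph0 proj) => /quot_proj_eq; rewrite subr0.
rewrite fE big1 // => n _; apply: vanishing_basis; first exact: proj_relations.
exact: h.
Qed.
End Kernel.
End TateExt.

(** * The diagonal bimodule of a plane curve provides Tate data *)

Section CurveTate.
Variables (k : fieldType) (A : comAlgType k) (a b : nat) (x y : A).
Variable co : nat -> nat -> A -> k.
Hypothesis cA : curve_algebra a b x y co.
Hypothesis x_reg : forall c, x * c = 0 -> c = 0.
Hypotheses (a_unit : a%:R != 0 :> k) (b_unit : b%:R != 0 :> k).

Lemma x_reg_exp n c : x ^+ n * c = 0 -> c = 0.
Proof.
elim: n => [|n IH]; first by rewrite mul1r.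
by rewrite exprS -mulrA => /x_reg/IH.
Qed.

(** Multiplying by x y and cancelling x^b = y^a gives y m = x m'. For polynomial lifts, y p - x p' =
    q F, that is y (p - q y^(a-1)) = x (p' - q x^(b-1)). As x and y are coprime, p - q y^(a-1) = x d
    and p' - q x^(b-1) = y d, so c comes from d and c' from q. *)
Lemma derivation_generators (m m' : A) : x ^+ b.-1 * m = y ^+ a.-1 * m' ->
  exists c c', m = x * c + y ^+ a.-1 * c' /\ m' = y * c + x ^+ b.-1 * c'.
Proof.
have a0 := curve_a_gt0 cA; have b0 := curve_b_gt0 cA; have xy := curve_rel cA.
move=> h; have {}h : y * m - x * m' = 0.
  apply: (@x_reg_exp b).
  apply: (@etrans _ _ (x ^+ b * (y * m) - x ^+ b * (x * m'))); first by ring.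
  rewrite {2}xy -{1}(prednK b0) -(prednK a0) !exprS.
  apply: (@etrans _ _ (x * y * (x ^+ b.-1 * m) - x * y * (y ^+ a.-1 * m'))); first by ring.
  by rewrite h subrr.
have [p pE] := curve_gen cA m; have [p' p'E] := curve_gen cA m'.
have FE : curve k a b = 'X * 'X ^+ a.-1 - 'X%:P * 'X%:P ^+ b.-1 :> {poly {poly k}}.
  by rewrite /curve -!exprS !prednK // polyC_exp.
have [|q qE] := @curve_ker _ _ _ _ _ _ _ cA ('X * p - 'X%:P * p').
  rewrite -[LHS]/(iota x y _) iotaB !rmorphM /= iotaX iotaY.
  by rewrite -[iota x y p]pE -[iota x y p']p'E h.
have h1 : 'X * (p - q * 'X ^+ a.-1) = 'X%:P * (p' - q * 'X%:P ^+ b.-1).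
  apply/eqP; rewrite -subr_eq0; apply/eqP.
  apply: (@etrans _ _ (('X * p - 'X%:P * p') - q * ('X * 'X ^+ a.-1 - 'X%:P * 'X%:P ^+ b.-1))).
    by ring.
  by rewrite -FE qE subrr.
have [|d dE] := @horner0_mulY _ (p' - q * 'X%:P ^+ b.-1).
  have := congr1 (horner^~ 0) h1; rewrite /= hornerM hornerX mul0r hornerM hornerC => /esym/eqP.
  by rewrite mulf_eq0 (negbTE (monic_neq0 (monicX _))) => /eqP.
have {}h1 : p - q * 'X ^+ a.-1 = 'X%:P * d.
  by apply: (mulfI (monic_neq0 (monicX _))); rewrite h1 dE mulrCA.
exists (iota x y d), (iota x y q).
have -> : m = iota x y p by [].
have -> : m' = iota x y p' by [].
have -> : p = 'X%:P * d + 'X ^+ a.-1 * q by rewrite -h1 mulrC subrK.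
have -> : p' = 'X * d + 'X%:P ^+ b.-1 * q by rewrite -dE mulrC subrK.
by rewrite !rmorphD !rmorphM !rmorphXn /= iotaX iotaY.
Qed.

Lemma unit_alg n : n%:R != 0 :> k -> exists c : env A, c *+ n = 1.
Proof.
move=> nu; exists (n%:R^-1)%:A.
by rewrite scalerMnl -mulr_natr mulVf // scale1r.
Qed.

Lemma act_eq (e e' : env A) : mu e = mu e' ->
  forall m : diagonal_bimodule A, e *: m = e' *: m.
Proof. by move=> ee' m; have := act_mu e m; rewrite ee' -act_mu. Qed.

Lemma curve_tate_data : @tate_data k (env A) (diagonal_bimodule A) a b
  (xl x) (yl y) (uu x) (vv y) (PP b x) (QQ a y)
  (- divdiff2 b (envr x) (xl x)) (divdiff2 a (envr y) (yl y)) (1 : A).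
Proof.
have mux : mu (xl x) = x by apply: mu_envl.
have muy : mu (yl y) = y by apply: mu_envl.
split.
- exact: curve_a_gt0 cA.
- exact: curve_b_gt0 cA.
- exact: unit_alg.
- exact: unit_alg.
- by rewrite /xl /yl -!rmorphXn (curve_rel cA).
- exact: (uPvQ cA).
- by rewrite /PP divdiff2E opprD mulrN.
- by rewrite /QQ divdiff2E.
- move=> m; rewrite (@act_eq _ 0) ?scale0r //.
  by rewrite /uu rmorphB /= mu_envr mux subrr rmorph0.
- move=> m; rewrite (@act_eq _ 0) ?scale0r //.
  by rewrite /vv rmorphB /= mu_envr muy subrr rmorph0.
(* The constant is - binom(b, 2): on A, P' acts as half the second derivative of - x^b. *)
- exists (- (\sum_(i < b) (b.-1 - i))%:R) => m; apply: act_eq.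
  rewrite !rmorphM !rmorphN /= rmorph_divdiff2 /= rmorph_nat rmorphXn /= mu_envr mux.
  by rewrite mulrN divdiff2_diag mulrN mulr_natr.
- exists (\sum_(i < a) (a.-1 - i))%:R => m; apply: act_eq.
  rewrite !rmorphM /= rmorph_divdiff2 /= rmorph_nat rmorphXn /= mu_envr muy.
  by rewrite divdiff2_diag mulr_natr.
- exact: oner_neq0.
- by move=> m; exists (envl (m : A)); apply: mu_envl.
- by move=> e /(exact_aug cA).
- exact: (exact_odd cA).
- exact: (exact_even cA).
- move=> m h; apply: (@x_reg_exp b.-1); rewrite -[RHS]h.
  by rewrite (act_mu (xl x ^+ b.-1) m) rmorphXn /= mux.
- move=> m m' h.
  have [|c [c' [mE m'E]]] := @derivation_generators m m'.
    have := h; rewrite -[LHS]/(_ *: m : A) -[RHS]/(_ *: m' : A) => {}h.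
    move: h; rewrite (act_mu (xl x ^+ b.-1) m) (act_mu (yl y ^+ a.-1) m').
    by rewrite !rmorphXn /= mux muy.
  exists (envl c), (envl c'); split.
    rewrite {1}mE -[RHS]/(mu _) rmorphD !rmorphM !rmorphXn /= mux muy !mu_envl.
    by [].
  rewrite {1}m'E -[RHS]/(mu _) rmorphD !rmorphM !rmorphXn /= mux muy !mu_envl.
  by [].
Qed.

Lemma mu_alg (c : k) : mu (c%:A : env A) = c%:A.
Proof.
have -> : c%:A = envl (c%:A : A) :> env A; last exact: mu_envl.
by rewrite /envl (bilinZl _ _ _ (bilin_pure A)).
Qed.

Lemma mu_iota p : mu (iota (xl x) (yl y) p) = iota x y p.
Proof. by rewrite (rmorph_iota (phi := @mu _ A)) /xl /yl /= ?mu_envl //; apply: mu_alg. Qed.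

Lemma curve_gen_iota (m : diagonal_bimodule A) :
  exists p, iota (xl x) (yl y) p *: (1 : diagonal_bimodule A) = m.
Proof.
have [p pE] := curve_gen cA (m : A); exists p.
exact: (etrans (mu_iota p) (esym pE)).
Qed.

Lemma curve_ker_iota p : iota (xl x) (yl y) p *: (1 : diagonal_bimodule A) = 0 ->
  exists r, p = r * curve k a b.
Proof.
move=> h; apply: (curve_ker cA); exact: (etrans (esym (mu_iota p)) h).
Qed.
End CurveTate.

(** * Weights *)

Lemma sum_extend0 (I : eqType) (Z : zmodType) (F : I -> Z) (s t : seq I) :
  uniq s -> uniq t -> {subset s <= t} ->
  \sum_(w <- s) F w = \sum_(w <- t) (if w \in s then F w else 0).
Proof.
move=> us ut st; rewrite -big_mkcond -big_filter; apply: perm_big.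
apply: uniq_perm => //; first exact: filter_uniq.
by move=> w; rewrite mem_filter andb_idr //; apply: st.
Qed.

Section Gradings.
Variables (V : zmodType) (g : int -> V -> Prop).
Hypothesis gr : is_grading g.

Lemma gradingN w p : g w p -> g w (- p).
Proof. by move=> h; rewrite -sub0r; apply: (gradingB gr) h; apply: (grading0 gr). Qed.

Lemma grading_ind (pr : V -> Prop) : pr 0 -> (forall p q, pr p -> pr q -> pr (p + q)) ->
  (forall w p, g w p -> pr p) -> forall p, pr p.
Proof.
move=> p0 pD ph p; have [s [c [_ cg ->]]] := grading_span gr p.
by elim: s => [|w s IH]; rewrite ?big_nil ?big_cons //; apply: pD IH; apply: ph.
Qed.

Variables (U : zmodType) (h : int -> V -> U).
Hypothesis hD : forall w, {morph h w : p q / p + q}.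

Let h0 w : h w 0 = 0.
Proof. by apply: (addrI (h w 0)); rewrite -hD !addr0. Qed.
Let hB w p q : h w (p - q) = h w p - h w q.
Proof. by apply/eqP; rewrite eq_sym subr_eq -hD subrK. Qed.

Let decomposition_unique (s s' : seq int) (c c' : int -> V) :
  uniq s -> uniq s' -> (forall w, g w (c w)) -> (forall w, g w (c' w)) ->
  \sum_(w <- s) c w = \sum_(w <- s') c' w ->
  \sum_(w <- s) h w (c w) = \sum_(w <- s') h w (c' w).
Proof.
move=> us us' cg cg' e; pose t := undup (s ++ s').
have ut : uniq t by apply: undup_uniq.
have st : {subset s <= t} by move=> w ws; rewrite mem_undup mem_cat ws.
have st' : {subset s' <= t} by move=> w ws; rewrite mem_undup mem_cat ws orbT.
pose d w := (if w \in s then c w else 0) - (if w \in s' then c' w else 0).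
have d0 w : w \in t -> d w = 0.
  apply: (grading_free gr ut) => [v|]; last first.
    by rewrite sumrB -!sum_extend0 // e subrr.
  by rewrite /d; apply: (gradingB gr); case: ifP => _ //; apply: (grading0 gr).
rewrite (sum_extend0 _ us ut st) (sum_extend0 _ us' ut st').
apply/eqP; rewrite -subr_eq0 -sumrB big_seq big1 // => w /d0.
move=> /(congr1 (h w)); rewrite /d hB h0 => e'; rewrite -[RHS]e'.
by congr (_ - _); case: ifP.
Qed.

(** Prescribes an additive map on homogeneous elements. Each [h w] is given on all of V, to avoid
    partial maps, but only its values in weight w enter. *)
Lemma graded_extension : exists f : V -> U,
  {morph f : p q / p + q} /\ forall w p, g w p -> f p = h w p.
Proof.
have sp p : exists sc : seq int * (int -> V),
    [/\ uniq sc.1, forall w, g w (sc.2 w) & p = \sum_(w <- sc.1) sc.2 w].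
  by have [s [c H]] := grading_span gr p; exists (s, c).
pose s p := (projT1 (cid (sp p))).1; pose c p := (projT1 (cid (sp p))).2.
have scP p : [/\ uniq (s p), forall w, g w (c p w) & p = \sum_(w <- s p) c p w].
  exact: (projT2 (cid (sp p))).
exists (fun p => \sum_(w <- s p) h w (c p w)); split=> [p q|w p wp].
  have [up pg pE] := scP p; have [uq qg qE] := scP q; have [ur rg rE] := scP (p + q).
  pose t := undup (s p ++ s q).
  have ut : uniq t by apply: undup_uniq.
  have pt : {subset s p <= t} by move=> w ws; rewrite mem_undup mem_cat ws.
  have qt : {subset s q <= t} by move=> w ws; rewrite mem_undup mem_cat ws orbT.
  pose d w := (if w \in s p then c p w else 0) + (if w \in s q then c q w else 0).
  rewrite (@decomposition_unique _ t _ d ur ut rg); first last.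
  - by rewrite -rE {1}pE {1}qE (sum_extend0 _ up ut pt) (sum_extend0 _ uq ut qt) -big_split.
  - move=> w; rewrite /d -[X in _ + X]opprK; apply: (gradingB gr).
      by case: ifP => _ //; apply: (grading0 gr).
    by apply: gradingN; case: ifP => _ //; apply: (grading0 gr).
  rewrite (sum_extend0 _ up ut pt) (sum_extend0 _ uq ut qt) -big_split.
  by apply: eq_bigr => w _; rewrite /d hD /=; congr (_ + _); case: ifP.
have [up pg pE] := scP p.
rewrite (@decomposition_unique _ [:: w] _ (fun v => if v == w then p else 0) up) ?big_seq1 ?eqxx //.
by move=> v; case: eqP => [->|_] //; apply: (grading0 gr).
Qed.
End Gradings.

(** * Weights on Tate's resolution *)

Section GradedTate.
Variables (k : fieldType) (E : comAlgType k) (M : lmodType E) (a b : nat).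
Variables (x y u v P Q P' Q' : E) (m1 : M).
Hypothesis td : tate_data a b x y u v P Q P' Q' m1.
Local Notation K := (tate td).
Local Notation E1 := (E^o : lmodType E).
Local Notation E2 := ((E^o * E^o)%type : lmodType E).

Variables (comp : int -> E -> E) (hE : int -> E -> Prop).
Variables (gM : int -> M -> Prop) (prM : int -> M -> M).

Local Notation za := (a%:Z).
Local Notation zb := (b%:Z).

(** [comp w] and [prM w] play the role of the projections of E and M to weight w. That u, v, P, Q
    have weights a, b, a b - a, a b - b is expressed by how multiplication by them shifts
    components. *)
Record tate_grading : Prop := {
  tg_compD : forall w, {morph comp w : e e' / e + e'};
  tg_comp : forall i h w e, hE i h -> comp (i + w) (h * e) = h * comp w e;
  tg_ind : forall p : E -> Prop, p 0 -> (forall e e', p e -> p e' -> p (e + e')) ->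
    (forall i h, hE i h -> p h) -> forall e, p e;
  tg_M0 : forall w, gM w 0;
  tg_MD : forall w m m', gM w m -> gM w m' -> gM w (m + m');
  tg_MZ : forall w (c : k) m, gM w m -> gM w (c%:A *: m);
  tg_M : forall w i e m, gM i m -> gM (w + i) (comp w e *: m);
  tg_aug : forall w e, comp w e *: m1 = prM w (e *: m1);
  tg_prM : forall w m, gM w m -> prM w m = m;
  tg_u : forall w e, comp w (e * u) = comp (w - za) e * u;
  tg_v : forall w e, comp w (e * v) = comp (w - zb) e * v;
  tg_P : forall w e, comp w (e * P) = comp (w + za - za * zb) e * P;
  tg_Q : forall w e, comp w (e * Q) = comp (w + zb - za * zb) e * Q;
  tg_xy : forall i j, gM (i%:Z * za + j%:Z * zb) ((x ^+ i * y ^+ j) *: m1)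
}.
Hypothesis tg : tate_grading.

Let compB w e e' : comp w (e - e') = comp w e - comp w e'.
Proof. by apply/eqP; rewrite eq_sym subr_eq -(tg_compD tg) subrK. Qed.

(* The generators of K_n sit in weights (n/2) a b + a and (n/2) a b + b for odd n,
   and (n/2) a b and (n/2 - 1) a b + a + b for even n. *)
Definition tate_wt (n : nat) : int * int :=
  if odd n then ((n./2)%:Z * (za * zb) + za, (n./2)%:Z * (za * zb) + zb)
  else ((n./2)%:Z * (za * zb), (n./2)%:Z * (za * zb) - za * zb + za + zb).

Definition tate_pr (n : nat) (w : int) : K n -> K n :=
  match n return K n -> K n with
  | 0%N => fun e : E1 => comp w e : E1
  | n'.+1 => fun p : E2 =>
      (comp (w - (tate_wt n'.+1).1) p.1, comp (w - (tate_wt n'.+1).2) p.2) : E2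
  end.

Lemma tate_prD n w : {morph @tate_pr n w : p q / p + q}.
Proof.
case: n => [|n] p q; first exact: (tg_compD tg).
by congr (_, _); apply: (tg_compD tg).
Qed.

Lemma tate_pr_act n i h w p : hE i h -> tate_pr (i + w) (h *: p : K n) = h *: tate_pr w p.
Proof.
move=> hi; case: n p => [|n] p; first exact: (tg_comp tg).
by congr (_, _); rewrite -addrA; apply: (tg_comp tg).
Qed.

Lemma tate_pr_d n w p : res_d K n (tate_pr w p) = tate_pr w (res_d K n p).
Proof.
case: n p => [|n] p.
  apply/esym; rewrite /= /diff0 (tg_compD tg) (tg_u tg) (tg_v tg) /tate_wt /=.
  by rewrite !mul0r !add0r.
rewrite /= /tate_d /tate_wt /=; case no : (odd n) => /=; congr (_, _).
- rewrite (tg_compD tg) (tg_u tg) (tg_v tg); congr (comp _ _ * _ + comp _ _ * _);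
  by rewrite uphalf_half no ?add1n ?add0n ?intS; ring.
- rewrite compB (tg_P tg) (tg_Q tg); congr (comp _ _ * _ - comp _ _ * _);
  by rewrite uphalf_half no ?add1n ?add0n ?intS; ring.
- rewrite compB (tg_P tg) (tg_v tg); congr (comp _ _ * _ - comp _ _ * _);
  by rewrite uphalf_half no ?add1n ?add0n ?intS; ring.
- rewrite (tg_compD tg) (tg_Q tg) (tg_u tg); congr (comp _ _ * _ + comp _ _ * _);
  by rewrite uphalf_half no ?add1n ?add0n ?intS; ring.
Qed.

Lemma tate_pr_aug w p : res_aug K (tate_pr w p) = prM w (res_aug K p).
Proof. exact: (tg_aug tg). Qed.

Variables (R : projective_resolution M) (g : forall n, int -> R n -> Prop).
Hypotheses (gR : forall n, is_grading (@g n))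
  (gR_act : forall n i h w p, hE i h -> g w p -> @g n (i + w) (h *: p))
  (gR_d : forall n w p, g w p -> @g n w (res_d R n p))
  (gR_aug : forall w p, @g 0%N w p -> gM w (res_aug R p)).

(** On elements of weight w the new map is the weight w component of an arbitrary comparison map.
    Weight w in K means being in the image of [tate_pr w]. *)
Lemma graded_chain_map : exists f : forall n, {linear R n -> K n},
  chain_map f /\ forall n w p, @g n w p -> exists q, f n p = tate_pr w q.
Proof.
have [c [c0 cd]] := chain_map_exists R K.
have ext n : exists f : {linear R n -> K n}, forall w p, @g n w p -> f p = tate_pr w (c n p).
  have hD w : {morph (fun p => tate_pr w (c n p)) : p q / p + q}.
    by move=> p q; rewrite linearD tate_prD.
  have [f [fD fE]] := graded_extension (gR n) hD.
  have f0 : f 0 = 0 by apply: (addrI (f 0)); rewrite -fD !addr0.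
  (* Linearity over E reduces to homogeneous elements and homogeneous scalars, which span. *)
  have fZ e p : f (e *: p) = e *: f p.
    elim/(grading_ind (gR n)): p => [|p q hp hq|w p wp].
    - by rewrite scaler0 f0 scaler0.
    - by rewrite scalerDr !fD hp hq scalerDr.
    elim/(tg_ind tg): e => [|e e' he he'|i h hi].
    - by rewrite !scale0r.
    - by rewrite !scalerDl fD he he'.
    by rewrite (fE _ _ (gR_act hi wp)) (fE _ _ wp) linearZ /= tate_pr_act.
  have fl : linear f by move=> e p q; rewrite fD fZ.
  exists (projT1 (lin_pack fl)) => w p wp.
  by rewrite (projT2 (lin_pack fl)) (fE _ _ wp).
pose f n := projT1 (cid (ext n)).
have fE n w p : @g n w p -> f n p = tate_pr w (c n p).
  exact: (projT2 (cid (ext n))).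
exists f; split; last by move=> n w p wp; exists (c n p); apply: fE.
split=> [p|n p].
  elim/(grading_ind (gR 0)): p => [|p q hp hq|w p wp]; first by rewrite !linear0.
    by rewrite !linearD hp hq.
  by rewrite (fE _ _ _ wp) tate_pr_aug c0 (tg_prM tg) //; apply: gR_aug.
elim/(grading_ind (gR n.+1)): p => [|p q hp hq|w p wp]; first by rewrite !linear0.
  by rewrite !linearD hp hq.
by rewrite (fE _ _ _ wp) tate_pr_d cd (fE _ _ _ (gR_d wp)).
Qed.
End GradedTate.

(** * Classes with a representative of a given kind *)

Section Representatives.
Variables (k : comNzRingType) (R : algType k) (M : lmodType R).
Variables (P : projective_resolution M) (n : nat) (good : (P n -> M) -> Prop).
Hypotheses (good0 : good (fun=> 0))
  (good_lin : forall (c : k) f f', good f -> good f' -> good (fun p => c%:A *: f p + f' p)).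

(** Covers [HH_deg], with a trivial [good], and [HH_bideg], where [good] says that weights are
    shifted by w. *)
Definition has_rep (X : Ext P) : Prop := exists2 z : cocycle P, X = Ext_class z &
  (forall m, m != n -> forall p, cocycle_val z m p = 0) /\ good (cocycle_val z n).

Lemma has_rep0 : has_rep 0.
Proof.
exists 0; first by rewrite /Ext_class piE.
by split.
Qed.

Lemma has_rep_lin c X Z : has_rep X -> has_rep Z -> has_rep (c *: X + Z).
Proof.
case=> z -> [z0 zg] [z' -> [z0' zg']]; exists (c *: z + z').
  by rewrite Ext_classD -Ext_scaleE.
split; last exact: (good_lin c zg zg').
move=> m mn p; rewrite -[LHS]/(c%:A *: cocycle_val z m p + cocycle_val z' m p).
by rewrite z0 // z0' // scaler0 addr0.
Qed.

Lemma has_rep_sum (I : eqType) (s : seq I) (c : I -> k) (X : I -> Ext P) :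
  (forall i, i \in s -> has_rep (X i)) -> has_rep (\sum_(i <- s) c i *: X i).
Proof.
elim: s => [|i s IH] h; first by rewrite big_nil; apply: has_rep0.
rewrite big_cons; apply: has_rep_lin; first by apply: h; rewrite mem_head.
by apply: IH => j js; apply: h; rewrite in_cons js orbT.
Qed.
End Representatives.

(** * Degree and weight of the image of a monomial *)

Section Monomials.
Variables (k : fieldType) (E : comAlgType k) (M : lmodType E) (a b : nat).
Variables (x y u v P Q P' Q' : E) (m1 : M).
Hypothesis td : tate_data a b x y u v P Q P' Q' m1.
Local Notation K := (tate td).
Local Notation hcl := (hclass td).
Local Notation ex i := (@Ordinal 5 i isT).

Definition mono_coef (m : 'X_{1..5}) : E := x ^+ m (ex 0) * y ^+ m (ex 1).
Definition mono_deg (m : 'X_{1..5}) : nat := (m (ex 2) + m (ex 3) + (m (ex 4)).*2)%N.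

(** A monomial with two or more factors Y vanishes. Otherwise its coefficient sits in the second
    slot if Y_2 occurs, and in the first slot if Y_1 or neither occurs. *)
Lemma Phi_monomial m : Phi td 'X_[m] = 0 \/
  ((m (ex 2) + m (ex 3) <= 1)%N /\
   Phi td 'X_[m] = hcl (mono_deg m) (if m (ex 3) == 0%N then mono_coef m else 0)
                       (if m (ex 3) == 0%N then 0 else mono_coef m)).
Proof.
have rel := tate_relations td.
rewrite /Phi mmapX mmap1_gen /mono_deg /mono_coef.
rewrite /tX1 /tX2 -!rmorphXn -rmorphM /=.
move: (x ^+ _ * y ^+ _) (m (ex 2)) (m (ex 3)) (m (ex 4)) => c p q r.
have T0 (n : nat) d d' : (hcl n d d' : tateExt td) * tT td ^+ r = hcl (n + r.*2) d d'.
  by rewrite hclass_T.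
case: p => [|[|p]]; last first.
- left; rewrite !exprS; apply: (@etrans _ _ (hcl0 td c * (tY1 td * tY1 td) * tY1 td ^+ p *
    tY2 td ^+ q * tT td ^+ r)); first by ring.
  by rewrite (rel_Y1Y1 rel) !(mulr0, mul0r).
- case: q => [|q]; last first.
    left; rewrite expr1 exprS; apply: (@etrans _ _ (hcl0 td c * (tY1 td * tY2 td) *
      tY2 td ^+ q * tT td ^+ r)); first by ring.
    by rewrite (rel_Y1Y2 rel) !(mulr0, mul0r).
  right; split=> //; rewrite expr1 expr0 mulr1 [hcl0 td c * _]mulrC /tY1 mul_hcl0.
  by rewrite T0 mul1r mul0r /= addn0.
case: q => [|[|q]].
- by right; split=> //; rewrite !expr0 !mulr1 T0.
- right; split=> //; rewrite expr1 expr0 mulr1 [hcl0 td c * _]mulrC /tY2 mul_hcl0.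
  by rewrite T0 mul1r mul0r.
- left; rewrite !exprS; apply: (@etrans _ _ (hcl0 td c * (tY2 td * tY2 td) *
    tY2 td ^+ q * tT td ^+ r)); first by ring.
  by rewrite (rel_Y2Y2 rel) !(mulr0, mul0r).
Qed.

Variables (R : projective_resolution M) (f0 : forall n, {linear R n -> K n}).
Hypothesis f0c : chain_map f0.

(** The isomorphism is built from an arbitrary comparison map; this lets its values be represented
    through one that preserves weights. *)
Lemma pullback_indep (f : forall n, {linear R n -> K n}) (fc : chain_map f) X :
  Ext_pullback f0c X = Ext_pullback fc X.
Proof.
have [z ->] := Ext_classP X.
have [z1 z1E] := pullback_cocycle z f0c; have [z2 z2E] := pullback_cocycle z fc.
rewrite (Ext_pullbackE _ z1E) (Ext_pullbackE _ z2E); apply/Ext_class_eq => n.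
apply: cbd_ext (pullback_unique f0c fc (cocycleP z).1 n) => p.
by rewrite -[RHS]/(_ - _) z1E z2E.
Qed.

Lemma mono_rep (good : forall n, (R n -> M) -> Prop) m :
  good (mono_deg m) (fun=> 0) ->
  ((m (ex 2) + m (ex 3) <= 1)%N -> exists2 f, @chain_map _ _ _ R K f &
     forall z : cocycle R, (forall p, cocycle_val z (mono_deg m) p =
       @pair_cochain _ _ _ _ _ _ _ _ _ _ _ _ _ _ td (mono_deg m)
       (class_values a b x y m1 (mono_deg m) (if m (ex 3) == 0%N then mono_coef m else 0)
                       (if m (ex 3) == 0%N then 0 else mono_coef m)) (f (mono_deg m) p)) ->
     good (mono_deg m) (cocycle_val z (mono_deg m))) ->
  has_rep (@good (mono_deg m)) (Ext_pullback f0c (Phi td 'X_[m])).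
Proof.
move=> good0 hgood; case: (Phi_monomial m) => [->|[h ->]].
  have -> : Ext_pullback f0c 0 = 0.
    by have := Ext_pullback_linear f0c (-1) 0 0; rewrite scaler0 addr0 scaleN1r addNr.
  exact: has_rep0.
have [f fc hz] := hgood h; rewrite (pullback_indep fc).
have [z zE] := pullback_cocycle (class_cocycle td (mono_deg m)
  (if m (ex 3) == 0%N then mono_coef m else 0) (if m (ex 3) == 0%N then 0 else mono_coef m)) fc.
exists z; first exact: Ext_pullbackE zE.
split; last by apply: hz => p; rewrite zE class_cocycleE concentratedE.
move=> j jn p; rewrite zE class_cocycleE.
by rewrite (concentrated_ne _ (@pair_cochain_linear _ _ _ _ _ _ _ _ _ _ _ _ _ _ td _ _)).
Qed.

Variables (comp : int -> E -> E) (hE : int -> E -> Prop).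
Variables (gM : int -> M -> Prop) (prM : int -> M -> M).
Hypothesis tg : tate_grading a b x y u v P Q m1 comp hE gM prM.

Definition mono_wt (m : 'X_{1..5}) : int :=
  (m (ex 0))%:Z * a%:Z + (m (ex 1))%:Z * b%:Z +
  (m (ex 3))%:Z * (a%:Z * b%:Z - a%:Z - b%:Z) - (m (ex 4))%:Z * (a%:Z * b%:Z).

Let gM_eq w w' m : w = w' -> gM w m -> gM w' m.
Proof. by move=> ->. Qed.

Let gMn w n m : gM w m -> gM w (m *+ n).
Proof.
move=> h; elim: n => [|n IH]; first by rewrite mulr0n; apply: (tg_M0 tg).
by rewrite mulrS; apply: (tg_MD tg).
Qed.

(** The weight of a class is that of its value minus that of the generator it is evaluated on. For
    Y_2 T^r, the value on t^r e_1 is a multiple of y^(a-1), so the weight is (a b - b) - (r a b +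
    a). *)
Lemma mono_weight (m : 'X_{1..5}) (w : int) (q : K (mono_deg m)) : (m (ex 2) + m (ex 3) <= 1)%N ->
  gM (w + mono_wt m)
    (@pair_cochain _ _ _ _ _ _ _ _ _ _ _ _ _ _ td (mono_deg m)
       (class_values a b x y m1 (mono_deg m) (if m (ex 3) == 0%N then mono_coef m else 0)
                       (if m (ex 3) == 0%N then 0 else mono_coef m)) (tate_pr comp w q)).
Proof.
have a0 := td_a_gt0 td; have b0 := td_b_gt0 td.
rewrite /mono_wt /mono_coef; move: q; rewrite /mono_deg.
move: (m (ex 0)) (m (ex 1)) (m (ex 2)) (m (ex 3)) (m (ex 4)) => i j p q r.
case: p q => [|[|p]] [|[|q]] //= e _.
- rewrite !add0n in e *.
  case: r e => [|r] e.
    rewrite /class_values /=; apply: gM_eq (tg_M tg _ _ (tg_xy tg i j)); ring.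
  rewrite /class_values /= odd_double /=; apply: (tg_MD tg); last first.
    by rewrite scaler0; apply: (tg_M0 tg).
  apply: gM_eq (tg_M tg _ _ (tg_xy tg i j)).
  by rewrite /tate_wt /= odd_double /= doubleK; ring.
- rewrite /class_values /= odd_double /=.
  have tw : tate_wt a b (0 + 1 + r.*2) =
      (r%:Z * (a%:Z * b%:Z) + a%:Z, r%:Z * (a%:Z * b%:Z) + b%:Z).
    by rewrite /tate_wt /= odd_double /= uphalf_double.
  apply: (tg_MD tg).
    rewrite /derivx mulr0 add0r -scalerMnl.
    rewrite -scalerMnr; apply: gMn.
    have -> : y ^+ a.-1 * (x ^+ i * y ^+ j) = x ^+ i * y ^+ (a.-1 + j).
      by rewrite exprD; ring.
    apply: gM_eq (tg_M tg _ _ (tg_xy tg i (a.-1 + j))).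
    rewrite tw PoszD -subn1 -subzn //=; ring.
  rewrite /derivy mulr0 add0r -scalerMnl -scalerMnr; apply: gMn.
  have -> : x ^+ b.-1 * (x ^+ i * y ^+ j) = x ^+ (b.-1 + i) * y ^+ j.
    by rewrite exprD; ring.
  apply: gM_eq (tg_M tg _ _ (tg_xy tg (b.-1 + i) j)).
  rewrite tw PoszD -subn1 -subzn //=; ring.
have tw : tate_wt a b (1 + 0 + r.*2) =
    (r%:Z * (a%:Z * b%:Z) + a%:Z, r%:Z * (a%:Z * b%:Z) + b%:Z).
  by rewrite /tate_wt /= odd_double /= uphalf_double.
rewrite /class_values /= odd_double /=; apply: (tg_MD tg).
  rewrite /derivx mulr0 addr0 -scalerMnl -scalerMnr; apply: gMn.
  have -> : x * (x ^+ i * y ^+ j) = x ^+ i.+1 * y ^+ j by rewrite exprS mulrA.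
  apply: gM_eq (tg_M tg _ _ (tg_xy tg i.+1 j)).
  rewrite tw intS /=; ring.
rewrite /derivy mulr0 addr0 -scalerMnl -scalerMnr; apply: gMn.
have -> : y * (x ^+ i * y ^+ j) = x ^+ i * y ^+ j.+1 by rewrite exprS mulrCA.
apply: gM_eq (tg_M tg _ _ (tg_xy tg i j.+1)).
rewrite tw intS /=; ring.
Qed.
End Monomials.

(** * The weight grading of the enveloping algebra *)

Section EnvGrading.
Variables (k : fieldType) (A : comAlgType k) (gA : int -> A -> Prop).
Hypotheses (gr : is_grading gA)
  (gAZ : forall w (r : k) c, gA w c -> gA w (r *: c))
  (gAM : forall i j c d, gA i c -> gA j d -> gA (i + j) (c * d))
  (gA1 : gA 0 1).

Lemma gradingD w c d : gA w c -> gA w d -> gA w (c + d).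
Proof.
by move=> hc hd; rewrite -[d]opprK; apply: (gradingB gr) hc _; apply: gradingN.
Qed.

Lemma part_exists w : exists f : A -> A, {morph f : c d / c + d} /\
  forall i c, gA i c -> f c = if i == w then c else 0.
Proof.
apply: (graded_extension gr (h := fun i c => if i == w then c else 0)).
by move=> i c d; case: eqP => // _; rewrite addr0.
Qed.

Definition part w : A -> A := projT1 (cid (part_exists w)).

Lemma partD w : {morph part w : c d / c + d}.
Proof. by case: (projT2 (cid (part_exists w))). Qed.
Lemma part_hom w i c : gA i c -> part w c = if i == w then c else 0.
Proof. by case: (projT2 (cid (part_exists w))) => _; apply. Qed.
Lemma part0 w : part w 0 = 0.
Proof. by rewrite (part_hom _ (grading0 gr w)) if_same. Qed.
Lemma partZ w (r : k) c : part w (r *: c) = r *: part w c.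
Proof.
elim/(grading_ind gr): c => [|c d hc hd|i c ic].
- by rewrite scaler0 part0 scaler0.
- by rewrite scalerDr !partD hc hd scalerDr.
by rewrite (part_hom _ ic) (part_hom _ (gAZ r ic)); case: eqP => // _; rewrite scaler0.
Qed.

Lemma pureDl (c c' d : A) : pure (c + c') d = pure c d + pure c' d.
Proof. by have := (bilin_pure A).2 d 1 c c'; rewrite !scale1r. Qed.
Lemma pureDr (c d d' : A) : pure c (d + d') = pure c d + pure c d'.
Proof. by have := (bilin_pure A).1 c 1 d d'; rewrite !scale1r. Qed.
Lemma pureZl r (c d : A) : pure (r *: c) d = r *: pure c d.
Proof. exact: (bilinZl _ _ _ (bilin_pure A)). Qed.
Lemma pure0l (d : A) : pure 0 d = 0.
Proof. by apply: (addrI (pure 0 d)); rewrite -pureDl !addr0. Qed.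
Lemma pure0r (c : A) : pure c 0 = 0.
Proof. by apply: (addrI (pure c 0)); rewrite -pureDr !addr0. Qed.
Lemma pureZr r (c d : A) : pure c (r *: d) = r *: pure c d.
Proof. by have := (bilin_pure A).1 c r d 0; rewrite !addr0 pure0r addr0. Qed.

(** The weight w component of c (x) d: for c of weight i it is c tensored with the part of d of
    weight w - i, and additivity in c does the rest. *)
Lemma comp_pair_exists w d : exists f : A -> env A, {morph f : c c' / c + c'} /\
  forall i c, gA i c -> f c = pure c (part (w - i) d).
Proof.
apply: (graded_extension gr (h := fun i c => pure c (part (w - i) d))).
by move=> i c c'; apply: pureDl.
Qed.

Definition comp_pair w c d : env A := projT1 (cid (comp_pair_exists w d)) c.
Lemma comp_pairD w d : {morph comp_pair w ^~ d : c c' / c + c'}.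
Proof. by case: (projT2 (cid (comp_pair_exists w d))). Qed.
Lemma comp_pair_hom w d i c : gA i c -> comp_pair w c d = pure c (part (w - i) d).
Proof. by case: (projT2 (cid (comp_pair_exists w d))) => _; apply. Qed.
Lemma comp_pair0 w d : comp_pair w 0 d = 0.
Proof. by rewrite (comp_pair_hom _ _ (grading0 gr 0)) pure0l. Qed.

Lemma comp_pair_bilin w : bilin (comp_pair w).
Proof.
split=> [c r d d'|d r c c'].
  elim/(grading_ind gr): c => [|c c' hc hc'|i c ic].
  - by rewrite !comp_pair0 scaler0 addr0.
  - by rewrite !comp_pairD hc hc' scalerDr addrACA.
  by rewrite !(comp_pair_hom _ _ ic) partD partZ pureDr pureZr.
rewrite comp_pairD; congr (_ + _).
elim/(grading_ind gr): c => [|e e' he he'|i e ie].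
- by rewrite scaler0 comp_pair0 scaler0.
- by rewrite scalerDr !comp_pairD he he' scalerDr.
by rewrite (comp_pair_hom _ _ ie) (comp_pair_hom _ _ (gAZ r ie)) pureZl.
Qed.

Lemma comp_exists w : exists f : env A -> env A,
  linear f /\ forall c d, f (pure c d) = comp_pair w c d.
Proof. by have [f [fE _]] := env_universal (comp_pair_bilin w); exists f. Qed.

Definition comp w : env A -> env A := projT1 (cid (comp_exists w)).

Lemma compD w : {morph comp w : e e' / e + e'}.
Proof.
move=> e e'; case: (projT2 (cid (comp_exists w))) => /(_ 1 e e') + _.
by rewrite !scale1r.
Qed.
Lemma comp0 w : comp w 0 = 0.
Proof. by apply: (addrI (comp w 0)); rewrite -compD !addr0. Qed.

Lemma comp_pure w i j c d : gA i c -> gA j d ->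
  comp w (pure c d) = if i + j == w then pure c d else 0.
Proof.
move=> ic jd; case: (projT2 (cid (comp_exists w))) => _ /(_ c d); rewrite -/(comp w) => ->.
rewrite (comp_pair_hom _ _ ic) (part_hom _ jd).
have -> : (j == w - i) = (i + j == w) by rewrite eq_sym subr_eq addrC eq_sym.
by case: eqP => // _; apply: pure0r.
Qed.

(** Restricted to pure tensors: these are closed under products and span additively, which is what
    the inductions use. *)
Definition hom_pure i (e : env A) : Prop := exists i1 i2 c d,
  [/\ gA i1 c, gA i2 d, i = i1 + i2 & e = pure c d].

Lemma hom_pure_ind (p : env A -> Prop) : p 0 -> (forall e e', p e -> p e' -> p (e + e')) ->
  (forall i e, hom_pure i e -> p e) -> forall e, p e.
Proof.
move=> p0 pD ph; apply: env_ind => // c d.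
elim/(grading_ind gr): c => [|c c' hc hc'|i c ic]; first by rewrite pure0l.
  by rewrite pureDl; apply: pD.
elim/(grading_ind gr): d => [|d d' hd hd'|j d jd]; first by rewrite pure0r.
  by rewrite pureDr; apply: pD.
by apply: (ph (i + j)); exists i, j, c, d.
Qed.

Lemma comp_hom i w e : hom_pure i e -> comp w e = if i == w then e else 0.
Proof. by case=> i1 [i2 [c [d [ic jd -> ->]]]]; apply: comp_pure. Qed.

Lemma hom_pureM i j e f : hom_pure i e -> hom_pure j f -> hom_pure (i + j) (e * f).
Proof.
case=> i1 [i2 [c [d [ic jd -> ->]]]] [j1 [j2 [c' [d' [ic' jd' -> ->]]]]].
exists (i1 + j1), (j2 + i2), (c * c'), (d' * d); split; rewrite ?pureM //.
- exact: gAM.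
- exact: gAM.
by rewrite [j2 + i2]addrC addrACA.
Qed.

Lemma comp_mul i h w e : hom_pure i h -> comp (i + w) (h * e) = h * comp w e.
Proof.
move=> hi; elim/hom_pure_ind: e => [|e e' he he'|j e je].
- by rewrite mulr0 !comp0 mulr0.
- by rewrite mulrDr !compD he he' mulrDr.
rewrite (comp_hom _ je) (comp_hom _ (hom_pureM hi je)) (inj_eq (addrI i)).
by case: eqP => // _; rewrite mulr0.
Qed.

Lemma comp_act w i e m : gA i m -> gA (w + i) (comp w e *: (m : diagonal_bimodule A)).
Proof.
move=> im; elim/hom_pure_ind: e => [|e e' he he'|j e je].
- by rewrite comp0 scale0r; apply: (grading0 gr).
- by rewrite compD scalerDl; apply: gradingD.
rewrite (comp_hom _ je); case: eqP => [<-|_]; last by rewrite scale0r; apply: (grading0 gr).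
case: je => i1 [i2 [c [d [ic jd -> ->]]]].
rewrite pure_act; have -> : i1 + i2 + i = i1 + i + i2 by rewrite addrAC.
by apply: gAM => //; apply: gAM.
Qed.

Lemma comp_aug w e :
  comp w e *: (1 : diagonal_bimodule A) = part w (e *: (1 : diagonal_bimodule A)).
Proof.
elim/hom_pure_ind: e => [|e e' he he'|j e je].
- by rewrite comp0 !scale0r part0.
- by rewrite compD !scalerDl he he' partD.
rewrite (comp_hom _ je).
case: je => i1 [i2 [c [d [ic jd jE ->]]]].
rewrite pure_act mulr1 (part_hom _ (gAM ic jd)) -jE.
by case: eqP => // _; [rewrite pure_act mulr1 | rewrite scale0r].
Qed.

(** Homogeneity of weight r, phrased as a shift of components under multiplication. In this form it
    passes to sums and products and matches the fields of [tate_grading]. *)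
Definition comp_homog r (t : env A) : Prop :=
  forall w e, comp w (e * t) = comp (w - r) e * t.

Lemma homog_pure i t : hom_pure i t -> comp_homog i t.
Proof.
by move=> it w e; rewrite mulrC -{1}(subrKC i w) comp_mul // mulrC.
Qed.
Lemma homogD r s t : comp_homog r s -> comp_homog r t -> comp_homog r (s + t).
Proof. by move=> hs ht w e; rewrite mulrDr compD hs ht mulrDr. Qed.
Lemma homogN r t : comp_homog r t -> comp_homog r (- t).
Proof.
move=> ht w e; rewrite mulrN; have h : comp w (- (e * t)) = - comp w (e * t).
  by apply: (addrI (comp w (e * t))); rewrite -compD !subrr comp0.
by rewrite h ht mulrN.
Qed.
Lemma homogM r r' s t : comp_homog r s -> comp_homog r' t -> comp_homog (r + r') (s * t).
Proof.
by move=> hs ht w e; rewrite mulrA ht hs mulrA opprD addrA addrAC.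
Qed.
Lemma homog0 r : comp_homog r 0.
Proof. by move=> w e; rewrite !mulr0 comp0. Qed.
Lemma homog1 : comp_homog 0 1.
Proof. by move=> w e; rewrite !mulr1 subr0. Qed.
Lemma homogX r t n : comp_homog r t -> comp_homog (n%:Z * r) (t ^+ n).
Proof.
move=> ht; elim: n => [|n IH]; first by rewrite mul0r; apply: homog1.
by rewrite exprS intS mulrDl mul1r; apply: homogM.
Qed.
Lemma homog_sum r n (t : 'I_n -> env A) :
  (forall i, comp_homog r (t i)) -> comp_homog r (\sum_i t i).
Proof.
by move=> h; elim/big_ind: _ => [|s s'|i _]; [apply: homog0 | apply: homogD | apply: h].
Qed.

(** Every summand s^(n-1-i) t^i has weight (n - 1) r. *)
Lemma homog_divdiff r n s t : (0 < n)%N -> comp_homog r s -> comp_homog r t ->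
  comp_homog (n%:Z * r - r) (divdiff n s t).
Proof.
move=> n0 hs ht; apply: homog_sum => i.
have -> : n%:Z * r - r = (n.-1 - i)%N%:Z * r + i%:Z * r.
  rewrite -mulrDl -PoszD subnK; last by case: n n0 i => // n _ i; apply: (leq_ord i).
  by rewrite -subn1 -subzn // mulrBl mul1r.
by apply: homogM; apply: homogX.
Qed.

Variables (a b : nat) (x y : A).
Hypotheses (a_gt0 : (0 < a)%N) (b_gt0 : (0 < b)%N) (gx : gA a%:Z x) (gy : gA b%:Z y).

Let homog_l i c : gA i c -> comp_homog i (envl c).
Proof. by move=> h; apply: homog_pure; exists i, 0, c, 1; rewrite addr0. Qed.
Let homog_r i c : gA i c -> comp_homog i (envr c).
Proof. by move=> h; apply: homog_pure; exists 0, i, 1, c; rewrite add0r. Qed.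

Lemma gAX i c n : gA i c -> gA (n%:Z * i) (c ^+ n).
Proof.
move=> h; elim: n => [|n IH]; first by rewrite mul0r; apply: gA1.
by rewrite exprS intS mulrDl mul1r; apply: gAM.
Qed.

Lemma env_tate_grading : @tate_grading k (env A) (diagonal_bimodule A) a b
  (xl x) (yl y) (uu x) (vv y) (PP b x) (QQ a y) (1 : diagonal_bimodule A)
  comp hom_pure gA part.
Proof.
have comp_eq w w' e : w = w' -> comp w e = comp w' e by move->.
split.
- exact: compD.
- exact: comp_mul.
- exact: hom_pure_ind.
- by move=> w; apply: (grading0 gr).
- by move=> w m m'; apply: gradingD.
- move=> w c m h; have -> : c%:A *: m = c *: (m : A) :> A; last exact: gAZ.
  have -> : c%:A = pure (c%:A : A) 1 :> env A by rewrite pureZl.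
  by rewrite pure_act mulr1 -scalerAl mul1r.
- exact: comp_act.
- exact: comp_aug.
- by move=> w m h; rewrite (part_hom _ h) eqxx.
- by apply: homogD; [apply: homog_r | apply: homogN; apply: homog_l].
- by apply: homogD; [apply: homog_r | apply: homogN; apply: homog_l].
- move=> w e; rewrite (homogN (homog_divdiff b_gt0 (homog_r gx) (homog_l gx))).
  by congr (_ * _); apply: comp_eq; ring.
- move=> w e; rewrite (homog_divdiff a_gt0 (homog_r gy) (homog_l gy)).
  by congr (_ * _); apply: comp_eq; ring.
move=> i j; rewrite -[X in gA _ X]/(mu _) rmorphM !rmorphXn /= !mu_envl.
by apply: gAM; apply: gAX.
Qed.
End EnvGrading.

Lemma sum_var_deg (m : 'X_{1..5}) : (\sum_i m i * var_deg i)%N = mono_deg m.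
Proof.
rewrite !big_ord_recl big_ord0 /var_deg !(tnth_nth 0%N) /= /mono_deg.
rewrite !muln0 !muln1 muln2 !add0n addn0 addnA.
by congr (m _ + m _ + (m _).*2)%N; apply: val_inj.
Qed.

Lemma sum_var_wt a b (m : 'X_{1..5}) : \sum_i var_wt a b i *+ m i = mono_wt a b m.
Proof.
rewrite !big_ord_recl big_ord0 /var_wt !(tnth_nth 0) /= /mono_wt PoszM.
have E (z : int) n : z *+ n = n%:Z * z by rewrite -mulr_natl natz.
rewrite mul0rn add0r addr0 !E mulrN !addrA.
by congr (_ * _ + _ * _ + _ * _ - _ * _); congr (Posz (m _)); apply: val_inj.
Qed.

(** * The isomorphism and its compatibility with degree and weight *)

Section Isomorphism.
Variables (k : fieldType) (E : comAlgType k) (M : lmodType E) (a b : nat).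
Variables (x y u v P Q P' Q' : E) (m1 : M).
Hypothesis td : tate_data a b x y u v P Q P' Q' m1.
Hypothesis gen_iota : forall m : M, exists p, iota x y p *: m1 = m.
Hypothesis ker_iota : forall p, iota x y p *: m1 = 0 -> exists r, p = r * curve k a b.
Hypotheses (a_gt0 : (0 < a)%N) (b_gt0 : (0 < b)%N).
Variables (R : projective_resolution M) (f0 : forall n, {linear R n -> tate td n}).
Hypothesis f0c : chain_map f0.

Local Notation I := (HH_ideal k a_gt0 b_gt0).
Local Notation Qt := (HH_presentation k a_gt0 b_gt0).
Local Notation proj := (quot_proj I).
Local Notation Phi := (Phi td).

Definition iso_fun (q : Qt) : Ext R :=
  Ext_pullback f0c (Phi (repr (q : {ideal_quot I}))).

Lemma iso_proj f : iso_fun (proj f) = Ext_pullback f0c (Phi f).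
Proof.
rewrite /iso_fun; congr (Ext_pullback f0c _); apply/eqP; rewrite -subr_eq0 -rmorphB.
apply/eqP; apply: (@Phi_ideal _ _ _ _ _ _ _ _ _ _ _ _ _ _ td a_gt0 b_gt0).
by apply/quot_proj_eq; rewrite /quot_proj reprK.
Qed.

Lemma iso_linear : linear iso_fun.
Proof.
move=> c p q; have [f ->] := quot_projP p; have [g ->] := quot_projP q.
have -> : c *: proj f + proj g = proj (c *: f + g).
  by rewrite quot_projD -quot_scaleE.
rewrite !iso_proj -Ext_pullback_linear; congr (Ext_pullback f0c _).
rewrite rmorphD /=; congr (_ + _).
by rewrite -mulr_algl rmorphM /= Phi_alg mulr_algl.
Qed.

Lemma iso_monoid : monoid_morphism iso_fun.
Proof.
split=> [|p q].
  have -> : (1 : Qt) = proj 1 by rewrite /quot_proj rmorph1.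
  by rewrite iso_proj rmorph1; apply: Ext_pullback1.
have [f ->] := quot_projP p; have [g ->] := quot_projP q.
rewrite -quot_projM !iso_proj rmorphM.
exact: Ext_pullbackM.
Qed.

Lemma iso_bij : bijective iso_fun.
Proof.
have [w wK Kw] := Ext_pullback_bij f0c.
pose h (z : Ext R) := projT1 (cid (Phi_surj (td := td) gen_iota (w z))).
have hE z : Phi (h z) = w z by apply: (projT2 (cid (Phi_surj (td := td) gen_iota (w z)))).
exists (fun z => proj (h z)) => [q|z]; last by rewrite iso_proj hE Kw.
have [f ->] := quot_projP q; rewrite iso_proj; apply/quot_proj_eq.
by apply: (Phi_ker (td := td) gen_iota ker_iota); rewrite rmorphB /= hE wK subrr.
Qed.

(** Reduces the statements on degrees and weights to single monomials. *)
Lemma iso_expand f : iso_fun (proj f) =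
  \sum_(m <- msupp f) f@_m *: Ext_pullback f0c (Phi 'X_[m]).
Proof.
rewrite iso_proj {1}[f]mpolyE.
have pl := Ext_pullback_linear f0c.
have pD X Z : Ext_pullback f0c (X + Z) = Ext_pullback f0c X + Ext_pullback f0c Z.
  by have := pl 1 X Z; rewrite !scale1r.
have p0 : Ext_pullback f0c 0 = 0.
  by apply: (addrI (Ext_pullback f0c 0)); rewrite -pD !addr0.
rewrite rmorph_sum (big_morph _ pD p0); apply: eq_bigr => m _ /=.
rewrite -mulr_algl rmorphM /= Phi_alg mulr_algl.
by have := pl f@_m (Phi 'X_[m]) 0; rewrite p0 !addr0.
Qed.

Lemma iso_deg n f : deg_homogeneous n f ->
  has_rep (fun _ : R n -> M => True) (iso_fun (proj f)).
Proof.
move=> fn; rewrite iso_expand; apply: has_rep_sum => // m mf.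
rewrite -(fn m mf) sum_var_deg.
by apply: (mono_rep f0c (good := fun n _ => True)) => // _; exists f0.
Qed.

Variables (comp : int -> E -> E) (hE : int -> E -> Prop).
Variables (gM : int -> M -> Prop) (prM : int -> M -> M).
Hypothesis tg : tate_grading a b x y u v P Q m1 comp hE gM prM.
Variable g : forall n, int -> R n -> Prop.
Hypotheses (gR : forall n, is_grading (@g n))
  (gR_act : forall n i h w p, hE i h -> g w p -> @g n (i + w) (h *: p))
  (gR_d : forall n w p, g w p -> @g n w (res_d R n p))
  (gR_aug : forall w p, @g 0%N w p -> gM w (res_aug R p)).

Lemma iso_bideg n w f : deg_homogeneous n f -> wt_homogeneous a b w f ->
  has_rep (fun z : R n -> M => forall s p, g s p -> gM (s + w) (z p)) (iso_fun (proj f)).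
Proof.
move=> fn fw; rewrite iso_expand.
pose good n (z : R n -> M) := forall s p, g s p -> gM (s + w) (z p).
apply: has_rep_sum => [s p _|c z z' gz gz' s p sp|m mf].
- exact: (tg_M0 tg).
- apply: (tg_MD tg); last exact: gz'.
  by apply: (tg_MZ tg); apply: gz.
rewrite -(fn m mf) sum_var_deg; apply: (mono_rep f0c (good := good)) => [s p _|h].
  exact: (tg_M0 tg).
(* The representative is taken along the weight-preserving [t]; the class is the one obtained from
   [f0]. *)
have [t [tc tE]] := graded_chain_map td tg gR gR_act gR_d gR_aug.
exists t => // z zE s p sp; rewrite zE; have [q ->] := tE _ _ _ sp.
have -> : w = mono_wt a b m by rewrite -(fw m mf) sum_var_wt.
exact: (mono_weight tg s q h).
Qed.
End Isomorphism.

Section CurveHochschild.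
Variables (k : fieldType) (A : comAlgType k) (a b : nat) (x y : A).
Variable co : nat -> nat -> A -> k.
Hypothesis cA : curve_algebra a b x y co.
Hypothesis x_reg : forall c, x * c = 0 -> c = 0.
Hypotheses (a_unit : a%:R != 0 :> k) (b_unit : b%:R != 0 :> k).
Variable gA : int -> A -> Prop.
Hypotheses (gr : is_grading gA)
  (gAZ : forall w (r : k) c, gA w c -> gA w (r *: c))
  (gAM : forall i j c d, gA i c -> gA j d -> gA (i + j) (c * d))
  (gA1 : gA 0 1) (gx : gA a%:Z x) (gy : gA b%:Z y).
Hypotheses (a_gt0 : (0 < a)%N) (b_gt0 : (0 < b)%N).
Variable P : projective_resolution (diagonal_bimodule A).

Local Notation td := (curve_tate_data cA x_reg a_unit b_unit).
Local Notation I := (HH_ideal k a_gt0 b_gt0).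
Local Notation Qt := (HH_presentation k a_gt0 b_gt0).
Local Notation proj := (quot_proj I).

Theorem curve_HH : exists phi : {lrmorphism Qt -> HH P},
  [/\ bijective phi,
      forall n f, deg_homogeneous n f -> HH_deg n (phi (proj f)) &
      forall g, graded_resolution gA g ->
      forall n w f, deg_homogeneous n f -> wt_homogeneous a b w f ->
        HH_bideg gA g n w (phi (proj f))].
Proof.
have [u uc] := @chain_map_exists k (env A) (diagonal_bimodule A) P (tate td).
pose phi : {lrmorphism Qt -> HH P} := HB.pack (@iso_fun _ _ _ _ _ _ _ _ _ _ _ _ _ _ td a_gt0 b_gt0 P u uc)
  (GRing.isLinear.Build k Qt (HH P) _ _ (@iso_linear _ _ _ _ _ _ _ _ _ _ _ _ _ _ td a_gt0 b_gt0 P u uc))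
  (GRing.isMonoidMorphism.Build Qt (HH P) _ (@iso_monoid _ _ _ _ _ _ _ _ _ _ _ _ _ _ td a_gt0 b_gt0 P u uc)).
exists phi; split.
- exact: (@iso_bij _ _ _ _ _ _ _ _ _ _ _ _ _ _ td (curve_gen_iota cA) (curve_ker_iota cA) a_gt0 b_gt0 P u uc).
- move=> n f fn; have [z zE [z0 _]] := @iso_deg _ _ _ _ _ _ _ _ _ _ _ _ _ _ td a_gt0 b_gt0 P u uc n f fn.
  by exists z.
move=> g gg n w f fn fw.
have tg := env_tate_grading gr gAZ gAM gA1 a_gt0 b_gt0 gx gy.
have gact n' i e v p : hom_pure gA i e -> g n' v p -> g n' (i + v) (e *: p).
  case=> i1 [i2 [c [d [ic jd -> ->]]]] vp; exact: (graded_act gg).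
have [z zE zg] := @iso_bideg _ _ _ _ _ _ _ _ _ _ _ _ _ _ td a_gt0 b_gt0 P u uc
  _ _ _ _ tg g (graded_obj gg) gact (graded_d gg) (graded_aug gg) n w f fn fw.
by exists z.
Qed.
End CurveHochschild.

(** * The numerical semigroup algebra *)

Section SemigroupCurve.
Variables (k : fieldType) (a b : nat).
Hypotheses (a_gt0 : (0 < a)%N) (b_gt0 : (0 < b)%N) (ab_coprime : coprime a b).
Local Notation A := (sg_algebra k a b).

Fact sg_mulC : commutative (@GRing.mul A).
Proof. by move=> c d; apply: val_inj; rewrite !rmorphM mulrC. Qed.

Lemma sg_val_sum (I : Type) (r : seq I) (F : I -> A) :
  sg_val (\sum_(i <- r) F i) = \sum_(i <- r) sg_val (F i).
Proof. by apply: (big_morph (@sg_val k a b)). Qed.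

Definition sg_com : comAlgType k :=
  HB.pack A (GRing.PzRing_hasCommutativeMul.Build A sg_mulC).

Fact sg_memX (i : 'I_2) : (if i == 0 then 'X^a else 'X^b) \in @sg_pred k a b.
Proof. by apply/asboolP; exists 'X_i; rewrite /sg_eval mmapX mmap1U. Qed.

Definition sgx : sg_com := SgAlgebra (sg_memX 0).
Definition sgy : sg_com := SgAlgebra (sg_memX 1).

Lemma sg_val_xy i j : sg_val (sgx ^+ i * sgy ^+ j : sg_com) = 'X^(a * i + b * j).
Proof.
rewrite -[LHS]/(val (sgx ^+ i * sgy ^+ j : A)) rmorphM !rmorphXn /=.
by rewrite exprD -!exprM.
Qed.

Definition sg_co (i j : nat) (c : sg_com) : k := (sg_val c)`_(a * i + b * j).

(** Modulo a, equality of the sums gives b j = b j'; as b is prime to a, the number a divides the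
    difference of j and j', which is smaller than a. *)
Lemma semigroup_unique i j i' j' : (j < a)%N -> (j' < a)%N ->
  (a * i + b * j == a * i' + b * j')%N = (i == i') && (j == j').
Proof.
move=> ja ja'; apply/eqP/andP => [e|[/eqP -> /eqP ->]//].
have jj' : j = j'.
  have : (b * j = b * j' %[mod a])%N.
    by rewrite -(modnMDl i (b * j) a) -(modnMDl i' (b * j') a) ![(_ * a)%N]mulnC e.
  move/eqP; wlog le : j j' ja ja' {e} / (j <= j')%N => [h|].
    case: (leqP j j') => [|/ltnW] le' e'; first exact: h.
    by apply/esym; apply: h => //; rewrite eq_sym.
  rewrite eq_sym eqn_mod_dvd ?leq_mul2l ?le ?orbT // -mulnBr Gauss_dvdr // => d.
  have : (j' - j < a)%N by apply: leq_ltn_trans ja'; apply: leq_subr.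
  move=> lt; apply/eqP; rewrite eqn_leq le /= -subn_eq0.
  by apply: contraTT d => nz; rewrite gtnNdvd // lt0n.
split; apply/eqP => //; move: e; rewrite jj' => /addIn /eqP.
by rewrite eqn_mul2l eqn0Ngt a_gt0 /= => /eqP.
Qed.

Lemma sg_curve : curve_algebra a b sgx sgy sg_co.
Proof.
split=> //.
- by apply: val_inj; have := sg_val_xy b 0; have := sg_val_xy 0 a;
    rewrite !expr0 mulr1 mul1r !muln0 addn0 add0n => /= -> ->; rewrite mulnC.
- move=> c; have /asboolP [q qE] := valP c.
  exists (mmap (polyC \o polyC) (fun i : 'I_2 => if i == 0 then 'X%:P else 'X) q).
  apply: val_inj; rewrite /= -[LHS]/(sg_val c) qE /sg_eval /mmap rmorph_sum sg_val_sum.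
  apply: eq_bigr => m _.
  rewrite rmorphM /= ev2CC mulr_algl.
  rewrite -[RHS]/(sg_val (_ *: _ : A)) /= -mul_polyC; congr (_ * _).
  rewrite /mmap1 !big_ord_recl !big_ord0 !mulr1 /= rmorphM !rmorphXn /= ev2CX ev2X.
  by apply/esym/(etrans (sg_val_xy _ _)); rewrite exprD !exprM.
- by move=> i j c d; rewrite /sg_co -coefD.
- by move=> i j r c; rewrite /sg_co -coefZ.
- move=> i j i' j' ja ja'; rewrite /sg_co sg_val_xy coefXn eq_sym.
  by rewrite eq_sym semigroup_unique.
Qed.

Lemma sgx_reg (c : sg_com) : sgx * c = 0 -> c = 0.
Proof.
move=> /(congr1 (@sg_val k a b)) h; apply: val_inj => /=; apply/eqP.
move: h; rewrite -[LHS]/('X^a * sg_val c) => /eqP.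
by rewrite mulf_eq0 (negbTE (monic_neq0 (monicXn _ _))).
Qed.

Lemma sg_wt0 w : @sg_wt k a b w 0.
Proof. by move=> n; rewrite coef0 eqxx. Qed.

Lemma sg_wtB w c d : @sg_wt k a b w c -> @sg_wt k a b w d -> @sg_wt k a b w (c - d).
Proof.
move=> hc hd n; rewrite coefB; have [c0|/hc //] := eqVneq (sg_val c)`_n 0.
by rewrite c0 sub0r oppr_eq0 => /hd.
Qed.

Lemma sg_wtD w c d : @sg_wt k a b w c -> @sg_wt k a b w d -> @sg_wt k a b w (c + d).
Proof.
move=> hc hd n; rewrite coefD; have [c0|/hc //] := eqVneq (sg_val c)`_n 0.
by rewrite c0 add0r => /hd.
Qed.

Lemma sg_wtZ w (r : k) c : @sg_wt k a b w c -> @sg_wt k a b w (r *: c).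
Proof.
move=> hc n; rewrite coefZ => h; apply: hc; apply: contra h => /eqP ->.
by rewrite mulr0.
Qed.

Lemma sg_wtM i j c d : @sg_wt k a b i c -> @sg_wt k a b j d -> @sg_wt k a b (i + j) (c * d).
Proof.
move=> hc hd n; rewrite coefM => h.
have [[l lE]|h'] := pselect (exists l : 'I_n.+1, (sg_val c)`_l * (sg_val d)`_(n - l) != 0).
  move: lE; rewrite mulf_eq0 negb_or => /andP[/hc <- /hd <-].
  by rewrite -PoszD subnKC // -ltnS.
case/negP: h; apply/eqP/big1 => l _; apply/eqP/negPn/negP => hl.
by apply: h'; exists l.
Qed.

Lemma sg_wt_mono i j : @sg_wt k a b ((a * i + b * j)%N%:Z) (sgx ^+ i * sgy ^+ j : sg_com).
Proof. by move=> n; rewrite sg_val_xy coefXn; have [-> //|_] := eqVneq n _; rewrite eqxx. Qed.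

Lemma sg_grading : is_grading (@sg_wt k a b).
Proof.
split; [exact: sg_wt0 | exact: sg_wtB | |].
  have spD (c d : A) :
      (exists s e, [/\ uniq s, forall w, @sg_wt k a b w (e w) & c = \sum_(w <- s) e w]) ->
      (exists s e, [/\ uniq s, forall w, @sg_wt k a b w (e w) & d = \sum_(w <- s) e w]) ->
      exists s e, [/\ uniq s, forall w, @sg_wt k a b w (e w) & c + d = \sum_(w <- s) e w].
    case=> s [e [us ew ->]] [s' [e' [us' ew' ->]]].
    pose t := undup (s ++ s').
    have ut : uniq t by apply: undup_uniq.
    exists t, (fun w => (if w \in s then e w else 0) + (if w \in s' then e' w else 0)).
    split=> //; first by move=> w; apply: sg_wtD; case: ifP => _ //; apply: sg_wt0.
    rewrite big_split; congr (_ + _); apply: sum_extend0 => // w ws;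
    by rewrite mem_undup mem_cat ws ?orbT.
  have sp0 : exists s e, [/\ uniq s, forall w, @sg_wt k a b w (e w) &
      (0 : A) = \sum_(w <- s) e w].
    by exists [::], (fun=> 0); split=> // [w|]; [apply: sg_wt0 | rewrite big_nil].
  have spsum n (F : 'I_n -> A) : (forall i, exists s e, [/\ uniq s,
      forall w, @sg_wt k a b w (e w) & F i = \sum_(w <- s) e w]) ->
      exists s e, [/\ uniq s, forall w, @sg_wt k a b w (e w) & \sum_i F i = \sum_(w <- s) e w].
    by move=> h; elim/big_ind: _ => // c d; apply: spD.
  move=> c; have [p pE] := curve_gen sg_curve c.
  have -> : c = \sum_(j < size p) \sum_(i < size p`_j) (p`_j`_i *: (sgx ^+ i * sgy ^+ j : sg_com) : A).
    rewrite pE ev2E; apply: eq_bigr => j _; apply: eq_bigr => i _.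
    by rewrite -mulrA mulr_algl.
  apply: (spsum _ _) => j; apply: (spsum _ _) => i.
  exists [:: (a * i + b * j)%N%:Z], (fun w => if w == (a * i + b * j)%N%:Z then
     p`_j`_i *: (sgx ^+ i * sgy ^+ j : sg_com) else 0 : A).
  split=> // [w|]; last by rewrite big_seq1 eqxx.
  by case: eqP => [->|_]; [apply: sg_wtZ; apply: sg_wt_mono | apply: sg_wt0].
(* A nonzero coefficient of degree n in [c w] forces w = n, so in degree n no other summand
   contributes to the vanishing sum. *)
move=> s c us cw e w ws; apply: val_inj; apply/polyP => n; rewrite coef0.
have [//|h] := eqVneq (sg_val (c w))`_n 0.
have nw := cw w n h.
have := congr1 (fun d : A => (sg_val d)`_n) e; rewrite /= sg_val_sum coef_sum /=.
rewrite (bigD1_seq w) //= big1 ?addr0 ?coef0 // => v vw.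
apply/eqP/negPn/negP => /cw; rewrite nw => wv; by rewrite wv eqxx in vw.
Qed.
End SemigroupCurve.

Lemma natr_neq0 (k : fieldType) n : (0 < n)%N ->
  (forall p, p \in [pchar k] -> ~~ (p %| n)%N) -> n%:R != 0 :> k.
Proof.
move=> n0 h; apply/negP => n0'.
have [p pk pn] : exists2 p, p \in [pchar k] & (p %| n)%N.
  have [p pch] := natf0_pchar n0 n0'; exists p => //.
  by rewrite (dvdn_pcharf pch).
by have := h p pk; rewrite pn.
Qed.

Theorem theoremA (k : fieldType) (a b : nat) (a_gt0 : (0 < a)%N) (b_gt0 : (0 < b)%N)
  (ab_coprime : coprime a b)
  (char_a : forall p, p \in [pchar k] -> ~~ (p %| a)%N)
  (char_b : forall p, p \in [pchar k] -> ~~ (p %| b)%N)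
  (P : projective_resolution (diagonal_bimodule (sg_algebra k a b))) :
  exists phi : {lrmorphism HH_presentation k a_gt0 b_gt0 -> HH P},
  [/\ bijective phi,
      forall n f, deg_homogeneous n f -> HH_deg n (phi (quot_proj _ f)) &
      forall g, graded_resolution (@sg_wt k a b) g ->
      forall n w f, deg_homogeneous n f -> wt_homogeneous a b w f ->
        HH_bideg (@sg_wt k a b) g n w (phi (quot_proj _ f))].
Proof.
have wt1 : @sg_wt k a b 0 (1 : sg_com k a b).
  by have := @sg_wt_mono k a b 0 0; rewrite !muln0 !expr0 mulr1.
have wtx : @sg_wt k a b a%:Z (sgx k a b).
  by have := @sg_wt_mono k a b 1 0; rewrite muln0 addn0 muln1 expr1 expr0 mulr1.
have wty : @sg_wt k a b b%:Z (sgy k a b).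
  by have := @sg_wt_mono k a b 0 1; rewrite muln0 add0n muln1 expr1 expr0 mul1r.
exact (@curve_HH k (sg_com k a b) a b (sgx k a b) (sgy k a b) (@sg_co k a b)
  (@sg_curve k a b a_gt0 b_gt0 ab_coprime) (@sgx_reg k a b)
  (natr_neq0 a_gt0 char_a) (natr_neq0 b_gt0 char_b) (@sg_wt k a b)
  (@sg_grading k a b a_gt0 b_gt0 ab_coprime) (@sg_wtZ k a b) (@sg_wtM k a b)
  wt1 wtx wty a_gt0 b_gt0 P).
Qed.
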